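(* The SLC problem with an arbitrary number $m$ of machines (part of the input) and $k=2$ linear constraints can be solved in $O(n^4L)$ time. Specifically, the following LP-based algorithm is optimal: find an optimal basic feasible solution $(\bm{x},t)$ of the linear program: minimize $t$ subject to $A\bm{x}\ge\bm{b}$ (the two constraints), $\sum_{i=1}^n x_i\le mt$, $x_i\le t$ for all $i$, $\bm{x},t\ge 0$; use $\bm{x}$ as processing times; place each job with $x_i=t$ alone on its own machine; for the remaining (at most two) jobs with $0<x_i<t$, if only one machine is idle put them both on it, otherwise put each on its own machine; return $\bm{x}$ and makespan $t$.
   Context: The SLC problem: there are $m$ identical parallel machines and $n$ jobs. The processing times $\bm{x}=(x_1,\ldots,x_n)$ are decision variables and must satisfy $A\bm{x}\ge\bm{b}$, $\bm{x}\ge 0$, with $A\in\mathbb{R}^{k\times n}$, $\bm{b}\in\mathbb{R}^k$ given. The goal is to choose feasible processing times and an assignment of each job to exactly one machine so as to minimize the makespan, i.e. the maximum over machines of the total processing time of the jobs assigned to that machine. $L$ denotes the bit length of the input. Basic feasible solutions are with respect to the standard form obtained by adding slack variables. *)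

(* Defs.v *)
From HB Require Import structures.
From mathcomp Require Import all_boot all_order all_algebra.

Set Implicit Arguments.
Unset Strict Implicit.
Unset Printing Implicit Defensive.

Import Order.TTheory GRing.Theory Num.Theory.
Local Open Scope ring_scope.

(** * Scheduling under linear constraints (SLC) *)

Section SLC.
Variables (R : realFieldType) (m k n : nat).
Implicit Types (A : 'M[R]_(k, n)) (b : 'cV[R]_k) (x : 'cV[R]_n) (t : R).
Implicit Type sigma : {ffun 'I_n -> 'I_m}.

Definition slc_feasible A b x : Prop :=
  (forall r, b r 0 <= (A *m x) r 0) /\ (forall i, 0 <= x i 0).

Definition load x sigma (p : 'I_m) : R := \sum_(i | sigma i == p) x i 0.

(* The default value 0 is harmless: it is only used with [x >= 0]. *)
Definition makespan x sigma : R := \big[Num.max/0]_(p < m) load x sigma p.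

Definition slc_optimal A b x sigma : Prop :=
  slc_feasible A b x /\
  forall x' sigma', slc_feasible A b x' -> makespan x sigma <= makespan x' sigma'.

(** * The linear program *)

Definition lp_feasible A b x t : Prop :=
  [/\ forall r, b r 0 <= (A *m x) r 0,
      \sum_i x i 0 <= m%:R * t,
      forall i, x i 0 <= t,
      forall i, 0 <= x i 0 &
      0 <= t].

Definition lp_optimal A b x t : Prop :=
  lp_feasible A b x t /\ forall x' t', lp_feasible A b x' t' -> t <= t'.

(* Standard form [M z = d, z >= 0].  The columns of [M] are those of
   x_1 .. x_n, then t, then the slack variables of the k + 1 + n rows:
       A x             - s = b
       sum_i x_i - m t + w = 0
       x_i - t       + u_i = 0. *)
Definition lp_std_mx A : 'M[R]_(k + (1 + n), (n + 1) + (k + (1 + n))) :=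
  row_mx
    (col_mx (row_mx A 0)
            (col_mx (row_mx (const_mx 1) (const_mx (- m%:R)))
                    (row_mx 1%:M (const_mx (- 1)))))
    (block_mx (- 1%:M) 0 0 1%:M).

Definition lp_std_rhs b : 'cV[R]_(k + (1 + n)) := col_mx b 0.

(* [f] lists the basic columns; invertibility forces [f] to be injective. *)
Definition basic_feasible p q (M : 'M[R]_(p, q)) (d : 'cV[R]_p) (z : 'cV[R]_q)
    : Prop :=
  [/\ M *m z = d,
      forall j, 0 <= z j 0 &
      exists f : 'I_p -> 'I_q,
        colsub f M \in unitmx /\ forall j, j \notin codom f -> z j 0 = 0].

Definition lp_basic_feasible A b x t : Prop :=
  exists s : 'cV[R]_(k + (1 + n)),
    basic_feasible (lp_std_mx A) (lp_std_rhs b) (col_mx (col_mx x t%:M) s).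

Definition lp_optimal_bfs A b x t : Prop :=
  lp_optimal A b x t /\ lp_basic_feasible A b x t.

(** * The placement rule *)

(* Jobs of processing time 0 never occupy a machine; in particular, when t = 0
   no job is full. *)
Definition full_jobs x t : {set 'I_n} := [set i | (0 < x i 0) && (x i 0 == t)].

Definition partial_jobs x t : {set 'I_n} := [set i | 0 < x i 0 < t].

(* Machines left idle once the full jobs have been placed. *)
Definition idle_machines x t sigma : {set 'I_m} :=
  ~: (sigma @: full_jobs x t).

Definition alone x sigma (i : 'I_n) : Prop :=
  forall j, 0 < x j 0 -> sigma j = sigma i -> j = i.

(* [sigma] is a possible outcome of the rule.  Jobs of processing time 0 may be
   assigned to any machine. *)
Definition placement x t sigma : Prop :=
  [/\ forall i, i \in full_jobs x t -> alone x sigma i,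
      forall i, i \in partial_jobs x t -> sigma i \in idle_machines x t sigma &
      #|idle_machines x t sigma| != 1%N ->
        forall i, i \in partial_jobs x t -> alone x sigma i].

End SLC.

Arguments slc_optimal {R} m {k n} A b x sigma.
Arguments lp_feasible {R} m {k n} A b x t.
Arguments lp_optimal {R} m {k n} A b x t.
Arguments lp_basic_feasible {R} m {k n} A b x t.
Arguments lp_optimal_bfs {R} m {k n} A b x t.

(** * Running time

   A random access machine with unit-cost arithmetic (+, -, *, /, <=) on
   rational cells, the model in which running times of linear programming
   algorithms are counted.  Every number it computes must fit in [w] bits;
   otherwise it is stuck, as it is on a division by 0 or on an address that is
   not a natural number.  There is no rounding operation. *)

Definition nat_bits (a : nat) : nat := (trunc_log 2 a).+1.

(* The final successor accounts for the sign. *)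
Definition rat_bits (v : rat) : nat :=
  (nat_bits `|numq v| + nat_bits `|denq v|).+1.

Definition memory := nat -> rat.

Definition write (s : memory) (a : nat) (v : rat) : memory :=
  fun a' => if a' == a then v else s a'.

Inductive binop := OpAdd | OpSub | OpMul | OpDiv.

Inductive expr :=
| Lit of int
| Cell of expr                   (* indirect addressing *)
| Bin of binop & expr & expr.

Inductive cmd :=
| Skip
| Assign of expr & expr          (* [Assign a e] writes [e] at address [a] *)
| Seq of cmd & cmd
| IfLe of expr & expr & cmd & cmd
| WhileLe of expr & expr & cmd.

Definition binop_sem (o : binop) (v1 v2 : rat) : option rat :=
  match o with
  | OpAdd => Some (v1 + v2)
  | OpSub => Some (v1 - v2)
  | OpMul => Some (v1 * v2)
  | OpDiv => if v2 == 0 then None else Some (v1 / v2)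
  end.

Definition address (v : rat) : option nat :=
  if v \is a Num.nat then Some (Num.truncn v) else None.

Definition fit (w : nat) (v : rat) : option rat :=
  if (rat_bits v <= w)%N then Some v else None.

Fixpoint eval (w : nat) (s : memory) (e : expr) : option rat :=
  match e with
  | Lit z => fit w z%:~R
  | Cell e1 =>
      if eval w s e1 is Some v then
        if address v is Some a then fit w (s a) else None
      else None
  | Bin o e1 e2 =>
      if (eval w s e1, eval w s e2) is (Some v1, Some v2) then
        if binop_sem o v1 v2 is Some v then fit w v else None
      else None
  end.

Fixpoint cost (e : expr) : nat :=
  match e with
  | Lit _ => 1
  | Cell e1 => (cost e1).+1
  | Bin _ e1 e2 => (cost e1 + cost e2).+1
  end.

(* [exec w c s T s']: from memory [s], [c] terminates in memory [s'] after
   exactly [T] elementary steps. *)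
Inductive exec (w : nat) : cmd -> memory -> nat -> memory -> Prop :=
| ExecSkip s : exec w Skip s 1 s
| ExecAssign s ea e va v a of
    eval w s ea = Some va & address va = Some a & eval w s e = Some v :
    exec w (Assign ea e) s (cost ea + cost e).+1 (write s a v)
| ExecSeq s s1 s2 c1 c2 T1 T2 of
    exec w c1 s T1 s1 & exec w c2 s1 T2 s2 :
    exec w (Seq c1 c2) s (T1 + T2) s2
| ExecIf s s' e1 e2 c1 c2 v1 v2 T of
    eval w s e1 = Some v1 & eval w s e2 = Some v2 &
    exec w (if v1 <= v2 then c1 else c2) s T s' :
    exec w (IfLe e1 e2 c1 c2) s ((cost e1 + cost e2).+1 + T) s'
| ExecWhileStop s e1 e2 c v1 v2 of
    eval w s e1 = Some v1 & eval w s e2 = Some v2 & ~~ (v1 <= v2) :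
    exec w (WhileLe e1 e2 c) s (cost e1 + cost e2).+1 s
| ExecWhileLoop s s1 s2 e1 e2 c v1 v2 T1 T2 of
    eval w s e1 = Some v1 & eval w s e2 = Some v2 & v1 <= v2 &
    exec w c s T1 s1 & exec w (WhileLe e1 e2 c) s1 T2 s2 :
    exec w (WhileLe e1 e2 c) s ((cost e1 + cost e2).+1 + T1 + T2) s2.

(** * Encoding of instances and of solutions *)

(* n, m, the entries of A row by row, then those of b *)
Definition slc_encode (m k n : nat) (A : 'M[rat]_(k, n)) (b : 'cV[rat]_k)
    : seq rat :=
  [:: n%:R; m%:R]
    ++ [seq A r i | r <- enum 'I_k, i <- enum 'I_n]
    ++ [seq b r 0 | r <- enum 'I_k].

Definition bit_length (inst : seq rat) : nat := \sum_(v <- inst) rat_bits v.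

Definition init_memory (inst : seq rat) : memory := fun a => nth 0 inst a.

(* Cell 0 holds 1, cell 1 the makespan, and the next 2n cells the processing
   times followed by the machine numbers. *)
Definition outputs_schedule (m n : nat) (s : memory)
    (x : 'cV[rat]_n) (t : rat) (sigma : {ffun 'I_n -> 'I_m}) : Prop :=
  [/\ s 0%N = 1,
      s 1%N = t,
      forall i : 'I_n, s (2 + i)%N = x i 0 &
      forall i : 'I_n, s (2 + n + i)%N = (sigma i : nat)%:R].

Definition outputs_infeasible (s : memory) : Prop := s 0%N = 0.

(* Main.v *)
(** If t > 0 in an optimal basic solution of the linear program, then t is basic and the
    basis leaves exactly two of the n + 3 jobs and row slacks not fixed at a bound; call
    them a and c.  Let v_i in R^3 be the coefficients of job or slack i in the two rows of
    A and in the capacity row.  The dual vector is a multiple of y = v_a x v_c, and any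
    other job l is at its upper bound t or at 0 according to the sign of y . v_l; ties are
    broken by the lexicographic perturbation of the costs, under which an optimal basis is
    found by the dual simplex method.  Hence the basis is determined by the ordered pair
    (a, c), and a pair can be tested, for both primal and dual feasibility, with O(n)
    arithmetic operations and Cramer's rule.  Trying all pairs takes O(n^3) operations, and
    every number met is a quotient of 3 x 3 determinants whose entries are sums of input
    numbers, hence has O(L) bits.

    For the placement, the capacity row gives F t + (partial jobs) <= m t when F jobs have
    length t, so that two partial jobs on a single idle machine fit within t. *)

Require Import Defs.
From mathcomp Require Import all_boot all_order all_algebra.
From mathcomp Require Import ring lra zify.
Set Implicit Arguments.
Unset Strict Implicit.
Unset Printing Implicit Defensive.
Import Order.TTheory GRing.Theory Num.Theory.
Local Open Scope ring_scope.

(** * Lexicographic dual simplex *)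

(** The two directions of the pair test rest on different facts. That a good pair gives an optimal
    solution is weak duality: y bounds t from below at every feasible point, and jobs with y . v_l =
    0 contribute nothing at either bound. The lexicographic rule yields the converse, that some pair
    is good: under ties the dual vector does not determine the set of jobs at t, so it is pinned
    down by a perturbation whose outcome can be recomputed from (a, c) alone. Comparing t and then
    the coordinates in order achieves this, because a kernel vector of the standard form is
    determined by its job and t entries. The pair is ordered since y and the determinant of (v_a,
    v_c, h), with h the column of t once saturated jobs are set to t, both change sign under
    exchange; positivity of the determinant selects the order. The case b <= 0 is separate: there t
    = 0, and t need not be basic. Time is read off the nesting of loops. Word size is controlled by
    adding exponents along expressions; the cells written hold only input entries, counters, partial
    sums of h and final quotients. *)

Lemma scale_colE (R : pzRingType) m n (a : R) (A : 'M[R]_(m, n)) i j :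
  (a *: col j A) i 0 = a * A i j.
Proof. by rewrite !mxE. Qed.

Lemma sub_colE (V : zmodType) n (w w' : 'cV[V]_n) i :
  (w - w') i 0 = w i 0 - w' i 0.
Proof. by rewrite !mxE. Qed.

Section Lexicographic.
Variables (R : realFieldType) (k : nat).
Implicit Types w : 'cV[R]_k.

(* The first nonzero entry, if any, is positive. *)
Definition lexnn w : bool :=
  [forall i : 'I_k, [forall j : 'I_k, (j < i)%N ==> (w j 0 == 0)] ==> (0 <= w i 0)].

Lemma lexnnP w :
  reflect (forall i : 'I_k, (forall j : 'I_k, (j < i)%N -> w j 0 = 0) -> 0 <= w i 0)
          (lexnn w).
Proof.
apply: (iffP forallP) => H i.
  move=> w0; apply: (implyP (H i)); apply/forallP => j; apply/implyP => ji.
  by apply/eqP/w0.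
apply/implyP => /forallP w0; apply: H => j ji.
by apply/eqP; move: (w0 j); rewrite ji.
Qed.

Lemma lexnn0 : lexnn 0.
Proof. by apply/lexnnP => i _; rewrite mxE. Qed.

(** No cancellation can hide a leading entry: where the sum vanishes, two nonnegative entries add up
    to 0, so both summands vanish as well. *)
Lemma lexnnD w1 w2 : lexnn w1 -> lexnn w2 -> lexnn (w1 + w2).
Proof.
move=> /lexnnP h1 /lexnnP h2; apply/lexnnP => i z.
have z12 N : forall j : 'I_k, (j < N)%N -> (N <= i)%N -> w1 j 0 = 0 /\ w2 j 0 = 0.
  elim: N => // N IH j; rewrite ltnS leq_eqVlt => /orP[/eqP jN Ni|jN Ni]; last first.
    by apply: IH => //; apply: ltnW.
  have p1 : 0 <= w1 j 0 by apply: h1 => j' jj'; case: (IH j') => //; lia.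
  have p2 : 0 <= w2 j 0 by apply: h2 => j' jj'; case: (IH j') => //; lia.
  have : w1 j 0 + w2 j 0 = 0 by rewrite -[RHS](z j) ?mxE //; lia.
  by split; lra.
by rewrite mxE addr_ge0 // ?h1 ?h2 // => j ji; case: (z12 i j).
Qed.

Lemma lexnnZ a w : 0 <= a -> lexnn w -> lexnn (a *: w).
Proof.
rewrite le_eqVlt => /predU1P[<- _|a0 /lexnnP h]; first by rewrite scale0r lexnn0.
apply/lexnnP => i z; rewrite mxE mulr_ge0 ?(ltW a0) // h // => j ji.
by apply: (mulfI (lt0r_neq0 a0)); rewrite mulr0 -[RHS](z j ji) mxE.
Qed.

Lemma lexnn_total w : lexnn w || lexnn (- w).
Proof.
case: (boolP (lexnn w)) => //= /forallPn[i]; rewrite negb_imply -ltNge.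
case/andP => /forallP z wi; apply/lexnnP => i' z'; rewrite mxE oppr_ge0.
case: (ltngtP i' i) => ii'.
- by rewrite (eqP (implyP (z i') ii')).
- by move: wi; have := z' _ ii'; rewrite mxE => /eqP; rewrite oppr_eq0 => /eqP ->; rewrite ltxx.
- by rewrite (val_inj ii') ltW.
Qed.

Lemma lexnn_anti w : lexnn w -> lexnn (- w) -> w = 0.
Proof.
move=> /lexnnP h /lexnnP h'.
suff z N : forall j : 'I_k, (j < N)%N -> w j 0 = 0.
  by apply/colP => j; rewrite mxE (z k).
elim: N => // N IH j; rewrite ltnS => jN.
apply: le_anti; rewrite h ?andbT; last by move=> j' jj'; apply: IH; lia.
by rewrite -oppr_ge0; have := h' j; rewrite mxE; apply => j' jj'; rewrite mxE IH ?oppr0 //; lia.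
Qed.

End Lexicographic.

(* Lexicographic dual simplex method: [lp_key] breaks every tie between costs,
   so each pivot strictly increases the key of the basic solution. *)
Section LexSimplex.
Variables (R : realFieldType) (p q : nat).
Variables (M : 'M[R]_(p, q)) (d : 'cV[R]_p) (c : 'rV[R]_q).
Implicit Types (f : {ffun 'I_p -> 'I_q}) (w z : 'cV[R]_q).

Definition lp_key w : 'cV[R]_(1 + q) := col_mx (c *m w) w.

Definition basis f := colsub f M \in unitmx.
(** For injective [f], places a vector of basic values at the basic coordinates and 0 elsewhere. *)
Definition basis_embed f : 'M[R]_(q, p) := colsub f 1%:M.
Definition basis_sol f : 'cV[R]_q := basis_embed f *m (invmx (colsub f M) *m d).
(* Column j is the kernel vector obtained by raising the nonbasic variable j
   by 1. *)
Definition basis_dirs f : 'M[R]_q :=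
  1%:M - basis_embed f *m (invmx (colsub f M) *m M).
(** Dual feasibility for perturbed costs: the first entry of the key of column j is the reduced cost
    of j, the later entries are its perturbation. *)
Definition lexdual f := [forall j, lexnn (lp_key (col j (basis_dirs f)))].

Lemma lp_keyD w w' : lp_key (w + w') = lp_key w + lp_key w'.
Proof. by rewrite /lp_key mulmxDr add_col_mx. Qed.
Lemma lp_keyZ a w : lp_key (a *: w) = a *: lp_key w.
Proof. by rewrite /lp_key -scalemxAr scale_col_mx. Qed.
Lemma lp_keyN w : lp_key (- w) = - lp_key w.
Proof. by rewrite -scaleN1r lp_keyZ scaleN1r. Qed.
Lemma lp_key0 : lp_key 0 = 0.
Proof. by rewrite -[in LHS](scale0r 0) lp_keyZ scale0r. Qed.
Lemma lp_key_sum (I : finType) (P : pred I) (F : I -> 'cV[R]_q) :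
  lp_key (\sum_(i | P i) F i) = \sum_(i | P i) lp_key (F i).
Proof. exact: (big_morph lp_key lp_keyD lp_key0). Qed.
Lemma lp_key_eq0 w : lp_key w = 0 -> w = 0.
Proof. by rewrite /lp_key -col_mx0 => /eq_col_mx[]. Qed.

Lemma mulmx_embed f : M *m basis_embed f = colsub f M.
Proof. by rewrite /basis_embed mulmx_colsub mulmx1. Qed.

Lemma embed_supp f (u : 'cV[R]_p) j : j \notin codom f -> (basis_embed f *m u) j 0 = 0.
Proof.
move=> jf; rewrite mxE big1 // => r _; rewrite !mxE.
case: eqP => [E|_]; last by rewrite mul0r.
by case/negP: jf; rewrite E codom_f.
Qed.

Lemma mulmx_dirs f : basis f -> M *m basis_dirs f = 0.
Proof.
move=> fB; rewrite /basis_dirs mulmxBr mulmx1 mulmxA mulmx_embed mulmxA mulmxV //.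
by rewrite mul1mx subrr.
Qed.

Lemma dirs_ker f w : M *m w = 0 -> basis_dirs f *m w = w.
Proof. by move=> w0; rewrite /basis_dirs mulmxBl mul1mx -!mulmxA w0 !mulmx0 subr0. Qed.

Lemma dirs_nonbasic f i j : i \notin codom f -> basis_dirs f i j = (i == j)%:R.
Proof.
move=> fi; rewrite mxE [X in _ + X]mxE [X in _ - X](_ : _ = 0) ?subr0 ?mxE //.
rewrite big1 // => r _; rewrite !mxE.
case: eqP => [E|_]; last by rewrite mul0r.
by case/negP: fi; rewrite E codom_f.
Qed.

Lemma col_dirs_basic f j : basis f -> j \in codom f -> col j (basis_dirs f) = 0.
Proof.
move=> fB /codomP[r ->].
have E : col (f r) (1%:M : 'M[R]_q) = basis_embed f *m delta_mx r 0.
  by rewrite -colE; apply/colP => i; rewrite !mxE.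
rewrite !colE /basis_dirs mulmxBl mul1mx -!mulmxA.
have -> : M *m (delta_mx (f r) 0 : 'cV_q) = colsub f M *m delta_mx r 0.
  by rewrite -!colE; apply/colP => i; rewrite !mxE.
rewrite mulKmx // -colE.
have -> : (delta_mx (f r) 0 : 'cV_q) = col (f r) (1%:M : 'M[R]_q) by rewrite colE mul1mx.
by rewrite E -colE subrr.
Qed.

Lemma ker_sum_dirs f w : basis f -> M *m w = 0 ->
  w = \sum_(j | j \notin codom f) w j 0 *: col j (basis_dirs f).
Proof.
move=> fB w0; rewrite -{1}(dirs_ker f w0); apply/colP => i.
rewrite mxE summxE (bigID (fun j => j \in codom f)) /= big1 ?add0r.
  by apply: eq_bigr => j _; rewrite !mxE mulrC.
move=> j jf; have /colP/(_ i) := col_dirs_basic fB jf.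
by rewrite !mxE => ->; rewrite mul0r.
Qed.

Lemma basis_inj f : basis f -> injective f.
Proof.
move=> fB r1 r2 E; apply/eqP/negPn/negP => r12.
have : colsub f M *m (delta_mx r1 0 - delta_mx r2 0 : 'cV_p) = 0.
  by rewrite mulmxBr -!colE; apply/colP => i; rewrite !mxE E subrr.
move=> /(congr1 (mulmx (invmx (colsub f M)))); rewrite mulKmx // mulmx0.
move=> /colP/(_ r1); rewrite !mxE eqxx (negPf r12) /= subr0.
by move/eqP; rewrite oner_eq0.
Qed.

Lemma basis_solP f : basis f -> M *m basis_sol f = d.
Proof. by move=> fB; rewrite /basis_sol mulmxA mulmx_embed mulKVmx. Qed.

(** Such a vector is a nonnegative combination of the columns of [basis_dirs]. Applied to the
    difference between a feasible point and the basic solution, this is lexicographic optimality. *)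
Lemma lexdual_ker f w : basis f -> lexdual f -> M *m w = 0 ->
  (forall j, j \notin codom f -> 0 <= w j 0) -> lexnn (lp_key w).
Proof.
move=> fB /forallP fD w0 wp; rewrite (ker_sum_dirs fB w0) lp_key_sum.
elim/big_rec: _ => [|j x jf IH]; first exact: lexnn0.
by rewrite lexnnD // lp_keyZ lexnnZ ?wp.
Qed.

Lemma ker_basis f : (forall u : 'cV[R]_p, colsub f M *m u = 0 -> u = 0) -> basis f.
Proof.
move=> H; rewrite /basis -unitmx_tr unitmxE unitfE; apply/det0P => -[v v0 Ev].
case/negP: v0; rewrite -[v]trmxK -[X in _ == X]trmx0; apply/eqP; congr trmx.
by apply: H; rewrite -[_ *m _]trmxK trmx_mul trmxK Ev trmx0.
Qed.

Definition lexle w w' := lexnn (lp_key (w' - w)).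

Lemma lexle_refl : reflexive lexle.
Proof. by move=> w; rewrite /lexle subrr lp_key0 lexnn0. Qed.
Lemma lexle_trans : transitive lexle.
Proof.
move=> w2 w1 w3 h h'; have E : w3 - w1 = (w3 - w2) + (w2 - w1) by rewrite addrA subrK.
by rewrite /lexle E lp_keyD lexnnD.
Qed.
Lemma lexle_total : total lexle.
Proof. by move=> w w'; rewrite /lexle -(opprB w') lp_keyN;
  case/orP: (lexnn_total (lp_key (w' - w))) => ->; rewrite ?orbT. Qed.

Section Pivot.
Variables (f : {ffun 'I_p -> 'I_q}) (r : 'I_p) (j : 'I_q).
Hypotheses (fB : basis f) (Wj : 0 < basis_dirs f (f r) j).

Definition pivot : {ffun 'I_p -> 'I_q} := [ffun i => if i == r then j else f i].

Lemma pivot_nonbasic : j \notin codom f.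
Proof.
apply/negP => jf; have /colP/(_ (f r)) := col_dirs_basic fB jf.
by rewrite [LHS]mxE [RHS]mxE => E; move: Wj; rewrite E ltxx.
Qed.

Lemma codom_pivot i : i \notin codom pivot -> i != f r -> i \notin codom f.
Proof.
move=> ip ir; apply/negP => /codomP[r' E]; case/negP: ip.
have r'r : r' != r by apply: contraNneq ir => <-; rewrite E.
by rewrite E (_ : f r' = pivot r') ?codom_f // ffunE (negPf r'r).
Qed.

Lemma pivot_leave : f r \notin codom pivot.
Proof.
apply/negP => /codomP[r']; rewrite ffunE; case: eqP => [_ E|rr' /(basis_inj fB) E].
  by move: pivot_nonbasic; rewrite -E codom_f.
by case: rr'.
Qed.

Lemma pivot_enter : j \in codom pivot.
Proof. by apply/codomP; exists r; rewrite ffunE eqxx. Qed.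

(** Apart from j, every index nonbasic for [f] is nonbasic for [pivot] and differs from [f r], so
    only direction j survives in the expansion. *)
Lemma pivot_ker w : M *m w = 0 ->
  (forall i, i \notin codom pivot -> i != f r -> w i 0 = 0) ->
  w = w j 0 *: col j (basis_dirs f).
Proof.
move=> w0 wz; rewrite {1}(ker_sum_dirs fB w0) (bigD1 j) ?pivot_nonbasic //=.
rewrite big1 ?addr0 // => i /andP[fi ij]; rewrite wz ?scale0r //.
  apply: contra fi => /codomP[r' E]; rewrite E ffunE in ij *.
  by case: (r' == r) ij => [|_]; rewrite ?eqxx ?codom_f.
by apply: contraNneq fi => ->; rewrite codom_f.
Qed.

Lemma pivot_basis : basis pivot.
Proof.
apply: ker_basis => u Bu.
pose w := basis_embed pivot *m u.
have Mw : M *m w = 0 by rewrite mulmxA mulmx_embed.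
have wr : w (f r) 0 = 0 by rewrite embed_supp ?pivot_leave.
have Ew := pivot_ker Mw (fun i ip _ => embed_supp u ip).
have wj : w j 0 = 0.
  have /colP/(_ (f r)) := Ew; rewrite wr scale_colE => /esym/eqP.
  by rewrite mulf_eq0 (gt_eqF Wj) orbF => /eqP.
have w0 : w = 0 by rewrite Ew wj scale0r.
have pI : injective pivot.
  move=> r1 r2; rewrite !ffunE; case: eqP => [->|n1]; case: eqP => [->|n2] //.
  - by move=> E; move: pivot_nonbasic; rewrite E codom_f.
  - by move=> E; move: pivot_nonbasic; rewrite -E codom_f.
  - exact: basis_inj.
apply/colP => r'; rewrite [RHS]mxE.
have <- : w (pivot r') 0 = 0 by rewrite w0 mxE.
rewrite mxE (bigD1 r') //= !mxE eqxx mul1r big1 ?addr0 // => i ir'.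
by rewrite !mxE (inj_eq pI) eq_sym (negPf ir') mul0r.
Qed.

(** The lexicographic ratio test. Let W be the row of the leaving variable and w_i the old
    directions. The new direction i is w_i - (W_i / W_j) w_j: a nonnegative combination when W_i <=
    0, and W_i times a difference of ratios, nonnegative by the choice of j, when W_i > 0. The
    leaving index gets w_j / W_j. *)
Lemma pivot_lexdual : lexdual f ->
  (forall i, 0 < basis_dirs f (f r) i ->
     lexle ((basis_dirs f (f r) j)^-1 *: col j (basis_dirs f))
           ((basis_dirs f (f r) i)^-1 *: col i (basis_dirs f))) ->
  lexdual pivot.
Proof.
move=> /forallP fD ratio; apply/forallP => i.
have pB := pivot_basis; case: (boolP (i \in codom pivot)) => ip.
  by rewrite (col_dirs_basic pB) // lp_key0 lexnn0.
set u := col i _; set wj := col j (basis_dirs f) in ratio *.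
have Mu : M *m u = 0 by rewrite /u colE mulmxA mulmx_dirs ?mul0mx.
have uE k : k \notin codom pivot -> u k 0 = (k == i)%:R by move=> kp; rewrite mxE dirs_nonbasic.
have frE := uE _ pivot_leave.
case: (eqVneq i (f r)) => [ir|ir].
  have Eu : u = u j 0 *: wj.
    by apply: pivot_ker => // k kp kr; rewrite uE // ir (negPf kr).
  have : u j 0 * basis_dirs f (f r) j = 1.
    by rewrite -scale_colE -Eu frE ir eqxx.
  move=> E; rewrite Eu lp_keyZ lexnnZ // ?fD //.
  by rewrite -(pmulr_lge0 _ Wj) E ler01.
have fi : i \notin codom f by apply: codom_pivot.
set wi := col i (basis_dirs f).
have Mwi : M *m wi = 0 by rewrite /wi colE mulmxA mulmx_dirs ?mul0mx.
have wiE k : k \notin codom f -> wi k 0 = (k == i)%:R by move=> kf; rewrite mxE dirs_nonbasic.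
have Eu : u - wi = (u j 0 - wi j 0) *: wj.
  have := @pivot_ker (u - wi); rewrite mulmxBr Mu Mwi subrr => /(_ erefl).
  rewrite ![(u - wi) j 0]mxE [(- wi) j 0]mxE; apply=> k kp kr.
  by rewrite mxE [X in _ + X]mxE uE // wiE ?subrr // codom_pivot.
have wij : wi j 0 = 0.
  rewrite wiE ?pivot_nonbasic //; case: eqP => // E; move: ip; by rewrite -E pivot_enter.
rewrite wij subr0 in Eu.
have Eur : u j 0 * basis_dirs f (f r) j = - basis_dirs f (f r) i.
  have /colP/(_ (f r)) := Eu; rewrite scale_colE => <-.
  by rewrite mxE frE eq_sym (negPf ir) add0r !mxE.
have -> : u = wi + u j 0 *: wj by rewrite -Eu addrC subrK.
case: (lerP (basis_dirs f (f r) i) 0) => Wi.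
  rewrite lp_keyD lexnnD ?fD // lp_keyZ lexnnZ ?fD //.
  by rewrite -(pmulr_lge0 _ Wj) Eur oppr_ge0.
have -> : wi + u j 0 *: wj = basis_dirs f (f r) i *:
    ((basis_dirs f (f r) i)^-1 *: wi - (basis_dirs f (f r) j)^-1 *: wj).
  rewrite scalerBr !scalerA divff ?gt_eqF // scale1r -scaleNr; congr (_ + _ *: _).
  by rewrite -mulNr -Eur mulfK ?gt_eqF.
by rewrite lp_keyZ lexnnZ ?(ltW Wi) //; exact: ratio.
Qed.

(** The basic solution moves by a positive multiple of direction j, whose key is lexicographically
    nonnegative. As the key determines the vector, no strict increase would make this nonzero move
    vanish. *)
Lemma pivot_increase : lexdual f -> basis_sol f (f r) 0 < 0 ->
  ~~ lexle (basis_sol pivot) (basis_sol f).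
Proof.
move=> /forallP fD zr; apply/negP => le.
have pB := pivot_basis.
have Mz : M *m (basis_sol pivot - basis_sol f) = 0.
  by rewrite mulmxBr !basis_solP // subrr.
have E := pivot_ker Mz.
set a := (basis_sol pivot - _) j 0 in E.
have {}E : basis_sol pivot - basis_sol f = a *: col j (basis_dirs f).
  apply: E => i ip ir; rewrite mxE embed_supp // add0r mxE embed_supp ?oppr0 //.
  exact: codom_pivot.
have Er : - basis_sol f (f r) 0 = a * basis_dirs f (f r) j.
  have /colP/(_ (f r)) := E; rewrite scale_colE => <-.
  by rewrite [RHS]mxE [X in _ = X + _]embed_supp ?pivot_leave // add0r [RHS]mxE.
have a0 : 0 < a by rewrite -(pmulr_lgt0 _ Wj) -Er oppr_gt0.
have : basis_sol pivot - basis_sol f = 0.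
  apply/lp_key_eq0/lexnn_anti; last by rewrite -lp_keyN opprB.
  by rewrite E lp_keyZ lexnnZ ?(ltW a0) // fD.
rewrite E => /colP/(_ (f r)); rewrite scale_colE [RHS]mxE => /eqP.
by rewrite mulf_eq0 !gt_eqF.
Qed.

End Pivot.

(** Termination comes from finiteness: among the lexicographically dual feasible bases one has the
    largest key, and a negative basic value there would allow an increasing pivot. *)
Lemma lex_dual_simplex f0 z0 : basis f0 -> lexdual f0 ->
  M *m z0 = d -> (forall j, 0 <= z0 j 0) ->
  exists f, [/\ basis f, lexdual f & forall j, 0 <= basis_sol f j 0].
Proof.
move=> f0B f0D Mz0 z0p.
pose P f := basis f && lexdual f.
have := @extremumP _ _ (fun w w' => lexle w' w) f0 P basis_sol.
case=> [w|w2 w1 w3 h h'|w w'||f /andP[fB fD] fmax].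
- exact: lexle_refl.
- exact: lexle_trans h' h.
- exact: lexle_total.
- by rewrite /P f0B f0D.
exists f; split=> // j; rewrite leNgt; apply/negP => zj.
case: (boolP (j \in codom f)) => [/codomP[r Er]|jf]; last first.
  by move: zj; rewrite embed_supp // ltxx.
rewrite {}Er in zj.
have Mz : M *m (z0 - basis_sol f) = 0 by rewrite mulmxBr Mz0 basis_solP ?subrr.
(* Otherwise the expansion of [z0] minus the basic solution shows that [z0] is at most the negative
   basic value at [f r], against [z0 >= 0]. *)
have [i0 Wi0] : exists i, 0 < basis_dirs f (f r) i.
  apply/existsP; apply: contraLR zj => /existsPn Wn; rewrite -leNgt.
  have /colP/(_ (f r)) := ker_sum_dirs fB Mz; rewrite mxE [X in _ + X]mxE summxE => E.
  apply: le_trans (z0p (f r)) _; rewrite -subr_le0 E; apply: sumr_le0 => i fi.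
  have zi : (z0 - basis_sol f) i 0 = z0 i 0.
    by rewrite mxE [X in _ + X]mxE [X in - X]embed_supp // subr0.
  by rewrite scale_colE zi mulr_ge0_le0 // leNgt.
pose Q i := 0 < basis_dirs f (f r) i.
pose F i := (basis_dirs f (f r) i)^-1 *: col i (basis_dirs f).
have [|||//|i Wi imin] := @extremumP _ _ lexle i0 Q F.
- exact: lexle_refl.
- exact: lexle_trans.
- exact: lexle_total.
have := fmax (pivot f r i).
rewrite /P pivot_basis //= pivot_lexdual // => /(_ isT).
by rewrite (negPf (pivot_increase _ _ _ _)).
Qed.

End LexSimplex.

(** * The linear program in standard form *)

Lemma sum_nat_recr3 (V : nmodType) n (F : nat -> V) :
  \sum_(0 <= i < n.+3) F i = \sum_(l < n) F l + F n + F n.+1 + F n.+2.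
Proof. by rewrite !big_nat_recr //= big_mkord. Qed.

Lemma slack_cases n i : (n <= i < n.+3)%N -> [|| i == n, i == n.+1 | i == n.+2].
Proof. lia. Qed.

Lemma slack_eqF n :
  ((n == n.+1) = false) * ((n == n.+2) = false) * ((n.+1 == n) = false) *
  ((n.+1 == n.+2) = false) * ((n.+2 == n) = false) * ((n.+2 == n.+1) = false).
Proof. by do ![split]; lia. Qed.

Lemma ltnS3 n i : (i < n)%N -> (i < n.+3)%N.
Proof. lia. Qed.

Lemma ord2P (r : 'I_2) : r = 0 \/ r = 1.
Proof. by case: r => [[|[|//]]] ?; [left|right]; apply: val_inj. Qed.

Section Columns.
Variable n : nat.

(** Columns of the standard form: processing time l, makespan t, slack of row r of [A], capacity
    slack w, slack u_l of x_l <= t. *)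
Definition cx (l : 'I_n) : 'I_((n + 1) + (2 + (1 + n))) := lshift _ (lshift 1 l).
Definition ct : 'I_((n + 1) + (2 + (1 + n))) := lshift _ (rshift n ord0).
Definition cs (r : 'I_2) : 'I_((n + 1) + (2 + (1 + n))) := rshift _ (lshift _ r).
Definition cw : 'I_((n + 1) + (2 + (1 + n))) := rshift _ (rshift 2 (lshift n ord0)).
Definition cu (l : 'I_n) : 'I_((n + 1) + (2 + (1 + n))) := rshift _ (rshift 2 (rshift 1 l)).

Variant column_spec : 'I_((n + 1) + (2 + (1 + n))) -> Prop :=
| ColX l : column_spec (cx l)
| ColT : column_spec ct
| ColS r : column_spec (cs r)
| ColW : column_spec cw
| ColU l : column_spec (cu l).

Lemma columnP j : column_spec j.
Proof.
rewrite -(splitK j); case: (split j) => {}j /=.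
  rewrite -(splitK j); case: (split j) => {}j /=; first exact: ColX.
  by rewrite ord1; exact: ColT.
rewrite -(splitK j); case: (split j) => {}j /=; first exact: ColS.
rewrite -(splitK j); case: (split j) => {}j /=; last exact: ColU.
by rewrite ord1; exact: ColW.
Qed.

Lemma big_columns (V : nmodType) (F : 'I_((n + 1) + (2 + (1 + n))) -> V) :
  \sum_j F j = \sum_l F (cx l) + F ct + (F (cs 0) + F (cs 1) + (F cw + \sum_l F (cu l))).
Proof.
rewrite big_split_ord /= big_split_ord /= big_ord1 big_split_ord /= big_split_ord /= big_ord1.
rewrite big_ord_recl big_ord1; congr (_ + (_ + F _ + _)).
by congr (rshift _ (lshift _ _)); apply: val_inj.
Qed.

End Columns.
Arguments ct {n}.
Arguments cs {n}.
Arguments cw {n}.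

Section Structure.
Variables (R : realFieldType) (m n : nat) (A : 'M[R]_(2, n)) (b : 'cV[R]_2).
Implicit Types (xi : nat -> R) (tau : R).

Notation M := (lp_std_mx m A).
Notation rhs := (lp_std_rhs n b).
Notation q := ((n + 1) + (2 + (1 + n)))%N.

(* [xi] lists the processing times followed by the slacks of the two rows of [A]
   and of the capacity row; the remaining slacks are determined by [tau]. *)
Definition std_vec xi tau : 'cV[R]_q :=
  col_mx (col_mx (\col_(l < n) xi l) tau%:M)
    (col_mx (\col_(r < 2) xi (n + r)%N)
            (col_mx (xi n.+2)%:M (\col_(l < n) (tau - xi l)))).

Lemma std_vec_x xi tau l : std_vec xi tau (cx l) 0 = xi l.
Proof. by rewrite /std_vec /cx !col_mxEu mxE. Qed.
Lemma std_vec_t xi tau : std_vec xi tau ct 0 = tau.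
Proof. by rewrite /std_vec /ct col_mxEu col_mxEd mxE eqxx. Qed.
Lemma std_vec_s xi tau r : std_vec xi tau (cs r) 0 = xi (n + r)%N.
Proof. by rewrite /std_vec /cs col_mxEd col_mxEu mxE. Qed.
Lemma std_vec_w xi tau : std_vec xi tau cw 0 = xi n.+2.
Proof. by rewrite /std_vec /cw !col_mxEd col_mxEu mxE eqxx. Qed.
Lemma std_vec_u xi tau l : std_vec xi tau (cu l) 0 = tau - xi l.
Proof. by rewrite /std_vec /cu !col_mxEd mxE. Qed.

Definition std_vecE := (std_vec_x, std_vec_t, std_vec_s, std_vec_w, std_vec_u).

Lemma mul_std x t s w u :
  M *m col_mx (col_mx x t%:M) (col_mx s (col_mx w%:M u)) =
  col_mx (A *m x - s)
   (col_mx ((\sum_i x i 0 - m%:R * t + w)%:M) (\col_i (x i 0 - t + u i 0))).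
Proof.
rewrite /lp_std_mx mul_row_col mul_col_mx mul_row_col mul_col_mx !mul_row_col.
rewrite mul_block_col !mul0mx mulNmx !mul1mx !addr0 add0r.
rewrite add_col_mx add_col_mx; congr (col_mx _ (col_mx _ _)).
  apply/colP => i; rewrite ord1 !mxE big_ord1 !mxE eqxx !mulr1n mulNr.
  by congr (_ + _ + _); apply: eq_bigr => j _; rewrite !mxE mul1r.
by apply/colP => i; rewrite !mxE big_ord1 !mxE eqxx mulr1n mulN1r.
Qed.

Definition vec3 := (R * R * R)%type.
Definition dot (u v : vec3) : R := u.1.1 * v.1.1 + u.1.2 * v.1.2 + u.2 * v.2.
Definition cross (u v : vec3) : vec3 :=
  (u.1.2 * v.2 - u.2 * v.1.2, u.2 * v.1.1 - u.1.1 * v.2, u.1.1 * v.1.2 - u.1.2 * v.1.1).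

(* Coefficients of job i, or of slack i - n, in the two rows of [A] and in the
   negated capacity row. *)
Definition slc_vec (i : nat) : vec3 :=
  if insub i is Some l then (A 0 l, A 1 l, -1)
  else (- (i == n)%:R, - (i == n.+1)%:R, - (i == n.+2)%:R).

Lemma slc_vec_job (l : 'I_n) : slc_vec l = (A 0 l, A 1 l, -1).
Proof. by rewrite /slc_vec valK. Qed.

Lemma slc_vec_slack i : (n <= i)%N ->
  slc_vec i = (- (i == n)%:R, - (i == n.+1)%:R, - (i == n.+2)%:R).
Proof. by move=> ni; rewrite /slc_vec insubF // ltnNge ni. Qed.

(** The standard form after elimination of the u_l: three equations, in which t has the column (0,
    0, m). *)
Definition slc_comb xi tau : vec3 :=
  (\sum_(0 <= i < n.+3) xi i * (slc_vec i).1.1,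
   \sum_(0 <= i < n.+3) xi i * (slc_vec i).1.2,
   \sum_(0 <= i < n.+3) xi i * (slc_vec i).2 + m%:R * tau).

Lemma slc_combE xi tau : slc_comb xi tau =
  (\sum_l A 0 l * xi l - xi n, \sum_l A 1 l * xi l - xi n.+1,
   m%:R * tau - \sum_(l < n) xi l - xi n.+2).
Proof.
rewrite /slc_comb !sum_nat_recr3 !slc_vec_slack //=; try lia.
rewrite !slack_eqF !eqxx !oppr0 !mulr0 !addr0 !mulrN1; congr (_, _, _).
- by congr (_ - _); apply: eq_bigr => l _; rewrite slc_vec_job mulrC.
- by congr (_ - _); apply: eq_bigr => l _; rewrite slc_vec_job mulrC.
rewrite addrAC; congr (_ - _); rewrite addrC -sumrN; congr (_ + _).
by apply: eq_bigr => l _; rewrite slc_vec_job mulrN1.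
Qed.

(** [g.2] changes sign because [slc_vec] uses the negated capacity row. *)
Lemma mul_std_vec xi tau (g : vec3) :
  M *m std_vec xi tau = col_mx (\col_r (if r == 0 then g.1.1 else g.1.2)) (col_mx (- g.2)%:M 0)
  <-> slc_comb xi tau = g.
Proof.
rewrite /std_vec mul_std slc_combE; split.
  move=> /eq_col_mx[E1 /eq_col_mx[E2 _]]; case: g => [[g1 g2] g3] /= in E1 E2 *.
  have := congr1 (fun w : 'cV_2 => w 0 0) E1; have := congr1 (fun w : 'cV_2 => w 1 0) E1.
  rewrite !mxE /= addn0 addn1.
  under eq_bigr do rewrite mxE; move=> E1b; under eq_bigr do rewrite mxE; move=> E1a.
  rewrite E1a E1b; congr (_, _, _).
  have := congr1 (fun w : 'cV_1 => w 0 0) E2; rewrite !mxE eqxx !mulr1n.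
  under eq_bigr do rewrite mxE; move=> E; lra.
case: g => [[g1 g2] g3] [E1 E2 E3] /=; congr (col_mx _ (col_mx _%:M _)).
- apply/colP => r; rewrite !mxE; under eq_bigr do rewrite mxE.
  by case: (ord2P r) => -> /=; rewrite ?addn0 ?addn1.
- by under eq_bigr do rewrite mxE; lra.
by apply/colP => r; rewrite !mxE; lra.
Qed.

(** The zero right-hand side in the last n rows forces u_l = t - x_l. *)
Lemma std_vec_surj (z : 'cV[R]_q) (g : 'cV[R]_2) (g3 : R) :
  M *m z = col_mx g (col_mx g3%:M 0) -> exists xi tau, z = std_vec xi tau.
Proof.
rewrite -[z]vsubmxK -[usubmx z]vsubmxK -[dsubmx z]vsubmxK -[dsubmx (dsubmx z)]vsubmxK.
set x := usubmx (usubmx z); set t := dsubmx (usubmx z).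
set s := usubmx (dsubmx z); set w := usubmx (dsubmx (dsubmx z)).
set u := dsubmx (dsubmx (dsubmx z)); clearbody x t s w u;
  rewrite [t]mx11_scalar [w]mx11_scalar mul_std.
move=> /eq_col_mx[_ /eq_col_mx[_ E]].
pose xi i := if insub i is Some l then x l 0 else
  if i == n then s 0 0 else if i == n.+1 then s 1 0 else w 0 0.
have xiE (l : 'I_n) : xi l = x l 0 by rewrite /xi valK.
exists xi, (t 0 0); congr (col_mx (col_mx _ _) (col_mx _ (col_mx _ _))).
- by apply/colP => l; rewrite mxE xiE.
- apply/colP => r; rewrite mxE /xi insubF ?ltnNge ?leq_addr //.
  case: (ord2P r) => -> /=; rewrite ?addn0 ?addn1 ?eqxx //.
  by rewrite slack_eqF.
- rewrite /xi insubF ?ltnNge ?(leqW (leqnSn n)) //.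
  by rewrite !slack_eqF.
apply/colP => l; have := congr1 (fun w : 'cV_n => w l 0) E.
rewrite !mxE xiE => {}E; lra.
Qed.

Lemma mul_std_vec0 xi tau : M *m std_vec xi tau = 0 <-> slc_comb xi tau = (0, 0, 0).
Proof.
rewrite -(mul_std_vec xi tau (0, 0, 0)) /= oppr0.
suff -> : col_mx (\col_r (if r == 0 then 0 else 0)) (col_mx 0%:M 0) = 0 :> 'cV[R]_(2 + (1 +
  n)) by [].
rewrite -[RHS]vsubmxK; congr col_mx; first by apply/colP => i; rewrite !mxE; case: ifP.
by rewrite -[RHS]vsubmxK; congr col_mx; apply/colP => i; rewrite !mxE ?mul0rn.
Qed.

Lemma std_ker_vec (w : 'cV[R]_q) : M *m w = 0 -> exists xi tau, w = std_vec xi tau.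
Proof.
move=> Mw; apply: (@std_vec_surj _ 0 0); rewrite Mw -col_mx0 -col_mx0.
by congr (col_mx _ (col_mx _ _)); apply/colP => k; rewrite !mxE mul0rn.
Qed.

(** All slacks are determined by the jobs and t, so lexicographic comparisons of kernel vectors
    never get past these columns. *)
Lemma std_ker_eq0 (w : 'cV[R]_q) : M *m w = 0 ->
  (forall l, w (cx l) 0 = 0) -> w ct 0 = 0 -> w = 0.
Proof.
move=> Mw; case: (std_ker_vec Mw) => xi [tau Ew].
rewrite Ew in Mw *; rewrite std_vec_t => xi0 tau0; move: Mw => /mul_std_vec0.
have {}xi0 (l : 'I_n) : xi l = 0 by rewrite -(xi0 l) std_vec_x.
rewrite slc_combE tau0 !big1 => [|l _|l _|l _]; rewrite ?xi0 ?mulr0 //.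
rewrite !sub0r oppr0 => -[/eqP + /eqP + /eqP]; rewrite !oppr_eq0 => /eqP E1 /eqP E2.
rewrite sub0r oppr_eq0 => /eqP E3.
apply/colP => j; rewrite [RHS]mxE; case: (columnP j) => [l||r||l];
  rewrite std_vecE ?tau0 ?xi0 ?subr0 //.
by case: (ord2P r) => -> /=; rewrite ?addn0 ?addn1.
Qed.

Definition slc_rhs : vec3 := (b 0 0, b 1 0, 0).

Lemma std_rhsE : rhs = col_mx (\col_r (if r == 0 then slc_rhs.1.1 else slc_rhs.1.2))
   (col_mx (- slc_rhs.2)%:M 0).
Proof.
rewrite /lp_std_rhs /= oppr0; congr (col_mx _ _).
  by apply/colP => r; rewrite mxE; case: (ord2P r) => ->.
by rewrite -[0 in LHS]vsubmxK; congr col_mx; apply/colP => i; rewrite !mxE ?mul0rn.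
Qed.

Lemma mul_std_vec_rhs xi tau : M *m std_vec xi tau = rhs <-> slc_comb xi tau = slc_rhs.
Proof. by rewrite std_rhsE; exact: mul_std_vec. Qed.

Lemma std_vec_ge0 xi tau : 0 <= tau -> (forall i, (i < n.+3)%N -> 0 <= xi i) ->
  (forall l : 'I_n, xi l <= tau) -> forall j, 0 <= std_vec xi tau j 0.
Proof.
move=> t0 x0 xt j; case: (columnP j) => [l||r||l]; rewrite ?std_vecE ?subr_ge0 ?x0 //.
  by case: l => /= l ln; lia.
by case: r => /= r ln; lia.
Qed.

Lemma lp_feasible_std xi tau : M *m std_vec xi tau = rhs ->
  (forall j, 0 <= std_vec xi tau j 0) -> lp_feasible m A b (\col_(l < n) xi l) tau.
Proof.
move=> /mul_std_vec_rhs; rewrite slc_combE => -[E1 E2 E3] z0.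
have s0 : 0 <= xi n by rewrite -[n]addn0 -(std_vec_s _ tau ord0).
have s1 : 0 <= xi n.+1 by rewrite -[n.+1]addn1 -(std_vec_s _ tau 1).
have w0 : 0 <= xi n.+2 by rewrite -(std_vec_w _ tau).
split=> [r||l|l|].
- by rewrite mxE; under eq_bigr do rewrite mxE; case: (ord2P r) => ->; lra.
- by under eq_bigr do rewrite mxE; lra.
- by rewrite mxE -subr_ge0 -std_vec_u.
- by rewrite mxE -(std_vec_x _ tau).
- by rewrite -(std_vec_t xi tau).
Qed.

Definition std_of (x : 'cV[R]_n) (t : R) : nat -> R := fun i =>
  if insub i is Some l then x l 0 else
  if i == n then (A *m x) 0 0 - b 0 0 else if i == n.+1 then (A *m x) 1 0 - b 1 0
  else m%:R * t - \sum_l x l 0.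

Lemma std_of_feasible x t : lp_feasible m A b x t ->
  [/\ M *m std_vec (std_of x t) t = rhs, forall j, 0 <= std_vec (std_of x t) t j 0
    & forall l : 'I_n, std_of x t l = x l 0].
Proof.
case=> Ax sx xt x0 t0.
have xE (l : 'I_n) : std_of x t l = x l 0 by rewrite /std_of valK.
have nE : std_of x t n = (A *m x) 0 0 - b 0 0.
  by rewrite /std_of insubF ?ltnn ?eqxx.
have n1E : std_of x t n.+1 = (A *m x) 1 0 - b 1 0.
  by rewrite /std_of insubF ?slack_eqF ?eqxx //; lia.
have n2E : std_of x t n.+2 = m%:R * t - \sum_l x l 0.
  by rewrite /std_of insubF ?slack_eqF //; lia.
split=> //.
  apply/mul_std_vec_rhs; rewrite slc_combE nE n1E n2E /slc_rhs !mxE.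
  congr (_, _, _); under eq_bigr do rewrite xE; lra.
apply: std_vec_ge0 => // [i|l]; last by rewrite xE.
rewrite !ltnS => iN; case: (ltnP i n) => [ni|ni].
  by rewrite (xE (Ordinal ni)).
have /or3P[/eqP->|/eqP->|/eqP->] : [|| i == n, i == n.+1 | i == n.+2].
  by apply: slack_cases; rewrite ni /= !ltnS.
- by rewrite nE subr_ge0.
- by rewrite n1E subr_ge0.
by rewrite n2E subr_ge0.
Qed.

Lemma slc_lp_feasible x : (0 < m)%N -> slc_feasible A b x ->
  lp_feasible m A b x (\sum_i x i 0).
Proof.
move=> m0 [Ax x0]; have s0 : 0 <= \sum_i x i 0 by apply: sumr_ge0.
split=> //; first by rewrite ler_peMl // ler1n.
by move=> i; rewrite (bigD1 i) //= lerDl sumr_ge0.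
Qed.

Definition t_cost : 'rV[R]_q := \row_j (j == ct)%:R.
Lemma t_costE z : t_cost *m z = (z ct 0)%:M.
Proof.
apply/colP => i; rewrite ord1 !mxE eqxx mulr1n (bigD1 ct) //= mxE eqxx mul1r big1 ?addr0 // =>
  j jt.
by rewrite mxE (negPf jt) mul0r.
Qed.

Definition slack_basis : {ffun 'I_(2 + (1 + n)) -> 'I_q} := [ffun r => rshift (n + 1) r].

Lemma basis_slack : basis M slack_basis.
Proof.
rewrite /basis (_ : colsub _ _ = block_mx (- 1%:M) 0 0 1%:M).
  by rewrite unitmxE det_ublock det1 mulr1 -scaleN1r detZ det1 mulr1 unitrX // unitrN1.
by rewrite /lp_std_mx; apply/matrixP => i j; rewrite mxE ffunE row_mxEr.
Qed.

Lemma slack_basis_x l : cx l \notin codom slack_basis.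
Proof. by apply/codomP => -[r]; rewrite ffunE => /eqP; rewrite eq_lrshift. Qed.
Lemma slack_basis_t : ct \notin codom slack_basis.
Proof. by apply/codomP => -[r]; rewrite ffunE => /eqP; rewrite eq_lrshift. Qed.

Lemma lp_key_ge (w : 'cV[R]_q) : lexnn (lp_key t_cost w) -> 0 <= w ct 0.
Proof.
move=> /lexnnP/(_ (lshift q 0)); rewrite /lp_key col_mxEu t_costE mxE eqxx mulr1n.
by apply=> j; rewrite ltn0.
Qed.

Lemma lp_key_lex (w : 'cV[R]_q) (i : 'I_q) : lexnn (lp_key t_cost w) -> w ct 0 = 0 ->
  (forall j : 'I_q, (j < i)%N -> w j 0 = 0) -> 0 <= w i 0.
Proof.
move=> /lexnnP/(_ (rshift 1 i)); rewrite /lp_key col_mxEd => + wt wj; apply => j.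
rewrite -(splitK j); case: (split j) => {}j /=;
  first by rewrite col_mxEu t_costE ord1 !mxE wt mul0rn.
by rewrite ltnS col_mxEd; apply: wj.
Qed.

(** Dual feasible whatever [b] is: the key starts with the cost t and the job columns. These entries
    are 0 or 1 in every direction, and a direction where all of them vanish is 0. *)
Lemma lexdual_slack : lexdual M t_cost slack_basis.
Proof.
apply/forallP => j; set w := col j _.
have Mw : M *m w = 0 by rewrite /w colE mulmxA mulmx_dirs ?mul0mx ?basis_slack.
have wx l : 0 <= w (cx l) 0 by rewrite mxE dirs_nonbasic ?slack_basis_x.
have wt : 0 <= w ct 0 by rewrite mxE dirs_nonbasic ?slack_basis_t.
apply/lexnnP => i; rewrite -(splitK i); case: (split i) => {}i /= z.
  by rewrite col_mxEu t_costE ord1 mxE eqxx.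
have wt0 : w ct 0 = 0.
  by have := z (lshift q 0); rewrite /= col_mxEu t_costE mxE eqxx mulr1n; apply.
have z' (k : 'I_q) : (k < i)%N -> w k 0 = 0.
  by move=> ki; have := z (rshift 1 k); rewrite col_mxEd; apply; rewrite /= ltnS.
rewrite col_mxEd; case: (columnP i) z' => [l||r||l] z'; rewrite ?wx ?wt0 //.
all: have wx0 l' : w (cx l') 0 = 0 by apply: z'; rewrite /=; have := ltn_ord l'; lia.
all: by rewrite (std_ker_eq0 Mw wx0 wt0) mxE.
Qed.

Lemma lp_lex_optimal : (0 < m)%N -> (exists x, slc_feasible A b x) ->
  exists f, [/\ basis M f, lexdual M t_cost f & forall j, 0 <= basis_sol M rhs f j 0].
Proof.
move=> m0 [x /(slc_lp_feasible m0)/std_of_feasible[Mz z0 _]].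
exact: lex_dual_simplex basis_slack lexdual_slack Mz z0.
Qed.

Lemma basis_sol_bfs f : basis M f -> (forall j, 0 <= basis_sol M rhs f j 0) ->
  basic_feasible M rhs (basis_sol M rhs f).
Proof.
move=> fB z0; split=> //; first exact: basis_solP.
by exists f; split=> // j jf; exact: embed_supp.
Qed.

Lemma std_vec_bfs xi tau : basic_feasible M rhs (std_vec xi tau) ->
  lp_basic_feasible m A b (\col_(l < n) xi l) tau.
Proof. by move=> H; eexists; exact: H. Qed.

Lemma basis_sol_optimal f : basis M f -> lexdual M t_cost f ->
  (forall j, 0 <= basis_sol M rhs f j 0) ->
  exists xi tau, [/\ basis_sol M rhs f = std_vec xi tau,
    lp_optimal m A b (\col_(l < n) xi l) tau &
    lp_basic_feasible m A b (\col_(l < n) xi l) tau].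
Proof.
move=> fB fD z0; have Mz := basis_solP rhs fB.
have [xi [tau Ez]] : exists xi tau, basis_sol M rhs f = std_vec xi tau.
  by move: Mz; rewrite std_rhsE; exact: std_vec_surj.
exists xi, tau; have bf := basis_sol_bfs fB z0; rewrite !Ez in bf Mz z0 *.
split=> //; last exact: std_vec_bfs.
split=> [|x' t' /std_of_feasible[Mz' z0' _]]; first exact: lp_feasible_std.
have := @lp_key_ge (std_vec (std_of x' t') t' - std_vec xi tau).
rewrite sub_colE !std_vec_t subr_ge0; apply.
apply: (lexdual_ker fB fD); first by rewrite mulmxBr Mz Mz' subrr.
by move=> j jf; rewrite sub_colE -Ez [X in _ - X]embed_supp // subr0.
Qed.

Lemma exists_lp_optimal_bfs : (0 < m)%N -> (exists x, slc_feasible A b x) ->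
  exists x t, lp_optimal_bfs m A b x t.
Proof.
move=> m0 /(lp_lex_optimal m0)[f [fB fD z0]].
by have [xi [tau [_ ? ?]]] := basis_sol_optimal fB fD z0; exists (\col_(l < n) xi l), tau.
Qed.

End Structure.
Arguments std_vec_t {R n}.
Arguments std_vec_s {R n}.
Arguments std_vec_w {R n}.

(** * Optimal bases as pairs of jobs or slacks *)

Section Vec3.
Variable R : realFieldType.
Implicit Types u v w h g : vec3 R.

Definition lin3 x u y v z h : vec3 R :=
  (x * u.1.1 + y * v.1.1 + z * h.1.1, x * u.1.2 + y * v.1.2 + z * h.1.2,
   x * u.2 + y * v.2 + z * h.2).
Definition det3 u v w := dot (cross u v) w.

Lemma lin3C x u y v z h : lin3 x u y v z h = lin3 y v x u z h.
Proof. by rewrite /lin3; congr (_, _, _); rewrite [x * _ + _]addrC. Qed.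

Lemma det3C u v w : det3 v u w = - det3 u v w.
Proof. case: u v w => [[? ?] ?] [[? ?] ?] [[? ?] ?]; rewrite /det3 /dot /cross /=; ring. Qed.

Lemma cramer u v h w : det3 u v h != 0 ->
  w = lin3 (det3 w v h / det3 u v h) u (det3 u w h / det3 u v h) v
           (det3 u v w / det3 u v h) h.
Proof.
move=> D0; case: u v h w D0 => [[? ?] ?] [[? ?] ?] [[? ?] ?] [[? ?] ?].
by rewrite /lin3 /det3 /dot /cross /= => D0; congr (_, _, _); field.
Qed.

Lemma det3_lin u v h x y z :
  [/\ det3 (lin3 x u y v z h) v h = x * det3 u v h,
      det3 u (lin3 x u y v z h) h = y * det3 u v h &
      det3 u v (lin3 x u y v z h) = z * det3 u v h].
Proof.
case: u v h => [[? ?] ?] [[? ?] ?] [[? ?] ?].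
by rewrite /lin3 /det3 /dot /cross /=; split; ring.
Qed.

(** Gives the sign of the coefficient x of V l = x V a + y V c without a division. *)
Lemma det3_lin_tie u v h x y :
  dot (cross u v) (cross (lin3 x u y v 0 h) v) = x * dot (cross u v) (cross u v).
Proof.
by case: u v h => [[? ?] ?] [[? ?] ?] [[? ?] ?]; rewrite /lin3 /dot /cross /=; ring.
Qed.

Lemma dot_sqr_gt0 u w : dot u w != 0 -> 0 < dot u u.
Proof.
case: u => [[u1 u2] u3]; rewrite /dot /= => D; rewrite lt0r -!expr2 !addr_ge0 ?sqr_ge0 // andbT.
apply: contraNneq D => /eqP; rewrite paddr_eq0 ?addr_ge0 ?sqr_ge0 //.
rewrite paddr_eq0 ?sqr_ge0 // !sqrf_eq0.
by case/andP => /andP[/eqP-> /eqP->] /eqP->; rewrite !mul0r !addr0.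
Qed.

(** Expressing the unit vectors through u, v, h writes 1 as the determinant of the coefficients
    times [det3 u v h]. *)
Lemma det3_span u v h :
  (forall g, exists x y z, g = lin3 x u y v z h) -> det3 u v h != 0.
Proof.
move=> span; have [x1 [y1 [z1 E1]]] := span (1, 0, 0).
have [x2 [y2 [z2 E2]]] := span (0, 1, 0); have [x3 [y3 [z3 E3]]] := span (0, 0, 1).
have : det3 (1, 0, 0) (0, 1, 0) (0, 0, 1) = 1 :> R by rewrite /det3 /dot /cross /=; ring.
rewrite E1 E2 E3 => E; apply/eqP => D0; move/eqP: E; apply/negP.
rewrite (_ : det3 _ _ _ = det3 (x1, y1, z1) (x2, y2, z2) (x3, y3, z3) * det3 u v h).
  by rewrite D0 mulr0 eq_sym oner_neq0.
case: u v h {span E1 E2 E3 D0} => [[? ?] ?] [[? ?] ?] [[? ?] ?].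
by rewrite /lin3 /det3 /dot /cross /=; ring.
Qed.

End Vec3.

(** * The pair test and its completeness *)

Section Pairs.
Variables (R : realFieldType) (m n : nat) (A : 'M[R]_(2, n)) (b : 'cV[R]_2).
Implicit Types (a c i l : nat) (S : pred nat).

Notation V := (slc_vec A).
Notation M := (lp_std_mx m A).
Notation rhs := (lp_std_rhs n b).
Notation q := ((n + 1) + (2 + (1 + n)))%N.

(* If V l = x V a + y V c, the reduced cost of job l vanishes and its lexicographic
   perturbation is x e_a + y e_c - e_l, smaller indices dominating.  The [x] below is
   a positive multiple of that coefficient x. *)
Definition tie a c l : bool :=
  let y := cross (V a) (V c) in let x := dot y (cross (V l) (V c)) in
  [&& (a < c)%N, (a < l)%N & (0 < x) || (x == 0) && (c < l)%N].

(* Jobs at their upper bound t when a and c index the basic variables. *)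
Definition saturated a c l : bool :=
  let y := cross (V a) (V c) in
  [&& l != a, l != c &
      (0 < dot y (V l)) || (dot y (V l) == 0) && (tie a c l || tie c a l)].

(* The column of t once the jobs of [S] are fixed at their upper bound t. *)
Definition t_col S : vec3 R :=
  (\sum_(0 <= l < n | S l) (V l).1.1, \sum_(0 <= l < n | S l) (V l).1.2,
   m%:R + \sum_(0 <= l < n | S l) (V l).2).

(* Primal feasibility, by Cramer's rule, and dual feasibility of the basis given by
   a, c and t. *)
Definition good a c : bool :=
  let y := cross (V a) (V c) in let h := t_col (saturated a c) in
  let g := slc_rhs b in
  [&& 0 < det3 (V a) (V c) h, 0 < det3 (V a) (V c) g,
      0 <= det3 g (V c) h, 0 <= det3 (V a) g h,
      (a < n)%N ==> (det3 g (V c) h <= det3 (V a) (V c) g),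
      (c < n)%N ==> (det3 (V a) g h <= det3 (V a) (V c) g) &
      [&& 0 <= y.1.1, 0 <= y.1.2 & 0 <= y.2]].

(** Written as a sum so that linear forms split termwise. Index [l] carries the variable that moves
    along an edge; [z] is 0 at a vertex. The test [i < n] is there because [S] may hold at slack
    indices. *)
Definition spread S (t : R) a (x : R) c (y : R) l (z : R) : nat -> R := fun i =>
  (if (i < n)%N && S i then t else 0) + (if i == a then x else 0)
  + (if i == c then y else 0) + (if i == l then z else 0).

Lemma sum_pick (F : nat -> R) a (x : R) N : (a < N)%N ->
  \sum_(0 <= i < N) (if i == a then x else 0) * F i = x * F a.
Proof.
move=> aN; rewrite big_mkord (bigD1 (Ordinal aN)) //= eqxx big1 ?addr0 // => i ia.
by rewrite (_ : val i == a = false) ?mul0r //; apply/eqP => E; case/eqP: ia; apply: val_inj.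
Qed.

Lemma sum_spread (F : nat -> R) S t a x c y l z :
  (a < n.+3)%N -> (c < n.+3)%N -> (l < n.+3)%N ->
  \sum_(0 <= i < n.+3) spread S t a x c y l z i * F i =
  x * F a + y * F c + t * (\sum_(0 <= l < n | S l) F l) + z * F l.
Proof.
move=> aN cN lN; under eq_bigr do rewrite !mulrDl.
have E : \sum_(0 <= i < n.+3) (if (i < n)%N && S i then t else 0) * F i =
    t * \sum_(0 <= l < n | S l) F l.
  rewrite sum_nat_recr3 !(ltnNge _ n) leqnn !leqW // !mul0r !addr0 /=.
  rewrite big_mkord mulr_sumr [RHS]big_mkcond; apply: eq_bigr => i _.
  by rewrite ltn_ord /=; case: ifP; rewrite ?mul0r.
by rewrite !big_split /= E !sum_pick //; ring.
Qed.

Lemma comb_spread S t a x c y l z : (a < n.+3)%N -> (c < n.+3)%N -> (l < n.+3)%N ->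
  slc_comb m A (spread S t a x c y l z) t =
  lin3 1 (lin3 x (V a) y (V c) t (t_col S)) z (V l) 0 (V l).
Proof.
move=> aN cN lN; rewrite /slc_comb !sum_spread // /lin3 /=.
congr (_, _, _); ring.
Qed.

Lemma slc_comb_ext xi xi' t : (forall i, (i < n.+3)%N -> xi i = xi' i) ->
  slc_comb m A xi t = slc_comb m A xi' t.
Proof.
by move=> E; rewrite /slc_comb; congr (_, _, _ + _); apply: eq_big_nat => i iN; rewrite E.
Qed.

Lemma lin3_10 (u v h : vec3 R) : lin3 1 u 0 v 0 h = u.
Proof. by case: u => [[? ?] ?]; rewrite /lin3 /=; congr (_, _, _); ring. Qed.

(** [zeta] holds the job entries of the direction raising an unsaturated job l of zero reduced cost.
    A tie would put a negative leading entry at a, or at c when x = 0. In the latter case y = 1,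
    because c and l are jobs and have third coefficient -1; hence [tie] tests no sign of y. *)
Lemma tie_lex_contra (zeta : nat -> R) a c l (x y : R) h :
  (forall k, (k < n)%N -> (forall j, (j < k)%N -> zeta j = 0) -> 0 <= zeta k) ->
  (forall j, (j < n)%N -> zeta j = (j == l)%:R - x * (j == a)%:R - y * (j == c)%:R) ->
  (l < n)%N -> l != a -> l != c -> a != c ->
  dot (cross (V a) (V c)) h != 0 ->
  V l = lin3 x (V a) y (V c) 0 h -> ~~ tie a c l.
Proof.
move=> lex zE ln la lc ac D0 Vl; apply/negP => /and3P[ltac ltal].
rewrite {1 2}Vl det3_lin_tie; have y2 := dot_sqr_gt0 D0.
have an : (a < n)%N by lia.
have : 0 <= zeta a.
  apply: lex => // j ja; rewrite zE; last lia.
  by rewrite !ltn_eqF ?mulr0 ?addr0 ?subr0 //; lia.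
rewrite zE // eqxx (negPf ac) eq_sym (negPf la) mulr1 mulr0 subr0 sub0r oppr_ge0 => x0.
rewrite pmulr_lgt0 // mulf_eq0 (gt_eqF y2) orbF ltNge x0 /= => /andP[/eqP Ex ltcl].
have : 0 <= zeta c.
  apply: lex => [|j jc]; first lia; rewrite zE ?Ex ?mul0r ?subr0; last lia.
  by rewrite !ltn_eqF ?mulr0 ?addr0 ?subr0 //; lia.
have cn : (c < n)%N by lia.
rewrite zE // eqxx eq_sym (negPf lc) Ex mul0r mulr1 !sub0r oppr0 add0r oppr_ge0.
have := congr1 snd Vl; rewrite -[l]/(val (Ordinal ln)) -[c]/(val (Ordinal cn)).
rewrite /lin3 /= (slc_vec_job A (Ordinal ln)) (slc_vec_job A (Ordinal cn)) Ex /=; lra.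
Qed.

(** Here [zeta] belongs to lowering a saturated job l. Its entry -1 at l cannot lead, so a precedes
    l, and either x > 0 or x = 0 and c precedes l. *)
Lemma tie_lex (zeta : nat -> R) a c l (x y : R) h :
  (forall k, (k < n)%N -> (forall j, (j < k)%N -> zeta j = 0) -> 0 <= zeta k) ->
  (forall j, (j < n)%N -> zeta j = x * (j == a)%:R + y * (j == c)%:R - (j == l)%:R) ->
  (l < n)%N -> l != a -> l != c -> (a < c)%N ->
  dot (cross (V a) (V c)) h != 0 ->
  V l = lin3 x (V a) y (V c) 0 h -> tie a c l.
Proof.
move=> lex zE ln la lc ac D0 Vl; rewrite /tie {1 2}Vl det3_lin_tie ac.
have y2 := dot_sqr_gt0 D0; rewrite pmulr_lgt0 // mulf_eq0 (gt_eqF y2) orbF.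
have al : (a < l)%N.
  rewrite ltnNge; apply/negP => lea.
  have : 0 <= zeta l.
    apply: lex => // j jl; rewrite zE; last lia.
    by rewrite !ltn_eqF ?mulr0 ?addr0 ?subr0 //; lia.
  by rewrite zE // eqxx (negPf la) (negPf lc) !mulr0 addr0 sub0r oppr_ge0 ler10.
rewrite al /=; have an : (a < n)%N by lia.
have : 0 <= zeta a.
  apply: lex => // j ja; rewrite zE; last lia.
  by rewrite !ltn_eqF ?mulr0 ?addr0 ?subr0 //; lia.
rewrite zE // eqxx (ltn_eqF ac) (ltn_eqF al) mulr1 mulr0 subr0 addr0.
rewrite le_eqVlt eq_sym => /predU1P[Ex|->//]; rewrite Ex eqxx ltxx /=.
rewrite ltnNge; apply/negP => lec.
have : 0 <= zeta l.
  apply: lex => // j jl; rewrite zE ?Ex ?mul0r; last lia.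
  by rewrite !ltn_eqF ?mulr0 ?addr0 ?subr0 //; lia.
by rewrite zE // eqxx (negPf la) (negPf lc) !mulr0 addr0 sub0r oppr_ge0 ler10.
Qed.

(** The pair is read off the basic columns of a lexicographically optimal basis. The main work is to
    show that [saturated a c], which sees only the pair, recovers the jobs at their upper bound. *)
Lemma exists_good : (0 < m)%N -> (exists x, slc_feasible A b x) ->
  ~ (forall r, b r 0 <= 0) ->
  exists a c, [/\ (a < n.+3)%N, (c < n.+3)%N & good a c].
Proof.
move=> m0 feas b0; have [f [fB fD z0]] := lp_lex_optimal m0 feas.
have [xi [t [Ez _ _]]] := basis_sol_optimal fB fD z0.
have Mz := basis_solP rhs fB; rewrite Ez in z0 Mz; move: Mz => /mul_std_vec_rhs Exi.
have z_supp j : j \notin codom f -> std_vec n xi t j 0 = 0 by rewrite -Ez; apply: embed_supp.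
have xi0 i : (i < n.+3)%N -> 0 <= xi i.
  move=> iN; case: (ltnP i n) => [ni|ni]; first by rewrite -(std_vec_x xi t (Ordinal ni)).
  have /or3P[] : [|| i == n, i == n.+1 | i == n.+2] by rewrite slack_cases ?ni.
  - by move/eqP->; rewrite -[n]addn0 -(std_vec_s xi t ord0).
  - by move/eqP->; rewrite -addn1 -(std_vec_s xi t 1).
  - by move/eqP->; rewrite -(std_vec_w xi t).
have xit (l : 'I_n) : xi l <= t by rewrite -subr_ge0 -(std_vec_u xi t).
(* With t = 0 all jobs vanish and the two row slacks equal -b >= 0, against the hypothesis. *)
have t0 : 0 < t.
  rewrite lt_def -{2}(std_vec_t (n:=n) xi t) z0 andbT; apply/eqP => t0; apply: b0.
  have xl0 (l : 'I_n) : xi l = 0.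
    by apply/le_anti; rewrite xi0 ?andbT -?t0 ?xit // ltnS3.
  move: Exi; rewrite slc_combE t0 !big1 => [|l _|l _|l _]; rewrite ?xl0 ?mulr0 // !sub0r.
  by case=> E1 E2 _ r; case: (ord2P r) => ->; rewrite -?E1 -?E2 oppr_le0 xi0 // !ltnS ?leqW.
pose B j := j \in codom f.
have tB : B ct by apply: contraLR t0 => /z_supp; rewrite std_vec_t => ->; rewrite ltxx.
have xuB (l : 'I_n) : B (cx l) || B (cu l).
  rewrite /B; apply: contraLR t0; rewrite negb_or => /andP[/z_supp + /z_supp].
  by rewrite std_vec_x std_vec_u => ->; rewrite subr0 => ->; rewrite ltxx.
(* Indices not fixed at a bound: both columns of the job are basic, or the slack is. *)
pose E i := if insub i is Some l then B (cx l) && B (cu l)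
            else if i == n then B (cs 0) else if i == n.+1 then B (cs 1) else B cw.
have EJ (l : 'I_n) : E l = B (cx l) && B (cu l) by rewrite /E valK.
have En : E n = B (cs 0) by rewrite /E insubF ?ltnn ?eqxx.
have En1 : E n.+1 = B (cs 1).
  by rewrite /E insubF ?slack_eqF ?eqxx // ltnNge leqnSn.
have En2 : E n.+2 = B cw.
  by rewrite /E insubF ?slack_eqF // ltnNge !leqW.
(* Of the n + 3 basic columns one is t, and every job takes at least one because x_l + u_l = t > 0;
   two are left over. *)
have cardE : count E (iota 0 n.+3) = 2%N.
  have -> : count E (iota 0 n.+3) = (\sum_(0 <= i < n.+3) E i)%N.
    by rewrite -sum1_count big_mkcond /index_iota subn0; apply: eq_bigr => i _; case: (E i).
  have : #|codom f| = (2 + (1 + n))%N by rewrite card_codom ?card_ord //; exact: basis_inj fB.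
  have big_col (F : 'I_q -> nat) : (\sum_j F j = \sum_l F (cx l) + F ct +
      (F (cs 0%R) + F (cs 1%R) + (F cw + \sum_l F (cu l))))%N by exact: big_columns.
  have big_idx (F : nat -> nat) :
    (\sum_(0 <= i < n.+3) F i = \sum_(l < n) F l + F n + F n.+1 + F n.+2)%N
    by exact: sum_nat_recr3.
  rewrite -sum1_card big_mkcond big_col /= -!/(B _) tB.
  rewrite big_idx En En1 En2.
  set X := (\sum_l _)%N; set U := (\sum_l _)%N; set Y := (\sum_(l < n) _)%N.
  have : (X + U = n + Y)%N.
    rewrite -[n in RHS]card_ord -sum1_card -!big_split /=; apply: eq_bigr => l _.
    by rewrite EJ -!/(B _); move: (xuB l); case: (B (cx l)); case: (B (cu l)).
  have ifE (e : bool) : (if e then 1 else 0)%N = e by case: e.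
  rewrite !ifE; clearbody X U Y; clear; move: (B _) (B _) (B _) => e0 e1 e2; lia.
have [a [c [aN cN ac [Ea Ec Eac]]]] : exists a c, [/\ (a < n.+3)%N, (c < n.+3)%N, a != c &
    [/\ E a, E c & forall i, (i < n.+3)%N -> E i -> (i == a) || (i == c)]].
  move: cardE; rewrite -size_filter; case Es: (filter _ _) => [|a [|c []]] // _.
  have Em i : ((i < n.+3)%N && E i) = (i == a) || (i == c).
    have : (i \in filter E (iota 0 n.+3)) = (i == a) || (i == c) by rewrite Es !inE.
    by rewrite mem_filter mem_iota andbC.
  have := filter_uniq E (iota_uniq 0 n.+3); rewrite Es /= inE andbT => ac.
  have /andP[aN Ea] : (a < n.+3)%N && E a by rewrite Em eqxx.
  have /andP[cN Ec] : (c < n.+3)%N && E c by rewrite Em eqxx orbT.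
  by exists a, c; split=> //; split=> // i iN Ei; rewrite -Em iN.
pose S i := if insub i is Some l then ~~ B (cu l) else false.
have SJ (l : 'I_n) : S l = ~~ B (cu l) by rewrite /S valK.
have SE i : S i -> ~~ E i.
  by rewrite /S /E; case: insubP => // l _ _; rewrite negb_and orbC => ->.
have slackP i : (n <= i < n.+3)%N -> ~~ E i -> exists2 j, ~~ B j &
    forall (xi' : nat -> R) (t' : R), std_vec n xi' t' j 0 = xi' i.
  case/slack_cases/or3P => /eqP->.
  - by rewrite En => H; exists (cs 0) => // xi' t'; rewrite std_vec_s addn0.
  - by rewrite En1 => H; exists (cs 1) => // xi' t'; rewrite std_vec_s addn1.
  - by rewrite En2 => H; exists cw => // xi' t'; rewrite std_vec_w.
(* A vector supported on the basis is t' on [S], free at the two indices of [E], and 0 at all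
   others. *)
have supp_comb a' c' (xi' : nat -> R) (t' : R) : (a' < n.+3)%N -> (c' < n.+3)%N -> a' != c' ->
    E a' -> E c' -> (forall i, (i < n.+3)%N -> E i -> (i == a') || (i == c')) ->
    (forall j, ~~ B j -> std_vec n xi' t' j 0 = 0) ->
    slc_comb m A xi' t' = lin3 (xi' a') (V a') (xi' c') (V c') t' (t_col S).
  move=> aN' cN' ac' Ea' Ec' Eac' z'.
  rewrite (@slc_comb_ext xi' (spread S t' a' (xi' a') c' (xi' c') 0 0)).
    by rewrite comb_spread // lin3_10.
  move=> i iN; rewrite /spread if_same addr0.
  case: (boolP (E i)) => [Ei|nEi].
    rewrite (negPf (contraL (@SE i) Ei)) andbF add0r.
    case/orP: (Eac' i iN Ei) => /eqP->; rewrite eqxx ?(negPf ac') ?addr0 //.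
    by rewrite eq_sym (negPf ac') add0r.
  rewrite (_ : i == a' = false); last by apply: contraNF nEi => /eqP->.
  rewrite (_ : i == c' = false); last by apply: contraNF nEi => /eqP->.
  rewrite !addr0; case: (ltnP i n) => ni /=; last first.
    by have [|j Bj /(_ xi' t') <-] := slackP i _ nEi; [rewrite ni | exact: z'].
  pose l := Ordinal ni; rewrite -[i]/(val l) SJ in nEi *; rewrite EJ in nEi.
  case: (boolP (B (cu l))) nEi => Bu; rewrite ?andbT => Bx.
    by have := z' _ Bx; rewrite std_vec_x.
  by have := z' _ Bu; rewrite std_vec_u => /eqP; rewrite subr_eq0 => /eqP.
clear cardE.
(* Exchanging a and c flips the sign. The determinant is nonzero because the basis solves every
   right-hand side, so V a, V c and the column of t span the space. *)
wlog D0 : a c aN cN ac Ea Ec Eac / 0 < det3 (V a) (V c) (t_col S).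
  move=> wl.
  suff D0 : det3 (V a) (V c) (t_col S) != 0.
    case: (ltrgtP 0 (det3 (V a) (V c) (t_col S))) => [D|D|D].
    - exact: (wl a c).
    - apply: (wl c a) => //; [by rewrite eq_sym | | by rewrite det3C oppr_gt0].
      by move=> i iN Ei; rewrite orbC Eac.
    - by rewrite -D eqxx in D0.
  apply: det3_span => g.
  pose G : 'cV[R]_(2 + (1 + n)) :=
    col_mx (\col_r (if r == 0 then g.1.1 else g.1.2)) (col_mx (- g.2)%:M 0).
  have MG := basis_solP G fB; have [xi' [t' Eg]] := std_vec_surj MG.
  exists (xi' a), (xi' c), t'; rewrite -(supp_comb a c) //; last first.
    by move=> j Bj; rewrite -Eg; exact: embed_supp.
  by apply/esym/mul_std_vec; rewrite -Eg MG.
set h := t_col S in D0.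
have Dn0 : det3 (V a) (V c) h != 0 by rewrite gt_eqF.
have aS : S a = false by apply/negbTE/(contraL (@SE a)).
have cS : S c = false by apply/negbTE/(contraL (@SE c)).
pose x i := det3 (V i) (V c) h / det3 (V a) (V c) h.
pose y i := det3 (V a) (V i) h / det3 (V a) (V c) h.
pose z i := det3 (V a) (V c) (V i) / det3 (V a) (V c) h.
have VE i : V i = lin3 (x i) (V a) (y i) (V c) (z i) h by exact: cramer.
(* Raising the nonbasic variable i ([s = 1]), or lowering a saturated job i
   ([s = -1]), is a direction of the lexicographically optimal vertex. *)
have dir_lex (s : R) i : (i < n.+3)%N -> i != a -> i != c ->
    (s = 1 /\ ~~ S i) \/ (s = -1 /\ S i) ->
    lexnn (lp_key (t_cost R n)
      (std_vec n (spread S (- s * z i) a (- s * x i) c (- s * y i) i s) (- s * z i))).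
  move=> iN ia ic Hs; apply: (lexdual_ker fB fD).
    apply/mul_std_vec0; rewrite comb_spread // (VE i) /lin3 /= -/h; congr (_, _, _); ring.
  have sp k : k != a -> k != c -> spread S (- s * z i) a (- s * x i) c (- s * y i) i s k =
     (if (k < n)%N && S k then - s * z i else 0) + (if k == i then s else 0).
    by move=> ka kc; rewrite /spread (negPf ka) (negPf kc) !addr0.
  have s_ge0 k : ~~ S k -> 0 <= (if k == i then s else 0).
    case: eqP => [->|_] // nSi; case: Hs => [[-> _]|[_ Si]]; first exact: ler01.
    by rewrite Si in nSi.
  move=> j; rewrite -/(B j); case: (columnP j) => [l||r||l] Bj; rewrite std_vecE.
  - have nE : ~~ E l by rewrite EJ negb_and Bj.
    have nS : ~~ S l by rewrite SJ negbK; move: (xuB l); rewrite (negPf Bj).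
    rewrite sp ?(negPf nS) ?andbF ?add0r ?s_ge0 //.
      by apply: contraNneq nE => ->.
    by apply: contraNneq nE => ->.
  - by rewrite tB in Bj.
  - have nE : ~~ E (n + r)%N by case: (ord2P r) Bj => -> /= Bj; rewrite ?addn0 ?addn1 ?En ?En1.
    have nS : ~~ S (n + r)%N by rewrite /S insubF // ltnNge leq_addr.
    rewrite sp ?(negPf nS) ?andbF ?add0r ?s_ge0 //.
      by apply: contraNneq nE => ->.
    by apply: contraNneq nE => ->.
  - have nE : ~~ E n.+2 by rewrite En2.
    have nS : ~~ S n.+2 by rewrite /S insubF // ltnNge !leqW.
    rewrite sp ?(negPf nS) ?andbF ?add0r ?s_ge0 //.
      by apply: contraNneq nE => ->.
    by apply: contraNneq nE => ->.
  - have nE : ~~ E l by rewrite EJ negb_and Bj orbT.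
    have Sl : S l by rewrite SJ.
    rewrite sp ?Sl ?ltn_ord /=.
    + rewrite opprD addrA subrr sub0r oppr_ge0; case: eqP => // li.
      by case: Hs => [[_]|[-> _]]; rewrite -?li ?Sl // lerN10.
    + by apply: contraNneq nE => ->.
    + by apply: contraNneq nE => ->.
have dir_le0 i : (i < n.+3)%N -> i != a -> i != c -> ~~ S i -> z i <= 0.
  move=> iN ia ic nS; have := lp_key_ge (dir_lex 1 i iN ia ic (or_introl (conj erefl nS))).
  by rewrite std_vec_t mulN1r oppr_ge0.
(* At zero reduced cost the t entry of the direction is 0, so its job entries must be
   lexicographically nonnegative. *)
have tie_dir (s : R) i : (i < n)%N -> i != a -> i != c -> z i = 0 ->
    (s = 1 /\ ~~ S i) \/ (s = -1 /\ S i) -> forall k, (k < n)%N ->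
    (forall j, (j < k)%N -> s * ((j == i)%:R - x i * (j == a)%:R - y i * (j == c)%:R) = 0) ->
    0 <= s * ((k == i)%:R - x i * (k == a)%:R - y i * (k == c)%:R).
  move=> ni ia ic z_0 Hs k kn.
  have := dir_lex s i (leqW (leqW (leqW ni))) ia ic Hs.
  rewrite z_0 mulr0 => lex.
  have sE j : spread S 0 a (- s * x i) c (- s * y i) i s j =
      s * ((j == i)%:R - x i * (j == a)%:R - y i * (j == c)%:R).
    by rewrite /spread if_same; do 3![case: eqP => _ /=]; ring.
  move=> z_lt; rewrite -sE -[k]/(val (Ordinal kn)) -(std_vec_x _ 0).
  apply: lp_key_lex lex _ _; first by rewrite std_vec_t.
  move=> j jk; have jn : (j < n)%N by move: jk => /= jk; apply: ltn_trans kn.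
  have -> : j = cx (Ordinal jn) by apply: val_inj.
  by rewrite std_vec_x sE z_lt.
have sat i : (i < n)%N -> saturated a c i = S i.
  move=> ni; have iN := ltnS3 ni.
  rewrite /saturated; case: (eqVneq i a) => [->|ia] /=; first by rewrite aS.
  case: (eqVneq i c) => [->|ic] /=; first by rewrite cS.
  have dE : dot (cross (V a) (V c)) (V i) = z i * det3 (V a) (V c) h.
    by rewrite -/(det3 _ _ _) {1}(VE i);
      have [_ _ ->] := det3_lin (V a) (V c) h (x i) (y i) (z i).
  rewrite dE pmulr_lgt0 // mulf_eq0 (negPf Dn0) orbF.
  have Dc0 : det3 (V c) (V a) h != 0 by rewrite det3C oppr_eq0.
  case: (boolP (S i)) => Si.
    have Hs : (-1 = 1 :> R /\ ~~ S i) \/ (-1 = -1 :> R /\ S i) by right.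
    have := lp_key_ge (dir_lex (-1) i iN ia ic Hs).
    rewrite std_vec_t opprK mul1r le_eqVlt eq_sym => /predU1P[z_0|-> //].
    have Vi := VE i; rewrite z_0 in Vi; rewrite z_0 eqxx ltxx /=.
    have lex := tie_dir _ _ ni ia ic z_0 Hs.
    case: (ltngtP a c) => [lac|lca|eac]; last by rewrite eac eqxx in ac.
      apply/orP; left; apply: (tie_lex lex) Vi => // j jn; ring.
    apply/orP; right; rewrite lin3C in Vi; apply: (tie_lex lex) Vi => // j jn; ring.
  have := dir_le0 i iN ia ic Si; rewrite le_eqVlt => /predU1P[z_0|zl]; last first.
    by rewrite ltNge ltW //= (lt_eqF zl).
  have Vi := VE i; rewrite z_0 in Vi; rewrite z_0 eqxx ltxx /=.
  have lex := tie_dir 1 _ ni ia ic z_0 (or_introl (conj erefl Si)).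
  apply/negbTE; rewrite negb_or; apply/andP; split.
    apply: (tie_lex_contra lex) Vi => // j jn; ring.
  rewrite lin3C in Vi; apply: (tie_lex_contra lex) Vi => //; last by rewrite eq_sym.
  move=> j jn; ring.
have hE : t_col (saturated a c) = h.
  by rewrite /h /t_col; congr (_, _, _ + _); rewrite big_nat_cond [RHS]big_nat_cond;
    apply: eq_bigl => i; case: (boolP (i < n)%N) => ni; rewrite /= ?sat.
exists a, c; split=> //; rewrite /good hE.
have gE : slc_rhs b = lin3 (xi a) (V a) (xi c) (V c) t h by rewrite -Exi (supp_comb a c).
have [E1 E2 E3] := det3_lin (V a) (V c) h (xi a) (xi c) t.
rewrite -gE in E1 E2 E3; rewrite E1 E2 E3 D0 !pmulr_lgt0 // t0 !pmulr_lge0 // !xi0 //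
  !ler_pM2r //=.
apply/and3P; split.
- by apply/implyP => an; exact: (xit (Ordinal an)).
- by apply/implyP => cn; exact: (xit (Ordinal cn)).
(* The slack vectors are minus the unit vectors, so this gives y >= 0. For i = a or i = c the
   determinant has a repeated column. *)
have slack_le0 i : (n <= i < n.+3)%N -> dot (cross (V a) (V c)) (V i) <= 0.
  move=> /andP[ni iN]; rewrite -/(det3 _ _ _) (VE i).
  have [_ _ ->] := det3_lin (V a) (V c) h (x i) (y i) (z i).
  rewrite pmulr_lle0 //; have Si : ~~ S i by rewrite /S insubF // ltnNge ni.
  have Dne := Dn0; case: (eqVneq i a) => [->|ia].
    rewrite /z (_ : det3 _ _ (V a) = 0) ?mul0r //.
    by case: (V a) (V c) => [[? ?] ?] [[? ?] ?]; rewrite /det3 /dot /cross /=; ring.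
  case: (eqVneq i c) => [->|ic]; last exact: dir_le0.
  rewrite /z (_ : det3 _ _ (V c) = 0) ?mul0r //.
  by case: (V a) (V c) => [[? ?] ?] [[? ?] ?]; rewrite /det3 /dot /cross /=; ring.
have := slack_le0 n; have := slack_le0 n.+1; have := slack_le0 n.+2.
rewrite (slc_vec_slack A (leqnn n)) (slc_vec_slack A (leqnSn n)) (slc_vec_slack A (leqW
  (leqnSn n))).
set y1 := (cross _ _); rewrite /dot !slack_eqF !eqxx /= !oppr0 !mulr0 !add0r !addr0 !mulrN1
  !oppr_le0.
rewrite !ltnS leqnn leqnSn (leqW (leqnSn n)) => H2 H1 H0.
by rewrite H0 ?H1 ?H2.
Qed.

End Pairs.

(** * From a good pair to an optimal basic solution *)

Section GoodPair.
Variables (R : realFieldType) (m n : nat) (A : 'M[R]_(2, n)) (b : 'cV[R]_2).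
Variables (a c : nat).
Hypotheses (aN : (a < n.+3)%N) (cN : (c < n.+3)%N) (gd : good m A b a c).

Notation V := (slc_vec A).
Notation M := (lp_std_mx m A).
Notation rhs := (lp_std_rhs n b).
Notation q := ((n + 1) + (2 + (1 + n)))%N.
Notation sat := (saturated A a c).
Notation y := (cross (V a) (V c)).
Notation h := (t_col m A sat).
Notation g := (slc_rhs b).
Notation D := (det3 (V a) (V c) h).

Definition good_t : R := det3 (V a) (V c) g / D.
Definition good_xa : R := det3 g (V c) h / D.
Definition good_xc : R := det3 (V a) g h / D.
Definition good_x : nat -> R := spread n sat good_t a good_xa c good_xc 0 0.

Lemma good_det_gt0 : 0 < D. Proof. by case/and3P: gd. Qed.

Lemma good_t_gt0 : 0 < good_t.
Proof. by rewrite divr_gt0 ?good_det_gt0 //; case/and3P: gd. Qed.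

Lemma good_xa_ge0 : 0 <= good_xa.
Proof. by rewrite divr_ge0 ?(ltW good_det_gt0) //; case/and4P: gd. Qed.

Lemma good_xc_ge0 : 0 <= good_xc.
Proof. by rewrite divr_ge0 ?(ltW good_det_gt0) //; case/and5P: gd. Qed.

Lemma good_xa_le : (a < n)%N -> good_xa <= good_t.
Proof.
by move=> an; rewrite ler_pM2r ?invr_gt0 ?good_det_gt0 //;
  case/and5P: gd => _ _ _ _ /andP[/implyP->].
Qed.

Lemma good_xc_le : (c < n)%N -> good_xc <= good_t.
Proof.
by move=> cn; rewrite ler_pM2r ?invr_gt0 ?good_det_gt0 //;
  case/and5P: gd => _ _ _ _ /and3P[_ /implyP->].
Qed.

Lemma good_dual_ge0 : [/\ 0 <= y.1.1, 0 <= y.1.2 & 0 <= y.2].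
Proof. by case/and5P: gd => _ _ _ _ /and3P[_ _ /and3P]. Qed.

Lemma good_neq : a != c.
Proof.
apply: contraTneq good_det_gt0 => ->; rewrite (_ : det3 _ _ _ = 0) ?ltxx //.
by case: (V c) h => [[? ?] ?] [[? ?] ?]; rewrite /det3 /dot /cross /=; ring.
Qed.

Lemma sat_neq i : sat i -> i != a /\ i != c.
Proof. by case/and3P. Qed.

Lemma good_xE i : good_x i =
  if i == a then good_xa else if i == c then good_xc
  else if (i < n)%N && sat i then good_t else 0.
Proof.
rewrite /good_x /spread if_same addr0; case: eqP => [->|ia].
  rewrite (negPf good_neq) addr0 (_ : sat a = false) ?andbF ?add0r //.
  by rewrite /saturated eqxx.
case: eqP => [->|ic]; last by rewrite !addr0.
by rewrite addr0 (_ : sat c = false) ?andbF ?add0r // /saturated eqxx andbF.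
Qed.

Lemma good_x_ge0 i : 0 <= good_x i.
Proof.
rewrite good_xE; case: ifP => _; first exact: good_xa_ge0.
by case: ifP => _; [exact: good_xc_ge0 | case: ifP => _ //; rewrite ltW ?good_t_gt0].
Qed.

Lemma good_x_le (l : 'I_n) : good_x l <= good_t.
Proof.
rewrite good_xE; case: eqP => [la|_]; first by rewrite good_xa_le // -la.
case: eqP => [lc|_]; first by rewrite good_xc_le // -lc.
by case: ifP => _; rewrite ?lexx // ltW ?good_t_gt0.
Qed.

Lemma good_comb : slc_comb m A good_x good_t = g.
Proof.
rewrite comb_spread // lin3_10 [in RHS](cramer g (_ : det3 (V a) (V c) h != 0)) //.
by rewrite gt_eqF ?good_det_gt0.
Qed.

Lemma good_lp_feasible : lp_feasible m A b (\col_(l < n) good_x l) good_t.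
Proof.
apply: lp_feasible_std; first exact/mul_std_vec_rhs/good_comb.
apply: std_vec_ge0 => [|i _|l]; [exact: ltW good_t_gt0 | exact: good_x_ge0 | exact: good_x_le].
Qed.

Lemma dot_comb (u : vec3 R) xi t : dot u (slc_comb m A xi t) =
  \sum_(0 <= i < n.+3) xi i * dot u (V i) + t * (m%:R * u.2).
Proof.
rewrite /slc_comb /dot /= mulrDr addrA !mulr_sumr -!big_split /=; congr (_ + _); last by ring.
by apply: eq_bigr => i _; ring.
Qed.

Lemma dot_t_col (u : vec3 R) S : dot u (t_col m A S) =
  \sum_(0 <= l < n | S l) dot u (V l) + m%:R * u.2.
Proof.
rewrite /t_col /dot /= mulrDr [_ * m%:R + _]addrC addrA !mulr_sumr -!big_split /=.
by rewrite mulrC.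
Qed.

Lemma dot_slack_le0 (u : vec3 R) i : 0 <= u.1.1 -> 0 <= u.1.2 -> 0 <= u.2 ->
  (n <= i)%N -> dot u (V i) <= 0.
Proof.
case: u => [[u1 u2] u3] /= p1 p2 p3 ni;
  rewrite slc_vec_slack // /dot /= !mulrN -!opprD oppr_le0.
by rewrite !addr_ge0 // mulr_ge0.
Qed.

(** Weak duality: y . g <= t' (y . h) at every feasible point. The term x'_l (y . V l) is at most t'
    (y . V l) for a saturated job, and at most 0 for other jobs and, since y >= 0, for slacks. Ties
    contribute 0 to both sides. *)
Lemma good_lp_optimal : lp_optimal m A b (\col_(l < n) good_x l) good_t.
Proof.
split=> [|x' t' F]; first exact: good_lp_feasible.
have [Mz z0 _] := std_of_feasible F; case: F => _ _ _ _ t0'.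
set xi := std_of _ _ _ _ _ in Mz z0; move/mul_std_vec_rhs: Mz => Exi.
rewrite /good_t ler_pdivrMr ?good_det_gt0 // /det3 -Exi dot_comb dot_t_col.
have [y1 y2 y3] := good_dual_ge0; set u := y in y1 y2 y3 *; rewrite [leRHS]mulrDr lerD2r.
have xi0 i : (i < n.+3)%N -> 0 <= xi i.
  move=> iN; case: (ltnP i n) => [ni|ni]; first by rewrite -(std_vec_x xi t' (Ordinal ni)).
  have /or3P[] : [|| i == n, i == n.+1 | i == n.+2] by rewrite slack_cases ?ni.
  - by move/eqP->; rewrite -[n]addn0 -(std_vec_s xi t' ord0).
  - by move/eqP->; rewrite -addn1 -(std_vec_s xi t' 1).
  - by move/eqP->; rewrite -(std_vec_w xi t').
have slack (k : 'I_3) : xi (n + k)%N * dot y (V (n + k)) <= 0.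
  rewrite mulr_ge0_le0 ?xi0 //; first by have := ltn_ord k; lia.
  exact: dot_slack_le0 (leq_addr _ _).
rewrite sum_nat_recr3 -addrA -addrA -[leRHS]addr0; apply: lerD; last first.
  have := (slack 0, slack 1, slack (inord 2)).
  by rewrite !inordK //= addn0 addn1 addn2 => -[[? ?] ?]; lra.
rewrite big_mkord mulr_sumr [leRHS]big_mkcond; apply: ler_sum => l _.
have xl0 : 0 <= xi l by rewrite -(std_vec_x xi t').
have xlt : xi l <= t' by rewrite -subr_ge0 -(std_vec_u xi t').
case: ifP => [/and3P[_ _ /orP[/ltW d0|/andP[/eqP-> _]]]|sl].
- exact: ler_wpM2r.
- by rewrite !mulr0.
rewrite mulr_ge0_le0 //; move: sl; rewrite /saturated.
case: (eqVneq (val l) a) => [->|_].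
  by rewrite (_ : dot _ _ = 0) // /u /dot /cross /=; ring.
case: (eqVneq (val l) c) => [->|_].
  by rewrite (_ : dot _ _ = 0) // /u /dot /cross /=; ring.
by case: ltrgtP.
Qed.

Definition col_of i : 'I_q := if insub i is Some l then cx l
  else if i == n then cs 0 else if i == n.+1 then cs 1 else cw.

Lemma col_of_job (l : 'I_n) : col_of l = cx l.
Proof. by rewrite /col_of valK. Qed.

Lemma std_vec_col_of (xi : nat -> R) t i : (i < n.+3)%N -> std_vec n xi t (col_of i) 0 = xi i.
Proof.
move=> iN; rewrite /col_of; case: insubP => [l _ <-|]; first by rewrite std_vec_x.
rewrite -leqNgt => ni; case: eqP => [->|i0]; first by rewrite std_vec_s addn0.
case: eqP => [->|i1]; first by rewrite std_vec_s addn1.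
by rewrite std_vec_w; congr xi; lia.
Qed.

Lemma col_of_eq i j : (i < n.+3)%N -> (j < n.+3)%N -> (col_of i == col_of j) = (i == j).
Proof.
move=> iN jN; apply/eqP/eqP => [E|-> //].
have := std_vec_col_of (fun k => k%:R : R) 0 jN; rewrite -E std_vec_col_of //.
by move/eqP; rewrite eqr_nat => /eqP.
Qed.

Lemma col_of_t i : (i < n.+3)%N -> col_of i != ct.
Proof.
move=> iN; apply/eqP => E; have := std_vec_col_of (fun=> 0 : R) 1 iN.
by rewrite E std_vec_t => /eqP; rewrite oner_eq0.
Qed.

Lemma col_of_u i l : (i < n.+3)%N -> col_of i != cu l.
Proof.
move=> iN; apply/eqP => E; have := std_vec_col_of (fun=> 0 : R) 1 iN.
by rewrite E std_vec_u subr0 => /eqP; rewrite oner_eq0.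
Qed.

Lemma ct_u l : ct != cu l :> 'I_q.
Proof. by rewrite /ct /cu eq_lrshift. Qed.

(** If a or c is a job, it contributes two columns, its own and that of its upper bound slack, since
    it is not saturated. *)
Definition good_basis : {ffun 'I_(2 + (1 + n)) -> 'I_q} := [ffun r =>
  match split r with
  | inl r => col_of (if r == 0 then a else c)
  | inr r => match split r with
             | inl _ => ct
             | inr l => if sat l then col_of l else cu l
             end
  end].

Lemma embed_good (u : 'cV[R]_(2 + (1 + n))) j : (basis_embed R good_basis *m u) j 0 =
  (j == col_of a)%:R * u (lshift _ 0) 0 + (j == col_of c)%:R * u (lshift _ 1) 0
  + ((j == ct)%:R * u (rshift _ (lshift _ 0)) 0 +
     \sum_(l < n) (j == (if sat l then col_of l else cu l))%:R * u (rshift _ (rshift _ l)) 0).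
Proof.
rewrite mxE big_split_ord /= big_split_ord /= big_ord1 big_ord_recl big_ord1.
rewrite !mxE !ffunE.
have -> : lift ord0 ord0 = 1 :> 'I_2 by apply: val_inj.
rewrite !(unsplitK (inl _)) !(unsplitK (inr _)) !(unsplitK (inl _)) /=.
congr (_ + (_ + _)); apply: eq_bigr => l _; rewrite !mxE !ffunE.
by rewrite !(unsplitK (inr _)).
Qed.

(** A kernel vector supported on these columns reduces to ua V a + uc V c + t h = 0. The nonzero
    determinant kills these three coefficients, and then all others. *)
Lemma basis_good : basis M good_basis.
Proof.
apply: ker_basis => u Bu; pose w := basis_embed R good_basis *m u.
have Mw : M *m w = 0 by rewrite mulmxA mulmx_embed.
have [xi [t Ew]] := std_ker_vec Mw; have wE := embed_good u; rewrite -/w Ew in wE.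
set ua := u (lshift _ 0) 0 in wE; set uc := u (lshift _ 1) 0 in wE.
set ut := u (rshift _ (lshift _ 0)) 0 in wE.
pose ul l := u (rshift 2 (rshift 1 l)) 0.
have tE : t = ut.
  rewrite -(std_vec_t (n:=n) xi t) wE eqxx mul1r ![ct == _]eq_sym.
  rewrite !(negPf (col_of_t _)) // !mul0r !add0r big1 ?addr0 // => l _.
  rewrite (negPf (_ : _ != _)) ?mul0r //; case: ifP => _; rewrite ?ct_u // eq_sym.
  by rewrite col_of_t // ltnS3.
have uE (l : 'I_n) : t - xi l = if sat l then 0 else ul l.
  rewrite -std_vec_u wE ![cu l == _]eq_sym !(negPf (col_of_u _ _)) // (negPf (ct_u _)).
  rewrite !mul0r !add0r (bigD1 l) //= big1 ?addr0 => [|l' l'l].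
    case: ifP => _; rewrite ?eqxx ?mul1r //.
    by rewrite eq_sym (negPf (col_of_u _ _)) ?mul0r // ltnS3.
  case: ifP => _; first by rewrite eq_sym (negPf (col_of_u _ _)) ?mul0r // ltnS3.
  by rewrite /cu !eq_rshift eq_sym (negPf l'l) mul0r.
have satE (l : 'I_n) : sat l -> xi l = t by move=> s; have := uE l; rewrite s => /eqP;
  rewrite subr_eq0 => /eqP.
have xE i : (i < n.+3)%N -> xi i = spread n sat t a ua c uc 0 0 i.
  move=> iN; rewrite /spread if_same addr0; case: (boolP (_ && _)) => [/andP[ni s]|ns].
    have [ia ic] := sat_neq s; rewrite (negPf ia) (negPf ic) !addr0.
    exact: (satE (Ordinal ni)).
  rewrite add0r -(std_vec_col_of xi t iN) wE !col_of_eq // (negPf (col_of_t iN)).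
  rewrite mul0r add0r big1 ?addr0.
    by congr (_ + _); case: eqP; rewrite ?mul1r ?mul0r.
  move=> l _; case: ifP => s; last by rewrite (negPf (col_of_u _ _)) ?mul0r.
  rewrite col_of_eq ?(ltnS3 (ltn_ord _)) // (_ : (i == l) = false) ?mul0r //.
  by apply: contraNF ns => /eqP->; rewrite ltn_ord.
have E0 : lin3 ua (V a) uc (V c) t h = (0, 0, 0).
  have : slc_comb m A xi t = (0, 0, 0) by apply/mul_std_vec0; rewrite -Ew.
  by rewrite (slc_comb_ext _ _ _ xE) comb_spread // lin3_10.
have [E1 E2 E3] := det3_lin (V a) (V c) h ua uc t; rewrite E0 in E1 E2 E3.
have Dn0 : D != 0 by rewrite gt_eqF ?good_det_gt0.
have z1 v w' : det3 (0, 0, 0) v w' = 0 :> R by rewrite /det3 /dot /cross /=; ring.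
have z2 v w' : det3 v (0, 0, 0) w' = 0 :> R by rewrite /det3 /dot /cross /=; ring.
have z3 v w' : det3 v w' (0, 0, 0) = 0 :> R by rewrite /det3 /dot /cross /=; ring.
have ua0 : ua = 0 by apply: (mulIf Dn0); rewrite -E1 z1 mul0r.
have uc0 : uc = 0 by apply: (mulIf Dn0); rewrite -E2 z2 mul0r.
have t0 : t = 0 by apply: (mulIf Dn0); rewrite -E3 z3 mul0r.
have ul0 (l : 'I_n) : ul l = 0.
  have := uE l; rewrite xE ?ltnS3 // /spread t0 ua0 uc0 !if_same !addr0 subr0.
  case: ifP => // s _; have := wE (col_of l); rewrite std_vec_col_of ?ltnS3 //.
  rewrite xE ?ltnS3 // /spread t0 ua0 uc0 !if_same !addr0 !mulr0 (negPf (col_of_t _)) ?ltnS3 //.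
  rewrite mul0r !add0r (bigD1 l) //= s eqxx mul1r big1 ?addr0 // => l' l'l.
  case: ifP => _; last by rewrite (negPf (col_of_u _ _)) ?mul0r ?ltnS3.
  rewrite col_of_eq ?(ltnS3 (ltn_ord _)) // (_ : (val l == val l') = false) ?mul0r //.
  by apply: contraNF l'l => /eqP E; apply/eqP/val_inj.
apply/colP => r; rewrite [RHS]mxE -(splitK r); case: (split r) => {}r /=.
  by case: (ord2P r) => ->.
rewrite -(splitK r); case: (split r) => {}r /=; last exact: ul0.
by rewrite ord1 -t0 tE.
Qed.

Lemma good_lp_optimal_bfs : lp_optimal_bfs m A b (\col_(l < n) good_x l) good_t.
Proof.
split; first exact: good_lp_optimal.
apply: std_vec_bfs; split.
- exact/mul_std_vec_rhs/good_comb.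
- by apply: std_vec_ge0 => [|i _|l];
  [exact: ltW good_t_gt0 | exact: good_x_ge0 | exact: good_x_le].
exists good_basis; split=> [|j jB]; first exact: basis_good.
have jN r : j != good_basis r by apply: contraNneq jB => ->; rewrite codom_f.
have ja : j != col_of a.
  by have := jN (lshift _ 0); rewrite ffunE (unsplitK (inl _)).
have jc : j != col_of c.
  by have := jN (lshift _ 1); rewrite ffunE (unsplitK (inl _)).
have jt : j != ct.
  by have := jN (rshift _ (lshift _ 0)); rewrite ffunE !(unsplitK (inr _)) (unsplitK (inl _)).
have jl (l : 'I_n) : j != if sat l then col_of l else cu l.
  by have := jN (rshift _ (rshift _ l)); rewrite ffunE !(unsplitK (inr _)).
have x0 i : (i < n.+3)%N -> j = col_of i -> good_x i = 0.
  move=> iN ji; rewrite good_xE; case: eqP => [ia|_]; first by rewrite ji ia eqxx in ja.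
  case: eqP => [ic|_]; first by rewrite ji ic eqxx in jc.
  case: ifP => // /andP[ni s].
  by have := jl (Ordinal ni); rewrite s ji eqxx.
case: (columnP j) ja jc jt jl x0 => {jB jN j}[l||r||l] ja jc jt jl x0; rewrite std_vecE.
- by apply: x0; rewrite ?ltnS3 ?col_of_job.
- by rewrite eqxx in jt.
- apply: x0; first by have := ltn_ord r; lia.
  rewrite /col_of insubF ?ltnNge ?leq_addr //.
  case: (ord2P r) => ->; first by rewrite addn0 eqxx.
  case: eqP => [/= E|_]; first by clear -E; lia.
  by case: eqP => //= -[]; rewrite addn1.
- by apply: x0; rewrite // /col_of insubF ?slack_eqF // ltnNge !leqW.
have := jl l; case: ifP => [s _|]; last by rewrite eqxx.
by rewrite good_xE; have [/negPf-> /negPf->] := sat_neq s; rewrite ltn_ord s subrr.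
Qed.

End GoodPair.

(** The slack basis is feasible when b <= 0: the row slacks are -b, and t = 0 cannot be improved. *)
Lemma zero_lp_optimal_bfs (R : realFieldType) m n (A : 'M[R]_(2, n)) (b : 'cV[R]_2) :
  (forall r, b r 0 <= 0) -> lp_optimal_bfs m A b 0 0.
Proof.
move=> b0; pose xi i : R := if i == n then - b 0 0 else if i == n.+1 then - b 1 0 else 0.
have xl (l : 'I_n) : xi l = 0.
  by rewrite /xi !ltn_eqF // ltnS ltnW.
have xn : xi n = - b 0 0 by rewrite /xi eqxx.
have xn1 : xi n.+1 = - b 1 0 by rewrite /xi slack_eqF eqxx.
have xn2 : xi n.+2 = 0 by rewrite /xi !slack_eqF.
have E : \col_(l < n) xi l = 0 by apply/colP => l; rewrite !mxE xl.
have Mz : lp_std_mx m A *m std_vec n xi 0 = lp_std_rhs n b.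
  apply/mul_std_vec_rhs; rewrite slc_combE xn xn1 xn2.
  have S0 (F : 'I_n -> R) : \sum_l F l * xi l = 0.
    by rewrite big1 // => l _; rewrite xl mulr0.
  have -> : \sum_(l < n) xi l = 0 by rewrite big1.
  by rewrite !S0 mulr0 !subr0 !sub0r !opprK.
have z0 : forall j, 0 <= std_vec n xi 0 j 0.
  apply: std_vec_ge0 => // [i _|l]; last by rewrite xl.
  by rewrite /xi; case: ifP => _; [|case: ifP => _]; rewrite ?oppr_ge0.
rewrite -E; split.
  by split=> [|x' t' []//]; exact: lp_feasible_std.
apply: std_vec_bfs; split=> //; exists (slack_basis n); split=> [|j jB].
  exact: basis_slack.
case: (columnP j) jB => [l||r||l]; rewrite std_vecE ?xl ?xn2 ?subr0 // => /codomP[].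
by exists (lshift _ r); rewrite ffunE.
Qed.

(** * Placements *)

Section Placement.
Variables (R : realFieldType) (m n : nat) (x : 'cV[R]_n) (t : R).
Implicit Type sigma : {ffun 'I_n -> 'I_m}.

Notation full := (full_jobs x t).
Notation partial := (partial_jobs x t).

Lemma placement_inj sigma :
  (forall i j, 0 < x i 0 -> 0 < x j 0 -> sigma i = sigma j -> i = j) ->
  placement x t sigma.
Proof.
move=> inj.
have al i : 0 < x i 0 -> alone x sigma i by move=> i0 j j0 E; apply: inj.
split=> [i|i|_ i]; rewrite !inE => /andP[i0 it]; [exact: al| |exact: al].
apply/imsetP => -[j]; rewrite inE => /andP[j0 /eqP jt] E.
by rewrite (inj _ _ i0 j0 E) jt ltxx in it.
Qed.

Lemma placement_one_idle sigma : (#|full| = m.-1)%N -> (0 < m)%N ->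
  {in full &, injective sigma} -> (forall i, 0 < x i 0 -> x i 0 <= t) ->
  (forall i j, i \in full -> j \in partial -> sigma i != sigma j) ->
  placement x t sigma.
Proof.
move=> cf m0 inj xt fp.
have idle1 : #|idle_machines x t sigma| = 1%N.
  by rewrite cardsCs setCK card_ord card_in_imset // cf; lia.
split=> [i fi j j0 E|j jp|]; last by rewrite idle1.
  have fj : j \in full.
    apply: contraTT isT => nf; have : j \in partial.
      by move: nf; rewrite !inE j0 /= lt_neqAle xt // andbT.
    by move/(fp _ _ fi); rewrite E eqxx.
  exact: inj.
by rewrite inE; apply/imsetP => -[i fi E]; have := fp _ _ fi jp; rewrite E eqxx.
Qed.

Lemma sum_full_partial : (forall i, 0 <= x i 0) -> (forall i, x i 0 <= t) ->
  \sum_i x i 0 = #|full|%:R * t + \sum_(i in partial) x i 0.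
Proof.
move=> x0 xt; rewrite (bigID (mem full)) /=; congr (_ + _).
  by rewrite (eq_bigr (fun=> t)) ?sumr_const ?mulr_natl // => i; rewrite inE => /andP[_ /eqP].
rewrite (bigID (mem partial)) /= [X in _ + X]big1 ?addr0.
  by apply: eq_bigl => i; rewrite !inE; case: (ltgtP (x i 0) t); rewrite ?andbF ?andbT.
move=> i; rewrite !inE => /andP[nf np]; apply: le_anti; rewrite x0 andbT leNgt;
  apply/negP => i0.
by move: nf np (xt i); rewrite i0 /=; case: ltgtP.
Qed.

(** Job number k in the list of full, then partial, jobs gets machine min(k, m - 1). Either all
    positive jobs get separate machines, or capacity forces exactly m - 1 full jobs and the partial
    ones meet on the last machine. Jobs of time 0 lie outside the list and end up on an arbitrary
    machine. *)
Lemma exists_placement : (0 < m)%N -> \sum_i x i 0 <= m%:R * t ->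
  (forall i, 0 <= x i 0) -> (forall i, x i 0 <= t) -> 0 <= t ->
  (#|partial| <= 2)%N -> exists sigma, placement x t sigma.
Proof.
move=> m0 sx x0 xt t0 p2; pose s := enum full ++ enum partial.
have Hm k : (minn k m.-1 < m)%N by lia.
pose sigma : {ffun 'I_n -> 'I_m} := [ffun i => Ordinal (Hm (index i s))].
have s_uniq : uniq s.
  rewrite cat_uniq !enum_uniq andbT; apply/hasPn => i; rewrite !mem_enum !inE.
  by move=> /andP[_ it]; rewrite (lt_eqF it) andbF.
have s_pos i : (i \in s) = (0 < x i 0).
  rewrite mem_cat !mem_enum !inE -andb_orr -le_eqVlt; first by rewrite xt andbT.
have s_full i : i \in full -> (index i s < #|full|)%N.
  by move=> fi; rewrite index_cat mem_enum fi cardE index_mem mem_enum.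
have s_partial i : i \in partial -> (#|full| <= index i s)%N.
  move=> pi; rewrite index_cat mem_enum ifF -?cardE ?leq_addr //.
  by move: pi; rewrite !inE => /andP[-> /lt_eqF ->].
have index_inj i j : 0 < x i 0 -> index i s = index j s -> i = j.
  rewrite -s_pos => si E; have sj : j \in s by rewrite -index_mem -E index_mem.
  by rewrite -(nth_index i si) E nth_index.
have szs : size s = (#|full| + #|partial|)%N by rewrite size_cat -!cardE.
exists sigma; case: (leqP (#|full| + #|partial|) m) => le_m.
  have small i : 0 < x i 0 -> minn (index i s) m.-1 = index i s.
    by rewrite -s_pos -index_mem szs => si; apply/minn_idPl;
      rewrite -ltnS prednK // (leq_trans si).
  apply: placement_inj => i j i0 j0 /(congr1 val).
  by rewrite !ffunE /= !small //; exact: index_inj.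
have [i0 i0_pos] : exists i, 0 < x i 0.
  have : (0 < size s)%N by rewrite szs (leq_ltn_trans _ le_m).
  by rewrite -has_predT => /hasP[i]; rewrite s_pos; exists i.
have t_gt0 : 0 < t := lt_le_trans i0_pos (xt i0).
rewrite (sum_full_partial x0 xt) in sx.
have sp0 : 0 <= \sum_(i in partial) x i 0 by apply: sumr_ge0.
have Fm : (#|full| <= m)%N.
  by rewrite -(ler_nat R) -(ler_pM2r t_gt0); apply: le_trans sx; rewrite lerDl.
have P0 : (0 < #|partial|)%N by rewrite -(ltn_add2l #|full|) addn0 (leq_ltn_trans Fm).
(* A partial job uses positive capacity, so the full jobs cannot fill all m machines. *)
have F_lt : (#|full| < m)%N.
  rewrite -(ltr_nat R) -(ltr_pM2r t_gt0); apply: lt_le_trans sx; rewrite ltrDl.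
  have /card_gt0P[i ip] := P0; rewrite (bigD1 i) //= ltr_wpDr ?sumr_ge0 //.
  by move: ip; rewrite inE => /andP[].
have F_eq : #|full| = m.-1.
  apply/eqP; rewrite eqn_leq -ltnS prednK // F_lt /= -(leq_add2r 1) !addn1 prednK //.
  by rewrite -ltnS (leq_trans le_m) // -addn2 leq_add2l.
apply: placement_one_idle => // [i j fi fj|i j fi pj].
  move=> /(congr1 val); rewrite !ffunE /= -F_eq !(minn_idPl (ltnW (s_full _ _))) //.
  by apply: index_inj; move: fi; rewrite inE => /andP[].
apply/eqP => /(congr1 val); rewrite !ffunE /= -F_eq (minn_idPl (ltnW (s_full _ fi))).
by rewrite (minn_idPr (s_partial _ pj)) => E; have := s_full _ fi; rewrite E ltnn.
Qed.

End Placement.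

(** * Schedules compared with the linear program *)

Section Makespan.
Variables (R : realFieldType) (m k n : nat) (A : 'M[R]_(k, n)) (b : 'cV[R]_k).
Implicit Types (x : 'cV[R]_n) (t : R) (sigma : {ffun 'I_n -> 'I_m}).

(** The linear program relaxes the scheduling problem, t standing for the makespan. *)
Lemma schedule_lp_feasible x sigma : slc_feasible A b x ->
  lp_feasible m A b x (makespan x sigma).
Proof.
move=> [Ax x0]; have le_ms p : load x sigma p <= makespan x sigma by exact: le_bigmax.
split=> // [|i|]; last exact: bigmax_ge_id.
  have -> : \sum_i x i 0 = \sum_p load x sigma p.
    by rewrite (partition_big sigma xpredT).
  apply: le_trans (ler_sum _ (fun p _ => le_ms p)) _.
  by rewrite sumr_const card_ord mulr_natl.
apply: le_trans (le_ms (sigma i)); rewrite /load (bigD1 i) //= lerDl.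
by apply: sumr_ge0 => j _.
Qed.

(** A machine with a full job gets no other positive time; a single idle machine receives at most t
    by the capacity row; otherwise partial jobs are alone. The relaxation gives the reverse
    inequality. *)
Lemma placement_makespan x t sigma : lp_optimal m A b x t -> placement x t sigma ->
  makespan x sigma = t /\ slc_optimal m A b x sigma.
Proof.
move=> [[Ax sx xt x0 t0] opt] [al_f p_idle al_p].
have feas : slc_feasible A b x by [].
have load1 p i : sigma i = p -> alone x sigma i -> load x sigma p = x i 0.
  move=> ip ai; rewrite /load (bigD1 i) ?ip ?eqxx //= big1 ?addr0 // => j /andP[/eqP jp ji].
  apply/eqP; rewrite eq_le x0 andbT leNgt; apply/negP => j0.
  by move/eqP: ji; apply; apply: ai; rewrite // jp ip.
have load_le p : load x sigma p <= t.
  case: (boolP (p \in idle_machines x t sigma)) => [pI|]; last first.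
    rewrite inE negbK => /imsetP[i fi ip]; rewrite (load1 p i) //; exact: al_f.
  have pos_partial j : sigma j = p -> 0 < x j 0 -> j \in partial_jobs x t.
    move=> jp j0; rewrite inE j0 lt_neqAle xt andbT; apply/negP => /eqP jt.
    move: pI; rewrite inE => /negP[]; apply/imsetP; exists j => //.
    by rewrite inE j0 jt /=.
  have load_partial : load x sigma p = \sum_(j in partial_jobs x t | sigma j == p) x j 0.
    rewrite /load (bigID (mem (partial_jobs x t))) /= [X in _ + X]big1 ?addr0.
      by apply: eq_bigl => j; rewrite andbC.
    move=> j /andP[/eqP jp npj]; apply/eqP; rewrite eq_le x0 andbT leNgt.
    by apply: contra npj; exact: pos_partial.
  case: (eqVneq #|idle_machines x t sigma| 1%N) => [c1|c1].
    have fE : (#|full_jobs x t| + 1 = m)%N.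
      rewrite -(card_in_imset (f := sigma)) -?c1; first by rewrite cardsC card_ord.
      move=> i j fi fj E; apply: al_f fj _ _ _ => //.
      by move: fi; rewrite inE => /andP[].
    rewrite load_partial; apply: le_trans (_ : \sum_(j in partial_jobs x t) x j 0 <= t).
      by rewrite [leRHS](bigID (fun j => sigma j == p)) /= lerDl sumr_ge0.
    move: sx; rewrite (sum_full_partial x0 xt) -fE natrD mulrDl mul1r.
    by rewrite lerD2l.
  case: (pickP (fun j => (j \in partial_jobs x t) && (sigma j == p))) => [j|no].
    by case/andP=> jp /eqP sj; rewrite (load1 p j sj) //; exact: al_p.
  by rewrite load_partial big_pred0.
have ms : makespan x sigma = t.
  apply/eqP; rewrite eq_le bigmax_le //=.
  by apply: (opt x); exact: schedule_lp_feasible.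
split=> //; split=> // x' sigma' feas'.
by rewrite ms; apply: (opt x'); exact: schedule_lp_feasible.
Qed.

End Makespan.

(** For t > 0 the column of t is basic, a partial job has x_l and u_l both basic, and any other job
    at least one of them: with P partial jobs, 1 + n + P <= n + 3. Degenerate solutions are covered,
    since only nonzero entries are counted. *)
Lemma bfs_partial_jobs (R : realFieldType) m n (A : 'M[R]_(2, n)) (b : 'cV[R]_2)
    (x : 'cV[R]_n) (t : R) :
  0 <= t -> (forall i, x i 0 <= t) -> lp_basic_feasible m A b x t ->
  (#|partial_jobs x t| <= 2)%N.
Proof.
move=> t0 xt [s [Mz z0 [f [fB zf]]]].
move: t0; rewrite le_eqVlt => /predU1P[t0|t0].
  rewrite (_ : partial_jobs x t = set0) ?cards0 //; apply/setP => i; rewrite !inE -t0.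
  by apply/negP => /andP[x0 /(lt_trans x0)]; rewrite ltxx.
set z := col_mx _ _ in Mz z0 zf.
have [xi [tau Ez]] : exists xi tau, z = std_vec n xi tau.
  by move: Mz; rewrite std_rhsE; exact: std_vec_surj.
have tE : tau = t.
  by rewrite -(std_vec_t (n:=n) xi tau) -Ez /z /ct col_mxEu col_mxEd mxE eqxx.
have xE (l : 'I_n) : xi l = x l 0.
  by rewrite -(std_vec_x xi tau) -Ez /z /cx !col_mxEu.
pose B j := j \in codom f.
have nzB j : z j 0 != 0 -> B j by apply: contraR => /zf ->.
have big_col (F : 'I_((n + 1) + (2 + (1 + n))) -> nat) : (\sum_j F j = \sum_l F (cx l) + F ct +
    (F (cs 0%R) + F (cs 1%R) + (F cw + \sum_l F (cu l))))%N by exact: big_columns.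
have : (\sum_j B j <= 2 + (1 + n))%N.
  have -> : (\sum_j B j = #|codom f|)%N.
    by rewrite -sum1_card [RHS]big_mkcond; apply: eq_bigr => j _; rewrite -/(B j); case: (B j).
  by apply: leq_trans (leq_image_card _ _) _; rewrite card_ord.
rewrite big_col nzB ?Ez ?std_vec_t ?tE ?gt_eqF //.
have : (n + #|partial_jobs x t| <= \sum_l B (cx l) + \sum_l B (cu l))%N.
  rewrite -[n in (n + _)%N]card_ord -!sum1_card.
  rewrite [X in (_ + X)%N]big_mkcond -!big_split /=; apply: leq_sum => l _.
  have Bx : 0 < x l 0 -> B (cx l) by move=> xl; rewrite nzB // Ez std_vec_x xE gt_eqF.
  have Bu : x l 0 < t -> B (cu l).
    by move=> xl; rewrite nzB // Ez std_vec_u xE tE subr_eq0 gt_eqF.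
  rewrite inE; case: ifP => [/andP[/Bx-> /Bu->] //|_]; rewrite addn0.
  case: (ltrP 0 (x l 0)) => [/Bx-> //|xl].
  by rewrite Bu ?addn1 // (le_lt_trans xl).
move: (\sum_l B (cx l))%N (\sum_l B (cu l))%N (B (cs 0) : nat) (B (cs 1) : nat) (B cw : nat).
clear; lia.
Qed.

(** * Verification of random access programs *)

(* The fraction need not be in lowest terms: the exponents then add up under every
   operation. *)
Definition bnd (k : nat) (v : rat) : Prop :=
  exists p r : int, [/\ r != 0, v = p%:~R / r%:~R, (`|p| <= 2 ^ k)%N & (`|r| <= 2 ^ k)%N].

Lemma nat_bits_le a k : (a <= 2 ^ k)%N -> (nat_bits a <= k.+1)%N.
Proof.
rewrite /nat_bits ltnS => ak; case: (posnP a) => [->|a0]; first by rewrite trunc_log0.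
by rewrite -(leq_exp2l (m := 2)) // (leq_trans (trunc_logP _ _)).
Qed.

(** Unless p = 0, the reduced numerator and denominator divide p and r. Each takes at most k + 1
    bits, and one more is for the sign. *)
Lemma bnd_bits k v : bnd k v -> (rat_bits v <= 2 * k + 3)%N.
Proof.
case=> p [r [r0 Ev pk rk]].
have r0' : r%:~R != 0 :> rat by rewrite intr_eq0.
have E : numq v * r = p * denq v.
  by apply: (@intr_inj rat); rewrite !rmorphM /= numqE {1}Ev mulrAC divfK.
have dr : (`|denq v| %| `|r|)%N.
  have : (`|denq v| %| `|numq v| * `|r|)%N by rewrite -abszM E abszM dvdn_mull.
  by rewrite Gauss_dvdr // coprime_sym coprime_num_den.
have nk : (`|numq v| <= 2 ^ k)%N.
  case: (eqVneq p 0) => [p0|p0].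
    by rewrite Ev p0 mul0r.
  have np : (`|numq v| %| `|p|)%N.
    have : (`|numq v| %| `|p| * `|denq v|)%N by rewrite -abszM -E abszM dvdn_mulr.
    by rewrite Gauss_dvdl // coprime_num_den.
  by apply: leq_trans (dvdn_leq _ np) pk; rewrite absz_gt0.
have dk : (`|denq v| <= 2 ^ k)%N by apply: leq_trans (dvdn_leq _ dr) rk; rewrite absz_gt0.
by rewrite /rat_bits; have := nat_bits_le nk; have := nat_bits_le dk; lia.
Qed.

Lemma bits_bnd v : bnd (rat_bits v).-1 v.
Proof.
have nb a : (a <= 2 ^ nat_bits a)%N.
  by case: (posnP a) => [->//|a0]; rewrite ltnW // trunc_log_ltn.
exists (numq v), (denq v); rewrite denq_neq0 divq_num_den; split=> //=.
  by apply: leq_trans (nb _) _; rewrite leq_exp2l // /rat_bits leq_addr.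
by apply: leq_trans (nb _) _; rewrite leq_exp2l // /rat_bits leq_addl.
Qed.

Lemma rat_bits_gt0 v : (0 < rat_bits v)%N. Proof. by []. Qed.

Lemma bnd_le k k' v : (k <= k')%N -> bnd k v -> bnd k' v.
Proof.
move=> kk [p [r [r0 E pk rk]]]; exists p, r; split=> //.
  by apply: leq_trans pk _; rewrite leq_exp2l.
by apply: leq_trans rk _; rewrite leq_exp2l.
Qed.

Lemma bnd_int k (z : int) : (`|z| <= 2 ^ k)%N -> bnd k z%:~R.
Proof. by move=> zk; exists z, 1; split=> //; rewrite ?divr1 ?expn_gt0. Qed.

Lemma bnd_nat k (a : nat) : (a <= 2 ^ k)%N -> bnd k a%:R.
Proof. by move=> ak; rewrite -[a%:R]/(a%:~R); apply: bnd_int. Qed.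

Lemma bndM k1 k2 v1 v2 : bnd k1 v1 -> bnd k2 v2 -> bnd (k1 + k2) (v1 * v2).
Proof.
case=> p1 [r1 [r10 -> pk1 rk1]] [p2 [r2 [r20 -> pk2 rk2]]].
exists (p1 * p2), (r1 * r2); rewrite mulf_neq0 // !abszM expnD !leq_mul //.
by split=> //; rewrite !rmorphM /= mulf_div.
Qed.

Lemma bndN k v : bnd k v -> bnd k (- v).
Proof. by case=> p [r [r0 -> pk rk]]; exists (- p), r; rewrite abszN rmorphN /= mulNr. Qed.

Lemma bndD k1 k2 v1 v2 : bnd k1 v1 -> bnd k2 v2 -> bnd (k1 + k2).+1 (v1 + v2).
Proof.
case=> p1 [r1 [r10 -> pk1 rk1]] [p2 [r2 [r20 -> pk2 rk2]]].
exists (p1 * r2 + p2 * r1), (r1 * r2); split; rewrite ?mulf_neq0 //.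
- by rewrite addf_div ?intr_eq0 // !rmorphD !rmorphM /=.
- rewrite expnS expnD mul2n -addnn.
  have h1 := leq_mul pk1 rk2; have h2 := leq_mul rk1 pk2.
  rewrite -!abszM in h1 h2; move: (2 ^ k1 * 2 ^ k2)%N h1 h2 => e; lia.
by rewrite abszM expnS expnD mul2n -addnn; apply: leq_trans (leq_addr _ _); rewrite leq_mul.
Qed.

Lemma bndB k1 k2 v1 v2 : bnd k1 v1 -> bnd k2 v2 -> bnd (k1 + k2).+1 (v1 - v2).
Proof. by move=> b1 /bndN; exact: bndD. Qed.

Lemma bnd_div k1 k2 v1 v2 : v2 != 0 -> bnd k1 v1 -> bnd k2 v2 -> bnd (k1 + k2) (v1 / v2).
Proof.
move=> v20 b1 [p2 [r2 [r20 E2 pk2 rk2]]]; apply: bndM => //.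
exists r2, p2; split=> //; last by rewrite E2 invf_div.
by apply: contraNneq v20 => p0; rewrite E2 p0 mul0r.
Qed.

(** * Evaluation of expressions within a word size *)

Definition binop_val (o : binop) (v1 v2 : rat) : rat :=
  match o with
  | OpAdd => v1 + v2
  | OpSub => v1 - v2
  | OpMul => v1 * v2
  | OpDiv => v1 / v2
  end.

(** Total semantics without word limit; division by 0 and invalid addresses take default values,
    which [safe] excludes. *)
Fixpoint ev (s : memory) (e : expr) : rat :=
  match e with
  | Lit z => z%:~R
  | Cell e1 => s (Num.truncn (ev s e1))
  | Bin o e1 e2 => binop_val o (ev s e1) (ev s e2)
  end.

(* Literals are bounded so that they fit in every word considered. *)
Fixpoint safe (s : memory) (e : expr) : Prop :=
  match e with
  | Lit z => (`|z| <= 2 ^ 5)%N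
  | Cell e1 => safe s e1 /\ ev s e1 \is a Num.nat
  | Bin o e1 e2 => [/\ safe s e1, safe s e2 & if o is OpDiv then ev s e2 != 0 else true]
  end.

Definition mem_bnd K (s : memory) : Prop := forall a, bnd K (s a).

(** [c * K.+1] bounds the exponent of an expression of cost c over cells of exponent K, and exponent
    k takes at most 2 k + 3 bits. *)
Definition word K c := (2 * (c * K.+1) + 3)%N.

Lemma leq_word K c c' : (c <= c')%N -> (word K c <= word K c')%N.
Proof. by move=> cc; rewrite leq_add2r leq_mul2l leq_mul2r cc orbT. Qed.

Lemma fit_bnd w k v : bnd k v -> (2 * k + 3 <= w)%N -> fit w v = Some v.
Proof. by move=> /bnd_bits vk kw; rewrite /fit (leq_trans vk kw). Qed.

(** Exponents add at every operation, plus 1 for a sum or difference; the K + 1 contributed by the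
    operation node pays for it. [5 <= K] covers the literals. *)
Lemma eval_safe K w s e : (5 <= K)%N -> mem_bnd K s -> safe s e ->
  (word K (cost e) <= w)%N ->
  eval w s e = Some (ev s e) /\ bnd (cost e * K.+1) (ev s e).
Proof.
move=> K5 sK; elim: e => [z|e IH|o e1 IH1 e2 IH2] /=.
- move=> zs zw; have zb : bnd (1 * K.+1) z%:~R.
    by apply: (bnd_le (k := 5)); [rewrite mul1n ltnW | exact: bnd_int].
  by rewrite (fit_bnd zb).
- case=> es en ew; have [|-> _] := IH es.
    by apply: leq_trans ew; apply: leq_word.
  have ab : bnd (cost (Cell e) * K.+1) (s (Num.truncn (ev s e))).
    by apply: bnd_le (sK _); rewrite /= mulSn ltnW // ltnS leq_addr.
  by rewrite /address en (fit_bnd ab).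
case=> s1 s2 so ow.
have [|-> b1] := IH1 s1; first by apply: leq_trans ow; apply: leq_word; lia.
have [|-> b2] := IH2 s2; first by apply: leq_trans ow; apply: leq_word; lia.
have ob : bnd (cost (Bin o e1 e2) * K.+1) (binop_val o (ev s e1) (ev s e2)).
  have le1 : ((cost e1 * K.+1 + cost e2 * K.+1).+1 <= cost (Bin o e1 e2) * K.+1)%N.
    by rewrite /= mulSn mulnDl; lia.
  case: o so {ow} le1 => so le1 /=.
  - exact: bnd_le le1 (bndD b1 b2).
  - exact: bnd_le le1 (bndB b1 b2).
  - exact: bnd_le (ltnW le1) (bndM b1 b2).
  - exact: bnd_le (ltnW le1) (bnd_div so b1 b2).
have -> : binop_sem o (ev s e1) (ev s e2) = Some (binop_val o (ev s e1) (ev s e2)).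
  by case: o so {ow ob} => //= /negPf ->.
by rewrite (fit_bnd ob).
Qed.

Definition den s e v := safe s e /\ ev s e = v.

Lemma den_lit s (z : int) : (`|z| <= 2 ^ 5)%N -> den s (Lit z) z%:~R.
Proof. by []. Qed.

Lemma den_cell s e (a : nat) : den s e a%:R -> den s (Cell e) (s a).
Proof. by case=> es eE; split; rewrite /= eE ?natrK // rpred_nat. Qed.

Lemma den_add s e1 e2 v1 v2 : den s e1 v1 -> den s e2 v2 -> den s (Bin OpAdd e1 e2) (v1 + v2).
Proof. by case=> ? <- [? <-]. Qed.

Lemma den_sub s e1 e2 v1 v2 : den s e1 v1 -> den s e2 v2 -> den s (Bin OpSub e1 e2) (v1 - v2).
Proof. by case=> ? <- [? <-]. Qed.

Lemma den_mul s e1 e2 v1 v2 : den s e1 v1 -> den s e2 v2 -> den s (Bin OpMul e1 e2) (v1 * v2).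
Proof. by case=> ? <- [? <-]. Qed.

Lemma den_div s e1 e2 v1 v2 : v2 != 0 -> den s e1 v1 -> den s e2 v2 ->
  den s (Bin OpDiv e1 e2) (v1 / v2).
Proof. by move=> v20 [? <-] [? E]; rewrite -E in v20 *. Qed.

Lemma den_eq s e v v' : v = v' -> den s e v -> den s e v'.
Proof. by move=> ->. Qed.

Inductive bexp :=
| BLe of expr & expr
| BNot of bexp
| BAnd of bexp & bexp.

Fixpoint bval s b : bool :=
  match b with
  | BLe e1 e2 => ev s e1 <= ev s e2
  | BNot b => ~~ bval s b
  | BAnd b1 b2 => bval s b1 && bval s b2
  end.

Fixpoint bsafe s b : Prop :=
  match b with
  | BLe e1 e2 => safe s e1 /\ safe s e2
  | BNot b => bsafe s b
  | BAnd b1 b2 => bsafe s b1 /\ bsafe s b2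
  end.

(** A conjunction duplicates [c2]; the cost measures count both copies and remain constants of the
    program. *)
Fixpoint cif b c1 c2 : cmd :=
  match b with
  | BLe e1 e2 => IfLe e1 e2 c1 c2
  | BNot b => cif b c2 c1
  | BAnd b1 b2 => cif b1 (cif b2 c1 c2) c2
  end.

Definition BOr b1 b2 := BNot (BAnd (BNot b1) (BNot b2)).
Definition BLt e1 e2 := BNot (BLe e2 e1).
Definition BEq e1 e2 := BAnd (BLe e1 e2) (BLe e2 e1).

Definition bden s b (x : bool) := bsafe s b /\ bval s b = x.

Lemma bden_le s e1 e2 v1 v2 : den s e1 v1 -> den s e2 v2 -> bden s (BLe e1 e2) (v1 <= v2).
Proof. by case=> ? <- [? <-]. Qed.
Lemma bden_not s b x : bden s b x -> bden s (BNot b) (~~ x).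
Proof. by case=> ? <-. Qed.
Lemma bden_and s b1 b2 x1 x2 : bden s b1 x1 -> bden s b2 x2 -> bden s (BAnd b1 b2) (x1 && x2).
Proof. by case=> ? <- [? <-]. Qed.
Lemma bden_or s b1 b2 x1 x2 : bden s b1 x1 -> bden s b2 x2 -> bden s (BOr b1 b2) (x1 || x2).
Proof. by case=> ? <- [? <-]; split=> //=; rewrite negb_and !negbK. Qed.
Lemma bden_lt s e1 e2 v1 v2 : den s e1 v1 -> den s e2 v2 -> bden s (BLt e1 e2) (v1 < v2).
Proof. by case=> ? <- [? <-]; split=> //=; rewrite ltNge. Qed.
Lemma bden_eq s e1 e2 v1 v2 : den s e1 v1 -> den s e2 v2 -> bden s (BEq e1 e2) (v1 == v2).
Proof. by case=> ? <- [? <-]; split=> //=; rewrite -eq_le. Qed.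

(** * Weakest preconditions with time and size budgets *)

Fixpoint maxcost c : nat :=
  match c with
  | Skip => 0
  | Assign ea e => maxn (cost ea) (cost e)
  | Seq c1 c2 => maxn (maxcost c1) (maxcost c2)
  | IfLe e1 e2 c1 c2 => maxn (maxn (cost e1) (cost e2)) (maxn (maxcost c1) (maxcost c2))
  | WhileLe e1 e2 c => maxn (maxn (cost e1) (cost e2)) (maxcost c)
  end.

Fixpoint depth c : nat :=
  match c with
  | Seq c1 c2 => maxn (depth c1) (depth c2)
  | IfLe _ _ c1 c2 => maxn (depth c1) (depth c2)
  | WhileLe _ _ c => (depth c).+1
  | _ => 0
  end.

(* If every loop of [c] runs at most N times, [c] takes time
   at most [tfactor c * N ^ depth c]. *)
Fixpoint tfactor c : nat :=
  match c with
  | Skip => 1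
  | Assign ea e => (cost ea + cost e).+1
  | Seq c1 c2 => (tfactor c1 + tfactor c2)%N
  | IfLe e1 e2 c1 c2 => (cost e1 + cost e2).+1 + (tfactor c1 + tfactor c2)
  | WhileLe e1 e2 c => (2 * (cost e1 + cost e2).+1 + tfactor c)%N
  end.

Fact wp_key : unit. Proof. exact: tt. Qed.

Section WeakestPrecondition.
Variables (K N M0 w : nat).
Hypotheses (K5 : (5 <= K)%N) (N0 : (0 < N)%N) (w_big : (word K M0 <= w)%N).
Implicit Types (s : memory) (Q : memory -> Prop).

(** The bound K is an invariant of the cells, so only stored values have to meet it; intermediate
    results are covered by [maxcost]. *)
Definition wp_def c Q s : Prop := (maxcost c <= M0)%N -> mem_bnd K s ->
  exists T s', [/\ exec w c s T s', (T <= tfactor c * N ^ depth c)%N, mem_bnd K s' & Q s'].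

(* Locked, lest automation evaluate the cost of a concrete command. *)
Definition wp c Q s : Prop := locked_with wp_key (wp_def c Q s).

Lemma wpE c Q s : wp c Q s = wp_def c Q s.
Proof. by rewrite /wp unlock. Qed.

Lemma eval_den s e v : mem_bnd K s -> (cost e <= M0)%N -> den s e v -> eval w s e = Some v.
Proof.
move=> sK eM [es <-]; case: (eval_safe K5 sK es (w := w)) => //.
by apply: leq_trans w_big; apply: leq_word.
Qed.

Lemma pow_ge d d' : (d <= d')%N -> (N ^ d <= N ^ d')%N.
Proof. by move=> dd; apply: leq_pexp2l. Qed.

Lemma pow_gt0 d : (0 < N ^ d)%N. Proof. by rewrite expn_gt0 N0. Qed.

Lemma wp_skip Q s : Q s -> wp Skip Q s.
Proof. by rewrite wpE => Qs _ sK; exists 1%N, s; split=> //; exact: ExecSkip. Qed.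

Lemma wp_seq c1 c2 Q s : wp c1 (wp c2 Q) s -> wp (Seq c1 c2) Q s.
Proof.
rewrite !wpE => w1; rewrite /wp_def /= geq_max => /andP[m1 m2] sK.
have [T1 [s1 [e1 t1 s1K w2]]] := w1 m1 sK; rewrite wpE in w2;
  have [T2 [s2 [e2 t2 s2K Qs2]]] := w2 m2 s1K.
exists (T1 + T2)%N, s2; split=> //; first exact: ExecSeq e1 e2.
rewrite mulnDl leq_add //.
  by apply: leq_trans t1 _; rewrite leq_mul2l pow_ge ?orbT ?leq_maxl.
by apply: leq_trans t2 _; rewrite leq_mul2l pow_ge ?orbT ?leq_maxr.
Qed.

Lemma wp_assign ea e (a : nat) v Q s : den s ea a%:R -> den s e v ->
  (mem_bnd K s -> bnd K v) -> Q (write s a v) -> wp (Assign ea e) Q s.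
Proof.
move=> ad ed vK Qs; rewrite wpE /wp_def /= geq_max => /andP[m1 m2] sK.
exists (cost ea + cost e).+1, (write s a v); split=> //.
- apply: ExecAssign; [exact: eval_den ad | | exact: eval_den ed].
  by rewrite /address rpred_nat natrK.
- by rewrite expn0 muln1.
by move=> a'; rewrite /write; case: eqP => _; auto.
Qed.

Lemma wp_if e1 e2 c1 c2 v1 v2 Q s : den s e1 v1 -> den s e2 v2 ->
  wp (if v1 <= v2 then c1 else c2) Q s -> wp (IfLe e1 e2 c1 c2) Q s.
Proof.
rewrite !wpE => d1 d2 w12; rewrite /wp_def /= !geq_max => /andP[/andP[m1 m2] /andP[mc1 mc2]] sK.
have [|T [s' [e12 t12 sK' Qs']]] := w12 _ sK; first by case: ifP.
exists ((cost e1 + cost e2).+1 + T)%N, s'; split=> //.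
  by apply: (ExecIf (v1 := v1) (v2 := v2)) => //; apply: eval_den.
rewrite mulnDl leq_add ?leq_pmulr ?pow_gt0 //; apply: leq_trans t12 _.
rewrite leq_mul //; first by case: ifP => _; rewrite ?leq_addr ?leq_addl.
by rewrite pow_ge //; case: ifP => _; rewrite ?leq_maxl ?leq_maxr.
Qed.

Lemma wp_cif b x c1 c2 Q s : bden s b x ->
  (x -> wp c1 Q s) -> (~~ x -> wp c2 Q s) -> wp (cif b c1 c2) Q s.
Proof.
case=> bs <-; elim: b c1 c2 bs => [e1 e2|b IH|b1 IH1 b2 IH2] c1 c2 /=.
- case=> s1 s2 w1 w2; apply: wp_if (conj s1 erefl) (conj s2 erefl) _.
  by case: ifP => [/w1|/negbT/w2].
- by move=> bs w1 w2; apply: (IH _ _ bs) => [bT|//]; refine (w2 _); rewrite bT.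
case=> s1 s2 w1 w2; apply: (IH1 _ _ s1) => b1T; last first.
  by refine (w2 _); rewrite negb_and b1T.
by apply: (IH2 _ _ s2) => b2T; [refine (w1 _)|refine (w2 _)]; rewrite b1T.
Qed.

Lemma wp_conseq c (Q Q' : memory -> Prop) s : (forall s',
  Q s' -> Q' s') -> wp c Q s -> wp c Q' s.
Proof.
rewrite !wpE => QQ wc mc sK; have [T [s' [? ? ? /QQ ?]]] := wc mc sK.
by exists T, s'.
Qed.

(** [I j] holds after j rounds. The k + 1 tests of the guard fit into the factor 2 of [tfactor]
    because N > 0. *)
Lemma wp_while (I : nat -> memory -> Prop) k e1 e2 c Q s : (k <= N)%N -> I 0%N s ->
  (forall j s, (j < k)%N -> I j s ->
     (exists v1 v2, [/\ den s e1 v1, den s e2 v2 & v1 <= v2]) /\ wp c (I j.+1) s) ->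
  (forall s, I k s -> (exists v1 v2, [/\ den s e1 v1, den s e2 v2 & v2 < v1]) /\ Q s) ->
  wp (WhileLe e1 e2 c) Q s.
Proof.
move=> kN I0 step stop; rewrite wpE /wp_def /= !geq_max => /andP[/andP[m1 m2] mc] sK.
pose C := ((cost e1 + cost e2).+1 + tfactor c * N ^ depth c)%N.
suff loop j : forall i s, (i + j = k)%N -> I i s -> mem_bnd K s ->
    exists T s', [/\ exec w (WhileLe e1 e2 c) s T s',
      (T <= j * C + (cost e1 + cost e2).+1)%N, mem_bnd K s' & Q s'].
  have [T [s' [ex tT sK' Qs']]] := loop k 0%N s (add0n k) I0 sK.
  exists T, s'; split=> //; apply: leq_trans tT _.
  have := leq_mul kN (leqnn C); rewrite /C.
  have := pow_gt0 (depth c); rewrite expnS;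
    move: (N ^ depth c)%N (cost e1 + cost e2).+1 (tfactor c).
  by move=> P E F; nia.
elim: j => [|j IH] i {I0 sK}s.
  rewrite addn0 => -> /stop[[v1 [v2 [d1 d2 v21]]] Qs] sK; exists (cost e1 + cost e2).+1, s.
  split=> //; apply: (ExecWhileStop _ (v1 := v1) (v2 := v2)); rewrite -?ltNge //;
    exact: eval_den.
move=> ij Ii sK; have ik : (i < k)%N by rewrite -ij -addSnnS leq_addr.
have [[v1 [v2 [d1 d2 v12]]] wc] := step i s ik Ii; rewrite wpE in wc.
have [T1 [s1 [ex1 t1 s1K I1]]] := wc mc sK.
have [|T2 [s2 [ex2 t2 s2K Qs2]]] := IH i.+1 s1 _ I1 s1K; first by rewrite addSnnS.
exists ((cost e1 + cost e2).+1 + T1 + T2)%N, s2; split=> //.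
  by apply: (ExecWhileLoop (v1 := v1) (v2 := v2) _ _ v12 ex1 ex2); apply: eval_den.
by rewrite mulSn -[leqRHS]addnA leq_add // /C leq_add2l.
Qed.

End WeakestPrecondition.

(** * The program *)

Notation "e1 +' e2" := (Bin OpAdd e1 e2) (at level 50, left associativity).
Notation "e1 -' e2" := (Bin OpSub e1 e2) (at level 50, left associativity).
Notation "e1 *' e2" := (Bin OpMul e1 e2) (at level 40, left associativity).
Notation "e1 /' e2" := (Bin OpDiv e1 e2) (at level 40, left associativity).
Notation "c1 ;' c2" := (Seq c1 c2) (at level 90, right associativity).

(* Cells 2n+4 .. 2n+16 hold the variables a, c, l, h (3 cells), found, a found,
   c found, t, x_a, x_c, counter; cells from 2n+20 on hold the vectors [slc_vec]. *)
Definition pn : expr := Cell (Lit 0).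
Definition pm : expr := Cell (Lit 1).
Definition paddr (k : nat) : expr := Lit 2 *' pn +' Lit k.
Definition pvar (k : nat) : expr := Cell (paddr (4 + k)).
Definition pset (k : nat) (e : expr) : cmd := Assign (paddr (4 + k)) e.
Definition ptab_addr (k : nat) (e : expr) : expr := paddr (20 + k) +' Lit 3 *' e.
Definition ptab (k : nat) (e : expr) : expr := Cell (ptab_addr k e).

Definition expr3 := (expr * expr * expr)%type.
Definition pdot (u v : expr3) : expr := u.1.1 *' v.1.1 +' u.1.2 *' v.1.2 +' u.2 *' v.2.
Definition pcross (u v : expr3) : expr3 :=
  (u.1.2 *' v.2 -' u.2 *' v.1.2, u.2 *' v.1.1 -' u.1.1 *' v.2,
    u.1.1 *' v.1.2 -' u.1.2 *' v.1.1).
Definition pdet (u v w : expr3) : expr := pdot (pcross u v) w.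
Definition pvec (e : expr) : expr3 := (ptab 0 e, ptab 1 e, ptab 2 e).
Definition ph : expr3 := (pvar 3, pvar 4, pvar 5).
Definition prhs : expr3 := (Cell (paddr 2), Cell (paddr 3), Lit 0).

Definition ptie (a c l : expr) : bexp :=
  let x := pdot (pcross (pvec a) (pvec c)) (pcross (pvec l) (pvec c)) in
  BAnd (BLt a c) (BAnd (BLt a l) (BOr (BLt (Lit 0) x) (BAnd (BEq x (Lit 0)) (BLt c l)))).

Definition psaturated (a c l : expr) : bexp :=
  let d := pdot (pcross (pvec a) (pvec c)) (pvec l) in
  BAnd (BNot (BEq l a)) (BAnd (BNot (BEq l c))
    (BOr (BLt (Lit 0) d) (BAnd (BEq d (Lit 0)) (BOr (ptie a c l) (ptie c a l))))).

Definition pgood (a c : expr) : bexp :=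
  let va := pvec a in let vc := pvec c in let y := pcross va vc in
  BAnd (BLt (Lit 0) (pdet va vc ph)) (BAnd (BLt (Lit 0) (pdet va vc prhs))
  (BAnd (BLe (Lit 0) (pdet prhs vc ph)) (BAnd (BLe (Lit 0) (pdet va prhs ph))
  (BAnd (BOr (BNot (BLt a pn)) (BLe (pdet prhs vc ph) (pdet va vc prhs)))
  (BAnd (BOr (BNot (BLt c pn)) (BLe (pdet va prhs ph) (pdet va vc prhs)))
  (BAnd (BLe (Lit 0) y.1.1) (BAnd (BLe (Lit 0) y.1.2) (BLe (Lit 0) y.2)))))))).

Definition for_jobs (body : cmd) : cmd :=
  pset 2 (Lit 0) ;' WhileLe (pvar 2) (pn -' Lit 1) (body ;' pset 2 (pvar 2 +' Lit 1)).

(** The table preserves the rows of [A], whose cells will receive the output. Memory beyond the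
    input is 0, so only the entry -1 of each slack vector is written. *)
Definition fill_table : cmd :=
  for_jobs (Assign (ptab_addr 0 (pvar 2)) (Cell (pvar 2 +' Lit 2)) ;'
            Assign (ptab_addr 1 (pvar 2)) (Cell (pn +' pvar 2 +' Lit 2)) ;'
            Assign (ptab_addr 2 (pvar 2)) (Lit (- 1))) ;'
  Assign (ptab_addr 0 pn) (Lit (- 1)) ;'
  Assign (ptab_addr 1 (pn +' Lit 1)) (Lit (- 1)) ;'
  Assign (ptab_addr 2 (pn +' Lit 2)) (Lit (- 1)).

Definition compute_h : cmd :=
  pset 3 (Lit 0) ;' pset 4 (Lit 0) ;' pset 5 pm ;'
  for_jobs (cif (psaturated (pvar 0) (pvar 1) (pvar 2))
    (pset 3 (pvar 3 +' ptab 0 (pvar 2)) ;' pset 4 (pvar 4 +' ptab 1 (pvar 2)) ;'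
     pset 5 (pvar 5 +' ptab 2 (pvar 2)))
    Skip).

(** All pairs are tried and the last good one is kept. The cell found starts at 0 because it lies
    beyond the input. *)
Definition search : cmd :=
  pset 0 (Lit 0) ;'
  WhileLe (pvar 0) (pn +' Lit 2) (
    pset 1 (Lit 0) ;'
    WhileLe (pvar 1) (pn +' Lit 2) (
      compute_h ;'
      cif (pgood (pvar 0) (pvar 1))
        (pset 6 (Lit 1) ;' pset 7 (pvar 0) ;' pset 8 (pvar 1)) Skip ;'
      pset 1 (pvar 1 +' Lit 1)) ;'
    pset 0 (pvar 0 +' Lit 1)).

Definition px (e : expr) : expr := e +' Lit 2.
Definition psigma (e : expr) : expr := pn +' e +' Lit 2.

Definition place (e x r : expr) : cmd :=
  cif (BLt e pn)
    (Assign (px e) x ;'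
     cif (BLe r (pm -' Lit 1)) (Assign (psigma e) r) (Assign (psigma e) (pm -' Lit 1)))
    Skip.

(** Cells 0 and 1 hold n and m, which address all other cells, so they are overwritten last. *)
Definition output : cmd :=
  let va := pvec (pvar 0) in let vc := pvec (pvar 1) in
  pset 0 (pvar 7) ;' pset 1 (pvar 8) ;' compute_h ;'
  pset 9 (pdet va vc prhs /' pdet va vc ph) ;'
  pset 10 (pdet prhs vc ph /' pdet va vc ph) ;'
  pset 11 (pdet va prhs ph /' pdet va vc ph) ;'
  pset 12 (Lit 0) ;'
  for_jobs (cif (psaturated (pvar 0) (pvar 1) (pvar 2))
    (Assign (px (pvar 2)) (pvar 9) ;' Assign (psigma (pvar 2)) (pvar 12) ;'
     pset 12 (pvar 12 +' Lit 1))
    (Assign (px (pvar 2)) (Lit 0) ;' Assign (psigma (pvar 2)) (Lit 0))) ;'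
  place (pvar 0) (pvar 10) (pvar 12) ;'
  place (pvar 1) (pvar 11) (pvar 12 +' Lit 1) ;'
  Assign (Lit 1) (pvar 9) ;' Assign (Lit 0) (Lit 1).

Definition output_zero : cmd :=
  for_jobs (Assign (px (pvar 2)) (Lit 0) ;' Assign (psigma (pvar 2)) (Lit 0)) ;'
  Assign (Lit 1) (Lit 0) ;' Assign (Lit 0) (Lit 1).

Definition slc_prog : cmd :=
  fill_table ;'
  cif (BAnd (BLe (Cell (paddr 2)) (Lit 0)) (BLe (Cell (paddr 3)) (Lit 0)))
    output_zero
    (search ;' cif (BLe (pvar 6) (Lit 0)) (Assign (Lit 0) (Lit 0)) output).

Lemma depth_slc_prog : (depth slc_prog <= 4)%N.
Proof. by vm_compute. Qed.

(** * Memory layout and values of expressions *)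

Section Memory.
Variables (m n : nat) (A : 'M[rat]_(2, n)) (b : 'cV[rat]_2).
Implicit Types (s : memory) (tau : seq rat) (W U : nat -> rat).
Notation V := (slc_vec A).

(** [tau] lists the thirteen variables, [W] the 2n cells holding [A] at first and the solution
    later, [U] the table. *)
Record rep s tau W U : Prop := Rep {
  rep_n : s 0%N = n%:R;
  rep_m : s 1%N = m%:R;
  rep_b0 : s (2 * n + 2)%N = b 0 0;
  rep_b1 : s (2 * n + 3)%N = b 1 0;
  rep_var : forall k, (k < 13)%N -> s (2 * n + (4 + k))%N = nth 0 tau k;
  rep_out : forall i, (i < 2 * n)%N -> s (2 + i)%N = W i;
  rep_tab : forall i, s (2 * n + (20 + i))%N = U i }.

Definition upd (F : nat -> rat) i v : nat -> rat := fun j => if j == i then v else F j.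

Lemma write_neq s a a' v : a' != a -> write s a v a' = s a'.
Proof. by rewrite /write => /negPf->. Qed.

Lemma rep_write_var s tau W U k v : (k < 13)%N -> rep s tau W U ->
  rep (write s (2 * n + (4 + k)) v) (set_nth 0 tau k v) W U.
Proof.
move=> k13 [rn rm rb0 rb1 rv ro rt]; split; try by rewrite write_neq //; lia.
- by move=> j j13; rewrite nth_set_nth /write /= !eqn_add2l; case: eqP => // _; exact: rv.
- by move=> i i2; rewrite write_neq ?ro //; lia.
- by move=> i; rewrite write_neq ?rt //; lia.
Qed.

Lemma rep_write_out s tau W U i v : (i < 2 * n)%N -> rep s tau W U ->
  rep (write s (2 + i) v) tau (upd W i v) U.
Proof.
move=> i2n [rn rm rb0 rb1 rv ro rt]; split; try by rewrite write_neq //; lia.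
- by move=> j j13; rewrite write_neq ?rv //; lia.
- by move=> j i2; rewrite /upd /write eqn_add2l; case: eqP => // _; exact: ro.
- by move=> j; rewrite write_neq ?rt //; lia.
Qed.

Lemma rep_write_tab s tau W U i v : rep s tau W U ->
  rep (write s (2 * n + (20 + i)) v) tau W (upd U i v).
Proof.
move=> [rn rm rb0 rb1 rv ro rt]; split; try by rewrite write_neq //; lia.
- by move=> j j13; rewrite write_neq ?rv //; lia.
- by move=> j i2; rewrite write_neq ?ro //; lia.
- by move=> j; rewrite /upd /write !eqn_add2l; case: eqP.
Qed.

Definition is_table U := forall i, (i < n.+3)%N -> (U (3 * i)%N, U (1 + 3 * i)%N,
  U (2 + 3 * i)%N) = V i.

Section Denotations.
Variables (s : memory) (tau : seq rat) (W U : nat -> rat).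
Hypothesis (rs : rep s tau W U).

Lemma den_litn k : (k <= 32)%N -> den s (Lit k) k%:R.
Proof. by move=> k32; apply: (den_lit s (z := k)). Qed.

Lemma den_pn : den s pn n%:R.
Proof. by rewrite -(rep_n rs); apply: (den_cell (a := 0)); exact: den_litn. Qed.

Lemma den_pm : den s pm m%:R.
Proof. by rewrite -(rep_m rs); apply: (den_cell (a := 1)); exact: den_litn. Qed.

Lemma den_addn e1 e2 (a1 a2 : nat) : den s e1 a1%:R -> den s e2 a2%:R ->
  den s (e1 +' e2) (a1 + a2)%N%:R.
Proof. by rewrite natrD; exact: den_add. Qed.

Lemma den_muln e1 e2 (a1 a2 : nat) : den s e1 a1%:R -> den s e2 a2%:R ->
  den s (e1 *' e2) (a1 * a2)%N%:R.
Proof. by rewrite natrM; exact: den_mul. Qed.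

Lemma den_paddr k : (k <= 32)%N -> den s (paddr k) (2 * n + k)%N%:R.
Proof.
move=> k32; apply: den_addn; last exact: den_litn.
by apply: den_muln; [exact: den_litn | exact: den_pn].
Qed.

Lemma den_pvar k : (k < 13)%N -> den s (pvar k) (nth 0 tau k).
Proof. by move=> k13; rewrite -(rep_var rs) //; apply/den_cell/den_paddr; lia. Qed.

Lemma den_ptab_addr k e i : (k < 3)%N -> den s e i%:R ->
  den s (ptab_addr k e) (2 * n + (20 + (k + 3 * i)))%N%:R.
Proof.
move=> k3 de; rewrite [(20 + _)%N]addnA addnA; apply: den_addn; first by apply: den_paddr; lia.
by apply: den_muln => //; exact: den_litn.
Qed.

Lemma den_px e i : den s e i%:R -> den s (px e) (2 + i)%N%:R.
Proof. by move=> de; rewrite addnC; apply: den_addn => //; exact: den_litn. Qed.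

Lemma den_psigma e i : den s e i%:R -> den s (psigma e) (2 + (n + i))%N%:R.
Proof.
move=> de; rewrite addnC; apply: den_addn; last exact: den_litn.
by apply: den_addn => //; exact: den_pn.
Qed.

Definition den3 (e : expr3) (v : vec3 rat) :=
  [/\ den s e.1.1 v.1.1, den s e.1.2 v.1.2 & den s e.2 v.2].

Lemma den_pdot e1 e2 v1 v2 : den3 e1 v1 -> den3 e2 v2 -> den s (pdot e1 e2) (dot v1 v2).
Proof. by case=> ? ? ? [? ? ?]; do ![apply: den_add]; apply: den_mul. Qed.

Lemma den_pcross e1 e2 v1 v2 : den3 e1 v1 -> den3 e2 v2 -> den3 (pcross e1 e2) (cross v1 v2).
Proof. by case=> ? ? ? [? ? ?]; split; apply: den_sub; apply: den_mul. Qed.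

Lemma den_pdet e1 e2 e3 v1 v2 v3 : den3 e1 v1 -> den3 e2 v2 -> den3 e3 v3 ->
  den s (pdet e1 e2 e3) (det3 v1 v2 v3).
Proof. by move=> ? ? ?; apply: den_pdot => //; exact: den_pcross. Qed.

Lemma den_prhs : den3 prhs (slc_rhs b).
Proof.
split=> /=; last exact: den_litn.
  by rewrite -(rep_b0 rs); apply/den_cell/den_paddr.
by rewrite -(rep_b1 rs); apply/den_cell/den_paddr.
Qed.

Lemma bden_ltn e1 e2 a1 a2 : den s e1 a1%:R -> den s e2 a2%:R -> bden s (BLt e1 e2) (a1 < a2)%N.
Proof. by move=> d1 d2; rewrite -(ltr_nat rat); exact: bden_lt. Qed.

Lemma bden_eqn e1 e2 a1 a2 : den s e1 a1%:R -> den s e2 a2%:R -> bden s (BEq e1 e2) (a1 ==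
  a2)%N.
Proof. by move=> d1 d2; rewrite -(eqr_nat rat); exact: bden_eq. Qed.

Hypothesis (tU : is_table U).

Lemma den_pvec e i : (i < n.+3)%N -> den s e i%:R -> den3 (pvec e) (V i).
Proof.
move=> iN de; rewrite -tU //; split; rewrite /= -(rep_tab rs).
- exact/den_cell/(den_ptab_addr (k := 0)).
- exact/den_cell/(den_ptab_addr (k := 1)).
- exact/den_cell/(den_ptab_addr (k := 2)).
Qed.

Section Test.
Variables (ea ec el : expr) (a c l : nat).
Hypotheses (da : den s ea a%:R) (dc : den s ec c%:R) (dl : den s el l%:R).
Hypotheses (aN : (a < n.+3)%N) (cN : (c < n.+3)%N) (lN : (l < n.+3)%N).

Let dva := den_pvec aN da.
Let dvc := den_pvec cN dc.
Let dvl := den_pvec lN dl.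
Let dy := den_pcross dva dvc.
Let d0 := den_litn (leq0n 32).

Lemma bden_ptie : bden s (ptie ea ec el) (tie A a c l).
Proof.
have dx := den_pdot dy (den_pcross dvl dvc).
apply: bden_and (bden_ltn da dc) (bden_and (bden_ltn da dl) _).
apply: bden_or (bden_lt d0 dx) (bden_and (bden_eq dx d0) (bden_ltn dc dl)).
Qed.

Hypothesis dh : den3 ph (t_col m A (saturated A a c)).

Lemma bden_pgood : bden s (pgood ea ec) (good m A b a c).
Proof.
have dr := den_prhs; have [y1 y2 y3] := dy.
rewrite /good !implybE.
apply: bden_and (bden_lt d0 (den_pdet dva dvc dh)) _.
apply: bden_and (bden_lt d0 (den_pdet dva dvc dr)) _.
apply: bden_and (bden_le d0 (den_pdet dr dvc dh)) _.
apply: bden_and (bden_le d0 (den_pdet dva dr dh)) _.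
apply: bden_and (bden_or (bden_not (bden_ltn da den_pn)) _) _.
  exact: bden_le (den_pdet dr dvc dh) (den_pdet dva dvc dr).
apply: bden_and (bden_or (bden_not (bden_ltn dc den_pn)) _) _.
  exact: bden_le (den_pdet dva dr dh) (den_pdet dva dvc dr).
exact: bden_and (bden_le d0 y1) (bden_and (bden_le d0 y2) (bden_le d0 y3)).
Qed.

End Test.

Lemma bden_psaturated ea ec el a c l :
  den s ea a%:R -> den s ec c%:R -> den s el l%:R ->
  (a < n.+3)%N -> (c < n.+3)%N -> (l < n.+3)%N ->
  bden s (psaturated ea ec el) (saturated A a c l).
Proof.
move=> da dc dl aN cN lN; have d0 := den_litn (leq0n 32).
have dd := den_pdot (den_pcross (den_pvec aN da) (den_pvec cN dc)) (den_pvec lN dl).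
apply: bden_and (bden_not (bden_eqn dl da)) (bden_and (bden_not (bden_eqn dl dc)) _).
apply: bden_or (bden_lt d0 dd) (bden_and (bden_eq dd d0) _).
by apply: bden_or; apply: bden_ptie.
Qed.

End Denotations.
End Memory.

Local Arguments cif : simpl never.

(** * Verification of the search and of the output *)

Section Program.
Variables (m n : nat) (A : 'M[rat]_(2, n)) (b : 'cV[rat]_2).
Hypothesis (n0 : (0 < n)%N).
Variables (K M0 w : nat).
Hypotheses (K5 : (5 <= K)%N) (w_big : (word K M0 <= w)%N).
Implicit Types (s : memory) (tau r : seq rat) (W U : nat -> rat) (Q : memory -> Prop).

Notation V := (slc_vec A).
Notation rep := (rep m n b).
Notation wp := (wp K n.+3 M0 w).
Notation sat := (saturated A).

Definition h_part (S : pred nat) k : vec3 rat :=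
  (\sum_(0 <= l < k | S l) (V l).1.1, \sum_(0 <= l < k | S l) (V l).1.2,
   m%:R + \sum_(0 <= l < k | S l) (V l).2).

(** Size obligations for stored values: counters, machine numbers, partial sums of h and the three
    final quotients. *)
Hypothesis (K_small : forall k, (k <= n.+3)%N -> bnd K k%:R).
Hypothesis (K_machine : forall k, (k <= m)%N -> bnd K k%:R).
Hypothesis (K_h : forall S k, (k <= n)%N ->
  [/\ bnd K (h_part S k).1.1, bnd K (h_part S k).1.2 & bnd K (h_part S k).2]).
Hypothesis (K_good : forall a c, (a < n.+3)%N -> (c < n.+3)%N -> good m A b a c ->
  [/\ bnd K (good_t m A b a c), bnd K (good_xa m A b a c) & bnd K (good_xc m A b a c)]).

Lemma K0 : bnd K 0. Proof. exact: (K_small (k := 0)). Qed.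
Lemma K1 : bnd K 1. Proof. by apply: (K_small (k := 1)). Qed.

Lemma sum_nat_recr_cond (V : nmodType) (S : pred nat) k (F : nat -> V) :
  \sum_(0 <= l < k.+1 | S l) F l = \sum_(0 <= l < k | S l) F l + (if S k then F k else 0).
Proof. by rewrite big_mkcond big_nat_recr //= -big_mkcond. Qed.

Lemma h_partS S k : h_part S k.+1 = if S k then
  ((h_part S k).1.1 + (V k).1.1, (h_part S k).1.2 + (V k).1.2, (h_part S k).2 + (V k).2)
  else h_part S k.
Proof. by rewrite /h_part !sum_nat_recr_cond; case: ifP => _ /=; rewrite ?addr0 ?addrA. Qed.

Lemma wp_pset k e v s tau W U Q : (k < 13)%N -> rep s tau W U -> den s e v ->
  (mem_bnd K s -> bnd K v) -> (forall s', rep s' (set_nth 0 tau k v) W U -> Q s') ->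
  wp (pset k e) Q s.
Proof.
move=> k13 rs de vK H; apply: (wp_assign _ K5 w_big _ de vK); last exact/H/rep_write_var.
by apply: den_paddr rs _ _; lia.
Qed.

Lemma wp_out ea e i v s tau W U Q : (i < 2 * n)%N -> rep s tau W U ->
  den s ea (2 + i)%N%:R -> den s e v ->
  (mem_bnd K s -> bnd K v) -> (forall s', rep s' tau (upd W i v) U -> Q s') ->
  wp (Assign ea e) Q s.
Proof.
by move=> i2 rs da de vK H; apply: (wp_assign _ K5 w_big da de vK); exact/H/rep_write_out.
Qed.

Lemma wp_tab k ea e i v s tau W U Q : (k < 3)%N -> rep s tau W U -> den s ea i%:R -> den s e v
  ->
  (mem_bnd K s -> bnd K v) -> (forall s', rep s' tau W (upd U (k + 3 * i) v) -> Q s') ->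
  wp (Assign (ptab_addr k ea) e) Q s.
Proof.
move=> k3 rs da de vK H; apply: (wp_assign _ K5 w_big (den_ptab_addr rs k3 da) de vK).
exact/H/rep_write_tab.
Qed.

(** The invariant exposes the counter cell. The body leaves it at k, and [I k.+1] is due only after
    the increment. *)
Lemma wp_for_jobs (I : nat -> memory -> Prop) body s Q tau W U :
  rep s tau W U ->
  (forall s', rep s' (set_nth 0 tau 2 0) W U -> I 0%N s') ->
  (forall k s, I k s -> exists tau W U, rep s tau W U /\ nth 0 tau 2 = k%:R) ->
  (forall k s, (k < n)%N -> I k s ->
    wp body (fun s => exists tau W U, [/\ rep s tau W U, nth 0 tau 2 = k%:R &
      forall s', rep s' (set_nth 0 tau 2 k.+1%:R) W U -> I k.+1 s']) s) ->
  (forall s, I n s -> Q s) ->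
  wp (for_jobs body) Q s.
Proof.
move=> rs I0 Irep step stop; apply: (wp_seq (ltn0Sn _)).
apply: (wp_pset _ rs (den_litn s (leq0n 32))) => // [_|s1 r1]; first exact: K0.
apply: (wp_while K5 (ltn0Sn _) w_big (I := I) (k := n)) => //; try lia.
- exact: I0.
- move=> k s2 kn I2; have [tau2 [W2 [U2 [r2 E2]]]] := Irep _ _ I2; split.
    exists k%:R, (n%:R - 1); split.
    + by rewrite -E2; exact: den_pvar r2 _ _.
    + by apply: den_sub; [exact: den_pn r2 | exact: den_litn].
    + by rewrite lerBrDr natr1 ler_nat.
  apply: (wp_seq (ltn0Sn _)); apply: wp_conseq (step _ _ kn I2) => s3 [tau3 [W3 [U3 [r3 E3
    I3]]]].
  apply: (wp_pset (v := k.+1%:R) _ r3) => //; last by move=> _; apply: K_small; lia.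
  by rewrite -natr1; apply: den_add; [rewrite -E3;
    exact: den_pvar r3 _ _ | exact: (den_litn _ (k := 1))].
move=> s2 I2; have [tau2 [W2 [U2 [r2 E2]]]] := Irep _ _ I2; split; last exact: stop.
exists n%:R, (n%:R - 1); split.
- by rewrite -E2; exact: den_pvar r2 _ _.
- by apply: den_sub; [exact: den_pn r2 | exact: den_litn].
- by rewrite ltrBlDr ltrDl.
Qed.

Lemma wp_compute_h (a c : nat) x2 x3 x4 x5 r W U s Q :
  rep s [:: a%:R, c%:R, x2, x3, x4, x5 & r] W U -> is_table A U ->
  (a < n.+3)%N -> (c < n.+3)%N ->
  (forall s', let h := t_col m A (sat a c) in
     rep s' [:: a%:R, c%:R, n%:R, h.1.1, h.1.2, h.2 & r] W U -> Q s') ->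
  wp compute_h Q s.
Proof.
move=> r0 tU aN cN HQ; apply: (wp_seq (ltn0Sn _)).
apply: (wp_pset _ r0 (den_litn s (leq0n 32))) => // [_|s1 /= r1]; first exact: K0.
apply: (wp_seq (ltn0Sn _)).
apply: (wp_pset _ r1 (den_litn s1 (leq0n 32))) => // [_|s2 /= r2]; first exact: K0.
apply: (wp_seq (ltn0Sn _)).
apply: (wp_pset _ r2 (den_pm r2)) => // [_|s3 /= r3]; first exact: K_machine.
pose h k := h_part (sat a c) k.
pose I k s := rep s [:: a%:R, c%:R, k%:R, (h k).1.1, (h k).1.2, (h k).2 & r] W U.
apply: (wp_for_jobs (I := I) r3) => //.
- by move=> s4; rewrite /I /h /h_part !big_geq //= addr0.
- by move=> k s4 r4; eexists _, W, U; split; first exact: r4.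
move=> k s4 kn r4; have kN : (k < n.+3)%N by lia.
have dk : den s4 (pvar 2) k%:R := den_pvar r4 (isT : (2 < 13)%N).
have dS := bden_psaturated r4 tU (den_pvar r4 (isT : (0 < 13)%N))
  (den_pvar r4 (isT : (1 < 13)%N)) dk aN cN kN.
have [K1' K2' K3'] := K_h (sat a c) kn.
apply: (wp_cif K5 (ltn0Sn _) w_big dS) => // Sk; last first.
  apply: wp_skip; eexists _, W, U; split; [exact: r4 | by [] | move=> s5 /=].
  by rewrite /I /h h_partS (negPf Sk).
rewrite h_partS Sk in K1' K2' K3'.
have [d0 d1 d2] := den_pvec r4 tU kN dk.
apply: (wp_seq (ltn0Sn _)); apply: (wp_pset _ r4 (den_add (den_pvar r4 (isT : (3 < 13)%N))
  d0)) => // s5 /= r5.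
have {}dk : den s5 (pvar 2) k%:R := den_pvar r5 (isT : (2 < 13)%N).
have {d0 d1 d2}[d0 d1 d2] := den_pvec r5 tU kN dk.
apply: (wp_seq (ltn0Sn _)); apply: (wp_pset _ r5 (den_add (den_pvar r5 (isT : (4 < 13)%N))
  d1)) => // s6 /= r6.
have {}dk : den s6 (pvar 2) k%:R := den_pvar r6 (isT : (2 < 13)%N).
have {d0 d1 d2}[d0 d1 d2] := den_pvec r6 tU kN dk.
apply: (wp_pset _ r6 (den_add (den_pvar r6 (isT : (5 < 13)%N)) d2)) => // s7 /= r7.
eexists _, W, U; split; [exact: r7 | by [] | move=> s8 /=].
by rewrite /I /h h_partS Sk.
Qed.

(* Contents of the cells found, a found, c found once the pairs in [P] have been tried. *)
Definition found_spec (fl fa fc : rat) (P : nat -> nat -> bool) : Prop :=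
  (exists a c, [/\ fl = 1, fa = a%:R, fc = c%:R & [/\ (a < n.+3)%N,
    (c < n.+3)%N & good m A b a c]])
  \/ fl = 0 /\ (forall a c, (c < n.+3)%N -> P a c -> ~~ good m A b a c).

Definition search_state r W U (i : nat) (x1 : rat) (P : nat -> nat -> bool) s : Prop :=
  exists x2 x3 x4 x5 fl fa fc,
    rep s [:: i%:R, x1, x2, x3, x4, x5, fl, fa, fc & r] W U /\ found_spec fl fa fc P.

Lemma den_succ s k (i : nat) : den s (pvar k) i%:R -> den s (pvar k +' Lit 1) i.+1%:R.
Proof. by move=> de; rewrite -natr1; apply: den_add de (den_litn s (isT : (1 <= 32)%N)). Qed.

Lemma den_pn2 s tau W U : rep s tau W U -> den s (pn +' Lit 2) n.+2%:R.
Proof. by move=> rs; rewrite -[n.+2]addn2;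
  apply: den_addn (den_pn rs) (den_litn s (isT : (2 <= 32)%N)). Qed.

Lemma found_spec_weaken fl fa fc (P P' : nat -> nat -> bool) :
  (forall a c, (c < n.+3)%N -> P' a c -> P a c) -> found_spec fl fa fc P -> found_spec fl fa
    fc P'.
Proof.
move=> PP [?|[fl0 no]]; [by left | right; split=> // a c cN Pac]; exact/no/PP.
Qed.

Lemma wp_search x0 x1 x2 x3 x4 x5 fa fc r W U s Q :
  rep s [:: x0, x1, x2, x3, x4, x5, 0, fa, fc & r] W U -> is_table A U ->
  (forall s' i y, search_state r W U i y (fun a c => (a < n.+3)%N) s' -> Q s') ->
  wp search Q s.
Proof.
move=> r0 tU HQ; apply: (wp_seq (ltn0Sn _)).
apply: (wp_pset _ r0 (den_litn s (leq0n 32))) => // [_|s1 r1]; first exact: K0.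
pose I i s := exists y, search_state r W U i y (fun a c => (a < i)%N) s.
apply: (wp_while K5 (ltn0Sn _) w_big (I := I) (k := n.+3)) => //; last first.
- move=> s2 [y I2]; split; last exact: HQ I2.
  have [y2 [y3 [y4 [y5 [fl [fa' [fc' [r2 _]]]]]]]] := I2.
  exists n.+3%:R, n.+2%:R; split; last by rewrite ltr_nat.
    exact: den_pvar r2 0 isT.
  exact: den_pn2 r2.
- move=> i s2 iN [y [y2 [y3 [y4 [y5 [fl [fa' [fc' [r2 f2]]]]]]]]]; split.
    exists i%:R, n.+2%:R; split; last by rewrite ler_nat -ltnS.
      exact: den_pvar r2 0 isT.
    exact: den_pn2 r2.
  apply: (wp_seq (ltn0Sn _)).
  apply: (wp_pset _ r2 (den_litn s2 (leq0n 32))) => // [_|s3 r3]; first exact: K0.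
  rewrite /= in r3; apply: (wp_seq (ltn0Sn _)).
  (* The pairs tried so far are those preceding (i, j) lexicographically. *)
  pose J j := search_state r W U i j%:R (fun a c => (a < i)%N || (a == i) && (c < j)%N).
  apply: (wp_while K5 (ltn0Sn _) w_big (I := J) (k := n.+3)) => //; last first.
  + move=> s4 [z2 [z3 [z4 [z5 [fl4 [fa4 [fc4 [r4 f4]]]]]]]]; split.
      exists n.+3%:R, n.+2%:R; split; last by rewrite ltr_nat.
        exact: den_pvar r4 1 isT.
      exact: den_pn2 r4.
    apply: (wp_pset _ r4 (den_succ (den_pvar r4 (isT : (0 < 13)%N)))) => // [_|s5 r5].
      exact: K_small.
    exists n.+3%:R, z2, z3, z4, z5, fl4, fa4, fc4; split; first exact: r5.
    apply: found_spec_weaken f4 => a c cN; rewrite ltnS leq_eqVlt orbC cN andbT.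
    by [].
  + move=> j s4 jN [z2 [z3 [z4 [z5 [fl4 [fa4 [fc4 [r4 f4]]]]]]]]; split.
      exists j%:R, n.+2%:R; split; last by rewrite ler_nat -ltnS.
        exact: den_pvar r4 1 isT.
      exact: den_pn2 r4.
    apply: (wp_seq (ltn0Sn _)); apply: (wp_compute_h r4) => // s5 h r5.
    apply: (wp_seq (ltn0Sn _)).
    have da := den_pvar r5 (isT : (0 < 13)%N); have dc := den_pvar r5 (isT : (1 < 13)%N).
    have dh : den3 s5 ph h by split;
      [exact: den_pvar r5 3 isT | exact: den_pvar r5 4 isT | exact: den_pvar r5 5 isT].
    have dg := bden_pgood r5 tU da dc iN jN dh.
    apply: (wp_cif K5 (ltn0Sn _) w_big dg) => gij.
      apply: (wp_seq (ltn0Sn _)).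
      apply: (wp_pset _ r5 (den_litn s5 (isT : (1 <= 32)%N))) => // [_|s6 r6]; first exact: K1.
      apply: (wp_seq (ltn0Sn _)); rewrite /= in r6.
      apply: (wp_pset _ r6 (den_pvar r6 (isT : (0 < 13)%N))) => // [_|s7 r7];
        first exact/K_small/ltnW.
      rewrite /= in r7.
      apply: (wp_pset _ r7 (den_pvar r7 (isT : (1 < 13)%N))) => // [_|s8 r8];
        first exact/K_small/ltnW.
      rewrite /= in r8.
      apply: (wp_pset _ r8 (den_succ (den_pvar r8 (isT : (1 < 13)%N)))) => // [_|s9 r9];
        first exact: K_small.
      rewrite /= in r9; do 7!eexists; split; first exact: r9.
      by left; exists i, j.
    apply: wp_skip.
    apply: (wp_pset _ r5 (den_succ (den_pvar r5 (isT : (1 < 13)%N)))) => // [_|s9 r9];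
      first exact: K_small.
    rewrite /= in r9; do 7!eexists; split; first exact: r9.
    case: f4 => [?|[fl0 no]]; [by left | right; split=> // a c cN].
    case/orP => [ai|/andP[/eqP-> ]]; first by apply: no; rewrite ?ai.
    by rewrite ltnS leq_eqVlt => /predU1P[-> //|cj]; apply: no; rewrite // eqxx cj orbT.
  do 7!eexists; split; first exact: r3.
  by apply: found_spec_weaken f2 => a c _; rewrite andbF orbF.
by exists x1; do 7!eexists; split; [exact: r1 | right; split].
Qed.

Section Output.
Variables (a c : nat).
Hypotheses (aN : (a < n.+3)%N) (cN : (c < n.+3)%N) (gd : good m A b a c) (m0 : (0 < m)%N).

Definition rank k := (\sum_(0 <= j < k) sat a c j)%N.

Lemma rankS k : rank k.+1 = (rank k + sat a c k)%N.
Proof. by rewrite /rank big_nat_recr. Qed.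

Lemma rank_le k : (rank k <= k)%N.
Proof. by elim: k => [|k IH]; [rewrite /rank big_geq | rewrite rankS -addn1 leq_add //
  leq_b1]. Qed.

(** The indices a and c take the next two machines, capped so that they meet on machine m - 1 if
    only that one is left. The remaining jobs have time 0. *)
Definition machine l :=
  if l == a then minn (rank n) m.-1 else if l == c then minn (rank n).+1 m.-1
  else if sat a c l then rank l else 0%N.

Lemma den_pred_m s tau W U : rep s tau W U -> den s (pm -' Lit 1) m.-1%:R.
Proof.
move=> rs; apply: den_eq (den_sub (den_pm rs) (den_litn s (isT : (1 <= 32)%N))).
by rewrite -{1}(prednK m0) -natr1 addrK.
Qed.

Lemma wp_place k e x p i v (rk : nat) s tau W U Q : (k < 13)%N -> e = pvar k ->
  rep s tau W U -> nth 0 tau k = i%:R -> den s x v ->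
  (forall s', rep s' tau (upd W i v) U -> den s' p rk%:R) -> bnd K v -> bnd K rk%:R ->
  (forall s' W', rep s' tau W' U ->
     (forall l, (l < n)%N -> W' l = if l == i then v else W l) ->
     (forall l, (l < n)%N -> W' (n + l)%N = if l == i then (minn rk m.-1)%:R else W (n + l)%N)
       ->
     Q s') ->
  wp (place e x p) Q s.
Proof.
move=> k13 -> r0 ki dx dp vK rK HQ.
have di s' W' : rep s' tau W' U -> den s' (pvar k) i%:R by move=> r'; rewrite -ki;
  apply: den_pvar r' _ _.
apply: (wp_cif K5 (ltn0Sn _) w_big (bden_ltn (di _ _ r0) (den_pn r0))) => [i_n|ni]; last first.
  apply: wp_skip; apply: (HQ s W) => // l ln; rewrite ifF //; apply/eqP => li.
    by rewrite -li ln in ni.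
  by rewrite -li ln in ni.
apply: (wp_seq (ltn0Sn _)).
apply: (wp_out (i := i) _ r0 (den_px (di _ _ r0)) dx) => // [|s1 r1]; first lia.
have dm := den_pred_m r1; have d1 := dp _ r1.
have ds := den_psigma r1 (di _ _ r1).
have bl : bden s1 (BLe p (pm -' Lit 1)) (rk <= m.-1)%N by rewrite -(ler_nat rat);
  exact: bden_le.
have HQ' s' : rep s' tau (upd (upd W i v) (n + i) (minn rk m.-1)%:R) U -> Q s'.
  move=> r'; apply: HQ r' _ _ => l ln; rewrite /upd ?eqn_add2l.
    by rewrite ifF //; apply/eqP; lia.
  by case: eqP => // _; rewrite ifF //; apply/eqP; lia.
apply: (wp_cif K5 (ltn0Sn _) w_big bl) => le.
  apply: (wp_out (i := n + i) _ r1 ds d1) => // [|s2 r2]; first lia.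
  by apply: HQ'; rewrite (minn_idPl le).
rewrite -ltnNge in le.
apply: (wp_out (i := n + i) _ r1 ds dm) => // [|_|s2 r2]; first lia.
  by apply: K_machine; lia.
by apply: HQ'; rewrite (minn_idPr (ltnW le)).
Qed.

Lemma wp_output x0 x1 x2 x3 x4 x5 x6 y0 y1 y2 y3 W U s Q :
  rep s [:: x0; x1; x2; x3; x4; x5; x6; a%:R; c%:R; y0; y1; y2; y3] W U -> is_table A U ->
  (forall s', s' 0%N = 1 -> s' 1%N = good_t m A b a c ->
     (forall l, (l < n)%N -> s' (2 + l)%N = good_x m A b a c l) ->
     (forall l, (l < n)%N -> s' (2 + (n + l))%N = (machine l)%:R) -> Q s') ->
  wp output Q s.
Proof.
move=> r0 tU HQ; have [tK aK cK] := K_good aN cN gd.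
apply: (wp_seq (ltn0Sn _)).
apply: (wp_pset _ r0 (den_pvar r0 (isT : (7 < 13)%N))) => // [_|s1 r1];
  first exact/K_small/ltnW.
apply: (wp_seq (ltn0Sn _)); rewrite /= in r1.
apply: (wp_pset _ r1 (den_pvar r1 (isT : (8 < 13)%N))) => // [_|s2 r2];
  first exact/K_small/ltnW.
apply: (wp_seq (ltn0Sn _)); rewrite /= in r2.
apply: (wp_compute_h r2) => // s3 h r3.
have D0 : det3 (V a) (V c) h != 0 by rewrite gt_eqF // (good_det_gt0 gd).
have dva s' tau' W' : rep s' (a%:R :: tau') W' U -> den3 s' (pvec (pvar 0)) (V a).
  by move=> r'; apply: (den_pvec r' tU aN); exact: den_pvar r' 0 isT.
have dvc s' tau' W' : rep s' [:: a%:R, c%:R & tau'] W' U -> den3 s' (pvec (pvar 1)) (V c).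
  by move=> r'; apply: (den_pvec r' tU cN); exact: den_pvar r' 1 isT.
have dh s' z0 z1 z2 tau' W' : rep s' [:: z0, z1, z2, h.1.1, h.1.2,
  h.2 & tau'] W' U -> den3 s' ph h.
  by move=> r'; split; [exact: den_pvar r' 3 isT | exact: den_pvar r' 4 isT | exact: den_pvar
    r' 5 isT].
apply: (wp_seq (ltn0Sn _)).
apply: (wp_pset (v := good_t m A b a c) _ r3) => // [|s4 r4].
  exact: den_div D0 (den_pdet (dva _ _ _ r3) (dvc _ _ _ r3) (den_prhs r3))
    (den_pdet (dva _ _ _ r3) (dvc _ _ _ r3) (dh _ _ _ _ _ _ r3)).
apply: (wp_seq (ltn0Sn _)); rewrite /= in r4.
apply: (wp_pset (v := good_xa m A b a c) _ r4) => // [|s5 r5].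
  exact: den_div D0 (den_pdet (den_prhs r4) (dvc _ _ _ r4) (dh _ _ _ _ _ _ r4))
    (den_pdet (dva _ _ _ r4) (dvc _ _ _ r4) (dh _ _ _ _ _ _ r4)).
apply: (wp_seq (ltn0Sn _)); rewrite /= in r5.
apply: (wp_pset (v := good_xc m A b a c) _ r5) => // [|s6 r6].
  exact: den_div D0 (den_pdet (dva _ _ _ r5) (den_prhs r5) (dh _ _ _ _ _ _ r5))
    (den_pdet (dva _ _ _ r5) (dvc _ _ _ r5) (dh _ _ _ _ _ _ r5)).
apply: (wp_seq (ltn0Sn _)); rewrite /= in r6.
apply: (wp_pset _ r6 (den_litn s6 (leq0n 32))) => // [_|s7 r7]; first exact: K0.
apply: (wp_seq (ltn0Sn _)); rewrite /= in r7.
pose t := good_t m A b a c.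
pose st k := [:: a%:R; c%:R; k%:R; h.1.1; h.1.2; h.2; x6; a%:R; c%:R; t;
                 good_xa m A b a c; good_xc m A b a c; (rank k)%:R].
pose I k s := exists W, [/\ rep s (st k) W U,
   forall l, (l < k)%N -> W l = (if sat a c l then t else 0) &
   forall l, (l < k)%N -> W (n + l)%N = (if sat a c l then rank l else 0%N)%:R].
apply: (wp_for_jobs (I := I) r7) => [s8 r8|k s8 [W8 [r8 _ _]]|k s8 kn [W8 [r8 x8 m8]]|s8 [W8
  [r8 x8 m8]]].
- by exists W; split=> //; rewrite /st /rank big_geq.
- by exists (st k), W8, U.
- have kN : (k < n.+3)%N by lia.
  have dk := den_pvar r8 (isT : (2 < 13)%N).
  have dS := bden_psaturated r8 tU (den_pvar r8 (isT : (0 < 13)%N))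
    (den_pvar r8 (isT : (1 < 13)%N)) dk aN cN kN.
  apply: (wp_cif K5 (ltn0Sn _) w_big dS) => Sk; apply: (wp_seq (ltn0Sn _)).
    apply: (wp_out (i := k) _ r8 (den_px dk) (den_pvar r8 (isT : (9 < 13)%N))) => // [|s9 r9];
      first lia.
    apply: (wp_seq (ltn0Sn _)).
    apply: (wp_out (i := n + k) _ r9 (den_psigma r9 (den_pvar r9 (isT : (2 < 13)%N)))
      (den_pvar r9 (isT : (12 < 13)%N))) => // [|_|s10 r10]; first lia.
      by apply: K_small; apply: leq_trans (rank_le k) _; lia.
    apply: (wp_pset _ r10 (den_succ (den_pvar r10 (isT : (12 < 13)%N)))) => // [_|s11 r11].
      by apply: K_small; apply: leq_ltn_trans (rank_le k) _; lia.
    rewrite /= in r11; eexists _, _, U; split; [exact: r11 | by [] | move=> s12 r12].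
    eexists; split; first by rewrite /st rankS Sk addn1; exact: r12.
      move=> l; rewrite ltnS leq_eqVlt /upd => /predU1P[->|lk].
        by rewrite ifF ?eqxx ?Sk //; apply/eqP; lia.
      by rewrite (ltn_eqF (ltn_addl n lk)) (ltn_eqF lk) x8.
    move=> l; rewrite ltnS leq_eqVlt /upd eqn_add2l => /predU1P[->|lk];
      first by rewrite eqxx Sk.
    by rewrite (ltn_eqF lk) (gtn_eqF (leq_trans kn (leq_addr l n))) m8.
  apply: (wp_out (i := k) _ r8 (den_px dk) (den_litn s8 (leq0n 32))) => // [|_|s9 r9];
    [lia | exact: K0 |].
  apply: (wp_out (i := n + k) _ r9 (den_psigma r9 (den_pvar r9 (isT : (2 < 13)%N)))
      (den_litn s9 (leq0n 32))) => // [|_|s10 r10]; [lia | exact: K0 |].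
  eexists _, _, U; split; [exact: r10 | by [] | move=> s12 r12].
  eexists; split; first by rewrite /st rankS (negPf Sk) addn0; exact: r12.
    move=> l; rewrite ltnS leq_eqVlt /upd => /predU1P[->|lk].
      by rewrite ifF ?eqxx ?(negPf Sk) //; apply/eqP; lia.
    by rewrite (ltn_eqF (ltn_addl n lk)) (ltn_eqF lk) x8.
  move=> l; rewrite ltnS leq_eqVlt /upd eqn_add2l => /predU1P[->|lk];
    first by rewrite eqxx (negPf Sk).
  by rewrite (ltn_eqF lk) (gtn_eqF (leq_trans kn (leq_addr l n))) m8.
apply: (wp_seq (ltn0Sn _)).
apply: (wp_place (k := 0) (i := a) (rk := rank n) _ _ r8 _ (den_pvar r8 (isT : (10 < 13)%N)))
  => //.
- by move=> s' r'; exact: den_pvar r' 12 isT.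
- by apply: K_small; apply: leq_trans (rank_le n) _; lia.
move=> s9 W9 r9 x9 m9; apply: (wp_seq (ltn0Sn _)).
apply: (wp_place (k := 1) (i := c) (rk := (rank n).+1) _ _ r9 _ (den_pvar r9 (isT : (11 <
  13)%N))) => //.
- by move=> s' r'; apply: den_succ; exact: den_pvar r' 12 isT.
- by apply: K_small; apply: leq_ltn_trans (rank_le n) _; lia.
move=> s10 W10 r10 x10 m10; apply: (wp_seq (ltn0Sn _)).
apply: (wp_assign _ K5 w_big (a := 1) (den_litn s10 (isT : (1 <= 32)%N)) (den_pvar r10 (isT :
  (9 < 13)%N))) => //.
apply: (wp_assign _ K5 w_big (a := 0) (den_litn _ (leq0n 32)) (den_litn _ (isT : (1 <=
  32)%N))) => [_|]; first exact: K1.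
have ac := good_neq gd.
apply: HQ => //.
- move=> l ln; rewrite !write_neq //; rewrite (rep_out r10); last lia.
  rewrite x10 // x9 // x8 // (good_xE gd) ln /=.
  by case: (eqVneq l c) => [->|_]; rewrite // eq_sym (negPf ac).
move=> l ln; rewrite !write_neq //; rewrite (rep_out r10); last lia.
rewrite m10 // m9 // m8 // /machine.
by case: (eqVneq l c) => [->|_]; rewrite 1?eq_sym ?(negPf ac) //; case: ifP.
Qed.

End Output.

Lemma wp_output_zero tau W U s Q : rep s tau W U ->
  (forall s', s' 0%N = 1 -> s' 1%N = 0 ->
     (forall l, (l < 2 * n)%N -> s' (2 + l)%N = 0) -> Q s') ->
  wp output_zero Q s.
Proof.
move=> r0 HQ; apply: (wp_seq (ltn0Sn _)).
pose I k s := exists tau W, [/\ rep s tau W U, nth 0 tau 2 = k%:R,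
   forall l, (l < k)%N -> W l = 0 & forall l, (l < k)%N -> W (n + l)%N = 0].
apply: (wp_for_jobs (I := I) r0) => [s1 r1|k s1 [tau1 [W1 [r1 E1 _ _]]]|k s1 kn [tau1 [W1 [r1
  E1 x1 m1]]]|s1 [tau1 [W1 [r1 _ x1 m1]]]].
- by eexists _, _; split; [exact: r1 | rewrite nth_set_nth | |].
- by exists tau1, W1, U.
- have dk := den_pvar r1 (isT : (2 < 13)%N); rewrite E1 in dk; apply: (wp_seq (ltn0Sn _)).
  apply: (wp_out (i := k) _ r1 (den_px dk) (den_litn s1 (leq0n 32))) => // [|_|s2 r2];
    [lia | exact: K0 |].
  have {}dk := den_pvar r2 (isT : (2 < 13)%N); rewrite E1 in dk.
  apply: (wp_out (i := n + k) _ r2 (den_psigma r2 dk) (den_litn s2 (leq0n 32))) => // [|_|s3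
    r3]; [lia | exact: K0 |].
  eexists tau1, _, U; split; [exact: r3 | by [] | move=> s4 r4].
  eexists _, _; split; [exact: r4 | by rewrite nth_set_nth | |] => l;
    rewrite ltnS leq_eqVlt /upd.
    by case/predU1P => [->|lk]; rewrite ?eqxx ?x1 // !if_same.
  by case/predU1P => [->|lk]; rewrite ?eqxx ?m1 // !if_same.
apply: (wp_seq (ltn0Sn _)).
apply: (wp_assign _ K5 w_big (a := 1) (den_litn s1 (isT : (1 <= 32)%N)) (den_litn s1 (leq0n
  32))) => [_|]; first exact: K0.
apply: (wp_assign _ K5 w_big (a := 0) (den_litn _ (leq0n 32)) (den_litn _ (isT : (1 <=
  32)%N))) => [_|]; first exact: K1.
apply: HQ => // l l2n; rewrite !write_neq // (rep_out r1) //.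
case: (ltnP l n) => ln; first exact: x1.
by rewrite -(subnKC ln) m1 //; lia.
Qed.

End Program.

(** * Verification of the coefficient table *)

Section FillTable.
Variables (m n : nat) (A : 'M[rat]_(2, n)) (b : 'cV[rat]_2).
Variables (K M0 w : nat).
Hypotheses (n0 : (0 < n)%N) (K5 : (5 <= K)%N) (w_big : (word K M0 <= w)%N).
Hypothesis (K_small : forall k, (k <= n.+3)%N -> bnd K k%:R).

Lemma wp_fill_table s W Q :
  rep m n b s (nseq 13 0) W (fun=> 0) ->
  (forall l : 'I_n, W l = A 0 l) -> (forall l : 'I_n, W (n + l)%N = A 1 l) ->
  (forall s' U, rep m n b s' [:: 0; 0; n%:R; 0; 0; 0; 0; 0; 0; 0; 0; 0; 0] W U ->
     is_table A U -> Q s') ->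
  wp K n.+3 M0 w fill_table Q s.
Proof.
move=> r0 WA0 WA1 HQ; apply: (wp_seq (ltn0Sn _)).
pose st k : seq rat := [:: 0; 0; k%:R; 0; 0; 0; 0; 0; 0; 0; 0; 0; 0].
pose filled k U := (forall i, (i < k)%N -> (U (3 * i)%N, U (1 + 3 * i)%N,
  U (2 + 3 * i)%N) = slc_vec A i)
  /\ (forall j, (3 * k <= j)%N -> U j = 0).
pose I k s := exists2 U, rep m n b s (st k) W U & filled k U.
have KN1 : bnd K (- 1) by apply/bndN/(K_small (k := 1)).
have dN1 s' : den s' (Lit (- 1)) (- 1) by apply: (den_lit s' (z := - 1)).
apply: (wp_for_jobs n0 K5 w_big K_small (I := I) r0) => [s1 r1|k s1 [U1 r1 _]|k s1 kn [U1 r1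
  [U1v U10]]|s1 [U1 r1 [U1v U10]]].
- by exists (fun=> 0).
- by exists (st k), W, U1.
- have dk s' U' : rep m n b s' (st k) W U' -> den s' (pvar 2) k%:R by move=> r';
  exact: den_pvar r' 2 isT.
  have Ek : slc_vec A k = (W k, W (n + k)%N, -1).
    by rewrite (WA0 (Ordinal kn)) (WA1 (Ordinal kn)); exact: slc_vec_job (Ordinal kn).
  apply: (wp_seq (ltn0Sn _)).
  have d1 : den s1 (Cell (pvar 2 +' Lit 2)) (W k).
    rewrite -(rep_out r1); last lia.
    by rewrite addnC; apply/den_cell/den_addn; [exact: dk r1 | exact: den_litn].
  apply: (wp_tab K5 w_big (k := 0) _ r1 (dk _ _ r1) d1) => // [|s2 r2].
    by move=> sK; rewrite -(rep_out r1); [exact: sK | lia].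
  apply: (wp_seq (ltn0Sn _)).
  have d2 : den s2 (Cell (pn +' pvar 2 +' Lit 2)) (W (n + k)%N).
    rewrite -(rep_out r2); last lia.
    rewrite addnC; apply/den_cell/den_addn; last exact: den_litn.
    by apply: den_addn; [exact: den_pn r2 | exact: dk r2].
  apply: (wp_tab K5 w_big (k := 1) _ r2 (dk _ _ r2) d2) => // [|s3 r3].
    by move=> sK; rewrite -(rep_out r2); [exact: sK | lia].
  apply: (wp_tab K5 w_big (k := 2) _ r3 (dk _ _ r3) (dN1 s3)) => // s4 r4.
  eexists _, W, _; split; [exact: r4 | by [] | move=> s5 r5].
  eexists; first exact: r5.
  split=> [i|j jk]; last first.
    by rewrite /upd !gtn_eqF ?U10 //; lia.
  rewrite ltnS leq_eqVlt => /predU1P[->|ik].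
    rewrite /upd eqxx !eqn_add2r /= Ek.
    by rewrite [_ == (2 + _)%N]ltn_eqF ?[_ == (1 + _)%N]ltn_eqF ?eqxx // ltn_add2r.
  by rewrite -U1v // /upd !ltn_eqF //; lia.
apply: (wp_seq (ltn0Sn _)).
apply: (wp_tab K5 w_big (k := 0) _ r1 (den_pn r1) (dN1 s1)) => // s2 r2.
apply: (wp_seq (ltn0Sn _)).
have d2 : den s2 (pn +' Lit 1) n.+1%:R.
  by rewrite -[n.+1]addn1; apply: den_addn; [exact: den_pn r2 | exact: den_litn].
apply: (wp_tab K5 w_big (k := 1) _ r2 d2 (dN1 s2)) => // s3 r3.
have d3 : den s3 (pn +' Lit 2) n.+2%:R.
  by rewrite -[n.+2]addn2; apply: den_addn; [exact: den_pn r3 | exact: den_litn].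
apply: (wp_tab K5 w_big (k := 2) _ r3 d3 (dN1 s3)) => // s4 r4.
apply: HQ r4 _ => i iN; case: (ltnP i n) => ni.
  by rewrite -U1v // /upd !ltn_eqF //; lia.
rewrite slc_vec_slack //; have /slack_cases/or3P[] : (n <= i < n.+3)%N by rewrite ni.
all: move/eqP->; rewrite !slack_eqF eqxx /upd; congr (_, _, _).
all: repeat (case: eqP => ?; [first [by [] | lia]|]).
all: by [rewrite U10 ?oppr0 //; lia | lia].
Qed.

End FillTable.

(** * The placement computed from a good pair *)

Section GoodPlacement.
Variables (m n : nat) (A : 'M[rat]_(2, n)) (b : 'cV[rat]_2) (a c : nat).
Hypotheses (m0 : (0 < m)%N) (aN : (a < n.+3)%N) (cN : (c < n.+3)%N) (gd : good m A b a c).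

Notation sat := (saturated A a c).
Notation rk := (rank A a c).
Notation F := (rk n).
Notation t := (good_t m A b a c).
Notation xa := (good_xa m A b a c).
Notation xc := (good_xc m A b a c).
Notation x := (good_x m A b a c).

Lemma rank_mono i j : (i <= j)%N -> (rk i <= rk j)%N.
Proof.
by move=> /subnKC <-; elim: (j - i)%N => [|k IH];
  rewrite ?addn0 // addnS rankS (leq_trans IH) ?leq_addr.
Qed.

Lemma rank_lt i j : sat i -> (i < j)%N -> (rk i < rk j)%N.
Proof. by move=> si ij; apply: leq_trans (rank_mono ij); rewrite rankS si addn1. Qed.

Lemma sum_good_x : \sum_(l < n) x l =
  F%:R * t + (if (a < n)%N then xa else 0) + (if (c < n)%N then xc else 0).
Proof.
have pick k (v : rat) : \sum_(l < n) (if val l == k then v else 0) = if (k < n)%N then v else 0.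
  case: ltnP => kn.
    rewrite (bigD1 (Ordinal kn)) //= eqxx big1 ?addr0 // => l lk.
    by rewrite ifF //; apply/negbTE; apply: contra lk => /eqP E; apply/eqP/val_inj.
  by rewrite big1 // => l _; rewrite ltn_eqF // (leq_trans (ltn_ord l)).
rewrite /good_x /spread; under eq_bigr do rewrite if_same addr0.
rewrite !big_split /= !pick; congr (_ + _ + _).
rewrite /rank big_mkord natr_sum mulr_suml; apply: eq_bigr => l _.
by rewrite ltn_ord /=; case: (sat l); rewrite ?mul1r ?mul0r.
Qed.

Lemma capacity : F%:R * t + (if (a < n)%N then xa else 0) + (if (c < n)%N then xc else 0) <=
  m%:R * t.
Proof.
rewrite -sum_good_x; have [_ + _ _ _] := good_lp_feasible aN cN gd.
by under eq_bigr do rewrite mxE.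
Qed.

Lemma rank_capacity : (F <= m)%N.
Proof.
have t0 := good_t_gt0 gd; have := capacity.
have := good_xa_ge0 gd; have := good_xc_ge0 gd => xc0 xa0 cap.
rewrite -(ler_nat rat) -(ler_pM2r t0); apply: le_trans cap.
by rewrite -addrA lerDl addr_ge0 //; case: ifP.
Qed.

Lemma machine_lt (l : 'I_n) : (machine m A a c l < m)%N.
Proof.
rewrite /machine; have := rank_capacity; case: eqP => _; first by lia.
case: eqP => _; first by lia.
by case: ifP => // sl; have := rank_lt sl (ltn_ord l); lia.
Qed.

Definition good_sigma : {ffun 'I_n -> 'I_m} := [ffun l => Ordinal (machine_lt l)].

(** When a and c share the last machine, capacity gives x_a + x_c <= t with both terms positive, so
    both jobs are partial and the full jobs are exactly the saturated ones. Otherwise a or c may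
    itself have length t, and the assignment is shown injective on jobs of positive time. *)
Lemma good_sigma_placement : placement (\col_(l < n) x l) t good_sigma.
Proof.
have t0 := good_t_gt0 gd; have Fm := rank_capacity; have cap := capacity.
have xa0 := good_xa_ge0 gd; have xc0 := good_xc_ge0 gd; have ac := good_neq gd.
have xE := good_xE gd.
have sigma_eq i j : good_sigma i = good_sigma j -> machine m A a c i = machine m A a c j.
  by move=> /(congr1 val); rewrite !ffunE.
have pos_cases (i : 'I_n) : 0 < x i -> [\/ val i = a /\ 0 < xa,
  val i = c /\ 0 < xc | [/\ sat i, val i != a & val i != c]].
  rewrite xE; case: (eqVneq (val i) a) => [ia h|ia]; first by constructor 1.
  case: (eqVneq (val i) c) => [ic h|ic]; first by constructor 2.
  by case: ifP => [/andP[_ si] _|]; [constructor 3 | rewrite ltxx].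
have satE (i : 'I_n) : sat i -> machine m A a c i = rk i.
  by move=> si; rewrite /machine si; case: (sat_neq si) => /negPf-> /negPf->.
have aE (i : 'I_n) : val i = a -> machine m A a c i = minn F m.-1 by rewrite /machine => ->;
  rewrite eqxx.
have cE (i : 'I_n) : val i = c -> machine m A a c i = minn F.+1 m.-1.
  by rewrite /machine => ->; rewrite eqxx eq_sym (negPf ac).
have satF (i : 'I_n) : sat i -> (rk i < F)%N by move=> si; exact: rank_lt.
have rk_inj (i j : 'I_n) : sat i -> sat j -> rk i = rk j -> i = j.
  move=> si sj E; apply: val_inj; case: (ltngtP i j) => // ij.
    by have := rank_lt si ij; rewrite E ltnn.
  by have := rank_lt sj ij; rewrite E ltnn.
have lt_m (v : rat) k : 0 < v -> k%:R * t + v <= m%:R * t -> (k < m)%N.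
  move=> v0 le; rewrite -(ltr_nat rat) -(ltr_pM2r t0); apply: lt_le_trans le; by rewrite ltrDl.
have aF : (a < n)%N -> 0 < xa -> (F < m)%N.
  move=> an xap; apply: (lt_m xa) => //; move: cap; rewrite an; case: ifP => _; lra.
have cF : (c < n)%N -> 0 < xc -> (F < m)%N.
  move=> cn xcp; apply: (lt_m xc) => //; move: cap; rewrite cn; case: ifP => _; lra.
case: (boolP [&& (a < n)%N, (c < n)%N, 0 < xa, 0 < xc & (F == m.-1)%N]) => [|nboth].
  case/and5P=> an cn xap xcp /eqP FE; rewrite an cn FE in cap.
  have mE : m%:R = m.-1%:R + 1 :> rat by rewrite natr1 prednK.
  have xact : xa + xc <= t by move: cap; rewrite mE mulrDl mul1r; lra.
  have fullE (i : 'I_n) : (i \in full_jobs (\col_(l < n) x l) t) = sat i.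
    rewrite inE !mxE; case: (boolP (sat i)) => [si|nsi].
      rewrite xE; have [/negPf-> /negPf->] := sat_neq si.
      by rewrite ltn_ord si /= t0 eqxx.
    rewrite xE (negPf nsi) andbF; case: eqP => _; first by rewrite lt_eqF ?andbF //; lra.
    by case: eqP => _; [rewrite lt_eqF ?andbF //; lra | rewrite ltxx].
  apply: placement_one_idle => //.
  - rewrite -FE /rank big_mkord -sum1_card [LHS]big_mkcond; apply: eq_bigr => i _.
    by rewrite fullE; case: (sat i).
  - move=> i j; rewrite !fullE => si sj /sigma_eq; rewrite !satE //; exact: rk_inj.
  - by move=> i _; rewrite mxE good_x_le.
  move=> i j; rewrite fullE => si; rewrite inE !mxE => /andP[xj xjt].
  apply: contraTneq (satF i si) => /sigma_eq; rewrite satE // => ->.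
  case: (pos_cases j xj) => [[ja _]|[jc _]|[sj ja jc]].
  - by rewrite aE // FE minnn ltnn.
  - by rewrite cE // FE (minn_idPr (leqnSn _)) ltnn.
  - by move: xjt; rewrite xE (negPf ja) (negPf jc) ltn_ord sj ltxx.
(* F < m and F differs from m - 1, so neither cap is active. *)
have ac_lt : (a < n)%N -> (c < n)%N -> 0 < xa -> 0 < xc -> (F.+1 < m)%N.
  move=> an cn xap xcp; move: nboth; rewrite an cn xap xcp /=; have := aF an xap; lia.
apply: placement_inj => i j; rewrite !mxE => /pos_cases ip /pos_cases jp /sigma_eq.
case: ip => [[ia xi]|[ic xi]|[si _ _]]; case: jp => [[ja xj]|[jc xj]|[sj _ _]].
- by move=> _; apply: val_inj; rewrite ia ja.
- rewrite aE // cE // => E.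
  have := ac_lt; rewrite -{1}ia -{1}jc !ltn_ord => /(_ isT isT xi xj); move: E; clear; lia.
- rewrite aE // satE // => E; have := satF _ sj; have := aF;
  rewrite -{1}ia ltn_ord => /(_ isT xi).
  by move: E; clear; lia.
- rewrite cE // aE // => E.
  have := ac_lt; rewrite -{1}ja -{1}ic !ltn_ord => /(_ isT isT xj xi); move: E; clear; lia.
- by move=> _; apply: val_inj; rewrite ic jc.
- rewrite cE // satE // => E; have := satF _ sj; have := cF;
  rewrite -{1}ic ltn_ord => /(_ isT xi).
  by move: E; clear; lia.
- rewrite satE // aE // => E; have := satF _ si; have := aF;
  rewrite -{1}ja ltn_ord => /(_ isT xj).
  by move: E; clear; lia.
- rewrite satE // cE // => E; have := satF _ si; have := cF;
  rewrite -{1}jc ltn_ord => /(_ isT xj).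
  by move: E; clear; lia.
- by rewrite !satE //; exact: rk_inj.
Qed.

End GoodPlacement.

(** * Bit lengths of stored values and correctness of the program *)

Section Bounds.
Variables (m n : nat) (A : 'M[rat]_(2, n)) (b : 'cV[rat]_2).
Hypotheses (m0 : (0 < m)%N) (n0 : (0 < n)%N).

Let inst := slc_encode m A b.
Let L := bit_length inst.

Lemma encodeE : inst = [:: n%:R; m%:R] ++
  ([seq A 0 i | i <- enum 'I_n] ++ [seq A 1 i | i <- enum 'I_n]) ++ [:: b 0 0; b 1 0].
Proof.
rewrite /inst /slc_encode; congr (_ ++ (_ ++ _)).
  rewrite /allpairs_dep enum_ordSl enum_ordSl enum_ord0 /= cats0.
  by have -> : lift ord0 ord0 = 1 :> 'I_2 by apply: val_inj.
rewrite enum_ordSl enum_ordSl enum_ord0 /=.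
by have -> : lift ord0 ord0 = 1 :> 'I_2 by apply: val_inj.
Qed.

Lemma bit_lengthE : L = (rat_bits n%:R + (rat_bits m%:R + (\sum_i rat_bits (A 0%R i) +
  \sum_i rat_bits (A 1%R i) + (rat_bits (b 0%R 0%R) + rat_bits (b 1%R 0%R)))))%N.
Proof.
rewrite /L /bit_length encodeE !big_cat !big_map -!enumT !big_enum !big_cons !big_nil.
by rewrite /= !addn0 -!addnA.
Qed.

Lemma size_row r : size [seq A r i | i <- enum 'I_n] = n.
Proof. by rewrite size_map size_enum_ord. Qed.

Lemma nth_row r (l : 'I_n) : nth 0 [seq A r i | i <- enum 'I_n] l = A r l.
Proof. by rewrite (nth_map l) ?size_enum_ord // nth_ord_enum. Qed.

Lemma size_inst : size inst = (2 * n + 4)%N.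
Proof. by rewrite encodeE !size_cat !size_row /=; lia. Qed.

Lemma nth_inst_row0 (l : 'I_n) : nth 0 inst (2 + l) = A 0 l.
Proof.
rewrite encodeE nth_cat [size _]/= (ltnNge (2 + l)) leq_addr [~~ _]/= addKn.
by rewrite nth_cat size_cat !size_row ltn_addr // nth_cat size_row ltn_ord nth_row.
Qed.

Lemma nth_inst_row1 (l : 'I_n) : nth 0 inst (2 + (n + l)) = A 1 l.
Proof.
rewrite encodeE nth_cat [size _]/= (ltnNge (2 + _)) leq_addr [~~ _]/= addKn.
rewrite nth_cat size_cat !size_row ltn_add2l ltn_ord nth_cat size_row.
by rewrite ltnNge leq_addr [~~ _]/= addKn nth_row.
Qed.

Lemma nth_inst_rhs : nth 0 inst (2 * n + 2) = b 0 0 /\ nth 0 inst (2 * n + 3) = b 1 0.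
Proof.
have E k : nth 0 inst (2 * n + k.+2) = nth 0 [:: b 0 0; b 1 0] k.
  have -> : (2 * n + k.+2 = 2 + (n + n + k))%N by lia.
  rewrite encodeE nth_cat [size _]/= (ltnNge (2 + _)) leq_addr [~~ _]/= addKn.
  by rewrite nth_cat size_cat !size_row ltnNge leq_addr [~~ _]/= addKn.
by rewrite !E.
Qed.

Lemma rep_init : rep m n b (init_memory inst) (nseq 13 0) (fun i => nth 0 inst (2 + i)) (fun=>
  0).
Proof.
split; rewrite /init_memory.
- by rewrite encodeE.
- by rewrite encodeE.
- by have [-> _] := nth_inst_rhs.
- by have [_ ->] := nth_inst_rhs.
- by move=> k k13; rewrite nth_default ?nth_nseq ?k13 // size_inst; lia.
- by [].
- by move=> i; rewrite nth_default // size_inst; lia.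
Qed.

Lemma n_le_L : (n <= L)%N.
Proof.
have : (n <= \sum_i rat_bits (A 0%R i))%N.
  rewrite -[n in (n <= _)%N]card_ord -sum1_card; apply: leq_sum => i _; exact: rat_bits_gt0.
by rewrite bit_lengthE; lia.
Qed.

Lemma L_gt0 : (0 < L)%N. Proof. by apply: leq_trans n0 n_le_L. Qed.

Lemma bnd_L v : (rat_bits v <= L)%N -> bnd L v.
Proof. by move=> vL; apply: bnd_le (bits_bnd v); lia. Qed.

Lemma bnd_A r l : bnd L (A r l).
Proof.
apply: bnd_L; have : (rat_bits (A r l) <= \sum_i rat_bits (A r i))%N by rewrite (bigD1 l) //=
  leq_addr.
by rewrite bit_lengthE; case: (ord2P r) => ->; lia.
Qed.

Lemma bnd_m : bnd L m%:R. Proof. by apply: bnd_L; rewrite bit_lengthE; lia. Qed.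
Lemma bnd_b r : bnd L (b r 0).
Proof. by apply: bnd_L; rewrite bit_lengthE; case: (ord2P r) => ->; lia. Qed.

Lemma m_le : (m <= 2 ^ L)%N.
Proof.
have mL : (nat_bits m <= L)%N.
  have : (rat_bits m%:R <= L)%N by rewrite bit_lengthE; lia.
  by apply: leq_trans; rewrite /rat_bits -[m%:R]/((m : int)%:~R : rat) numq_int absz_nat
    -addSn; apply: leq_trans (leq_addr _ _).
by apply: leq_trans (_ : 2 ^ nat_bits m <= _)%N; rewrite ?leq_exp2l // ltnW // trunc_log_ltn.
Qed.

Definition row_coef (r : 'I_2) (l : nat) : rat :=
  if r == 0 then (slc_vec A l).1.1 else (slc_vec A l).1.2.

(** An entry of bit length r has exponent r - 1 and an addition costs 1, so the exponent of a sum is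
    at most the total bit length of the row. *)
Lemma bnd_sum_row r (S : pred nat) k : (k <= n)%N ->
  bnd L (\sum_(0 <= l < k | S l) row_coef r l).
Proof.
move=> kn; pose rb l := if insub l is Some l' then rat_bits (A r (l' : 'I_n)) else 0%N.
have rbE (l : 'I_n) : rb l = rat_bits (A r l) by rewrite /rb valK.
have step j : (j <= n)%N -> bnd (\sum_(0 <= l < j) rb l)%N (\sum_(0 <= l < j | S l) row_coef r
  l).
  elim: j => [|j IH] jn; first by rewrite !big_geq //; apply: (bnd_nat (a := 0)).
  rewrite big_nat_recr //= [X in bnd _ X]sum_nat_recr_cond (rbE (Ordinal jn)).
  have bj : bnd (rat_bits (A r (Ordinal jn))).-1 (if S j then row_coef r j else 0).
    case: ifP => _; last by apply: (bnd_nat (a := 0)).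
    rewrite /row_coef (slc_vec_job A (Ordinal jn)) /=.
    by case: (ord2P r) => ->; exact: bits_bnd.
  apply: bnd_le (bndD (IH (ltnW jn)) bj).
  by rewrite -addnS prednK // rat_bits_gt0.
apply: bnd_le (step k kn); rewrite bit_lengthE.
have : (\sum_(0 <= l < k) rb l <= \sum_i rat_bits (A r i))%N.
  have -> : (\sum_i rat_bits (A r i) = \sum_(0 <= l < n) rb l)%N.
    by rewrite big_mkord; apply: eq_bigr => l _; rewrite rbE.
  by rewrite (@big_cat_nat _ _ _ k 0 n) /= ?leq_addr.
by case: (ord2P r) => ->; lia.
Qed.

Definition bnd3 k (v : vec3 rat) := [/\ bnd k v.1.1, bnd k v.1.2 & bnd k v.2].

Lemma bnd_h_part (S : pred nat) k : (k <= n)%N -> bnd3 (2 * L + 1) (h_part m A S k).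
Proof.
move=> kn; split; rewrite /=.
- by apply: bnd_le (bnd_sum_row 0 S kn); lia.
- by apply: bnd_le (bnd_sum_row 1 S kn); lia.
have step j : (j <= n)%N -> bnd j (\sum_(0 <= l < j | S l) (slc_vec A l).2).
  elim: j => [|j IH] jn; first by rewrite big_geq //; apply: (bnd_nat (a := 0)).
  rewrite sum_nat_recr_cond.
  have bj : bnd 0 (if S j then (slc_vec A j).2 else 0).
    case: ifP => _; last by apply: (bnd_nat (a := 0)).
    by rewrite (slc_vec_job A (Ordinal jn)); apply/bndN/(bnd_nat (a := 1)).
  by have := bndD (IH (ltnW jn)) bj; rewrite addn0.
apply: bnd_le (bndD bnd_m (step k kn)).
by have := n_le_L; lia.
Qed.

Lemma bnd_slc_vec i : bnd3 L (slc_vec A i).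
Proof.
rewrite /slc_vec; case: insubP => [l _ _|_].
  by split=> /=; try exact: bnd_A; apply: bnd_le (leq0n _) (bndN (bnd_nat (a := 1) _)).
have bb (e : bool) : bnd L (- e%:R).
  by apply: bnd_le (leq0n _) (bndN (bnd_nat _)); case: e.
by split; exact: bb.
Qed.

(** Exponent 4 k + 1 for an entry of the cross product, 5 k + 1 after multiplication by w, and 15 k
    + 5 for the sum of three such terms. *)
Lemma bnd_det3 k u v w : bnd3 k u -> bnd3 k v -> bnd3 k w -> bnd (15 * k + 5) (det3 u v w).
Proof.
case=> u1 u2 u3 [v1 v2 v3] [w1 w2 w3].
have c1 := bndB (bndM u2 v3) (bndM u3 v2); have c2 := bndB (bndM u3 v1) (bndM u1 v3).
have c3 := bndB (bndM u1 v2) (bndM u2 v1).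
have := bndD (bndD (bndM c1 w1) (bndM c2 w2)) (bndM c3 w3).
by apply: bnd_le; lia.
Qed.

(** A quotient of two determinants at k = 2 L + 1 has exponent 60 L + 40 <= 100 L, as L > 0; this is
    the origin of the cell bound 100 L. *)
Lemma bnd_good a c : good m A b a c ->
  [/\ bnd (100 * L) (good_t m A b a c), bnd (100 * L) (good_xa m A b a c) &
      bnd (100 * L) (good_xc m A b a c)].
Proof.
move=> gd; have D0 : det3 (slc_vec A a) (slc_vec A c) (t_col m A (saturated A a c)) != 0.
  by rewrite gt_eqF // (good_det_gt0 gd).
have le3 u : bnd3 L u -> bnd3 (2 * L + 1) u.
  by case=> ? ? ?; split; apply: bnd_le (_ : bnd L _) => //; lia.
have Va := le3 _ (bnd_slc_vec a); have Vc := le3 _ (bnd_slc_vec c).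
have H : bnd3 (2 * L + 1) (t_col m A (saturated A a c)) := bnd_h_part _ (leqnn n).
have G : bnd3 (2 * L + 1) (slc_rhs b).
  by apply: le3; split; rewrite /slc_rhs /=; try exact: bnd_b; apply: (bnd_nat (a := 0)).
have L0 := L_gt0; have bD := bnd_det3 Va Vc H.
have fin v : bnd (15 * (2 * L + 1) + 5) v ->
    bnd (100 * L) (v / det3 (slc_vec A a) (slc_vec A c) (t_col m A (saturated A a c))).
  by move=> bv; apply: bnd_le (bnd_div D0 bv bD); lia.
by split; apply: fin; exact: bnd_det3.
Qed.

Lemma mem_bnd_init : mem_bnd (100 * L) (init_memory inst).
Proof.
move=> i; rewrite /init_memory; case: (ltnP i (size inst)) => [i_s|le]; last first.
  by rewrite nth_default //; apply: bnd_le (leq0n _) (bnd_nat (a := 0) _).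
apply: bnd_le (_ : bnd L _); first by lia.
apply: bnd_L; rewrite /L /bit_length (big_rem (nth 0 inst i)) ?mem_nth //=.
exact: leq_addr.
Qed.

Lemma slc_prog_correct w : (word (100 * L) (maxcost slc_prog) <= w)%N ->
  exists T s, [/\ exec w slc_prog (init_memory inst) T s,
    (T <= tfactor slc_prog * n.+3 ^ depth slc_prog)%N &
    (exists (x : 'cV[rat]_n) (t : rat) (sigma : {ffun 'I_n -> 'I_m}),
       [/\ outputs_schedule s x t sigma, lp_optimal_bfs m A b x t & placement x t sigma])
    \/ outputs_infeasible s /\ ~ (exists x : 'cV[rat]_n, slc_feasible A b x)].
Proof.
move=> w_big; pose Post s := (exists (x : 'cV[rat]_n) (t : rat) (sigma : {ffun 'I_n -> 'I_m}),
       [/\ outputs_schedule s x t sigma, lp_optimal_bfs m A b x t & placement x t sigma])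
    \/ outputs_infeasible s /\ ~ (exists x : 'cV[rat]_n, slc_feasible A b x).
have L0 := L_gt0; have nL := n_le_L.
have K5 : (5 <= 100 * L)%N by lia.
have K_small k : (k <= n.+3)%N -> bnd (100 * L) k%:R.
  move=> kn; have kK : (k <= 100 * L)%N by lia.
  exact: bnd_le kK (bnd_nat (ltnW (ltn_expl k (ltnSn 1)))).
have K_machine k : (k <= m)%N -> bnd (100 * L) k%:R.
  move=> km; have LK : (L <= 100 * L)%N by lia.
  exact: bnd_le LK (bnd_nat (leq_trans km m_le)).
have K_h S k : (k <= n)%N -> bnd3 (100 * L) (h_part m A S k).
  have LK : (2 * L + 1 <= 100 * L)%N by lia.
  by case/(bnd_h_part S) => h1 h2 h3; split;
    [exact: bnd_le LK h1 | exact: bnd_le LK h2 | exact: bnd_le LK h3].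
have K_good a c : (a < n.+3)%N -> (c < n.+3)%N -> good m A b a c ->
  [/\ bnd (100 * L) (good_t m A b a c), bnd (100 * L) (good_xa m A b a c) &
      bnd (100 * L) (good_xc m A b a c)] by move=> _ _; exact: bnd_good.
suff : wp (100 * L) n.+3 (maxcost slc_prog) w slc_prog Post (init_memory inst).
  rewrite wpE => /(_ (leqnn _) mem_bnd_init)[T [s [ex tT _ res]]].
  exact: (ex_intro _ T (ex_intro _ s (And3 ex tT res))).
move: (maxcost slc_prog) w_big => M0 w_big.
apply: (wp_seq (ltn0Sn _)).
apply: (wp_fill_table (A := A) n0 K5 w_big K_small rep_init nth_inst_row0 nth_inst_row1) => s
  U r1 tU.
have b0P : (b 0 0 <= 0) && (b 1 0 <= 0) -> forall r, b r 0 <= 0.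
  by case/andP=> h0 h1 r; case: (ord2P r) => ->.
have db0 : den s (Cell (paddr 2)) (b 0 0) by have [] := den_prhs r1.
have db1 : den s (Cell (paddr 3)) (b 1 0) by have [] := den_prhs r1.
have db := bden_and (bden_le db0 (den_litn s (leq0n 32))) (bden_le db1 (den_litn s (leq0n 32))).
apply: (wp_cif K5 (ltn0Sn _) w_big db) => [/b0P b0|b0].
  apply: (wp_output_zero n0 K5 w_big K_small r1) => s' s0 s1 sz; left.
  exists 0, 0, [ffun=> Ordinal m0]; split; last first.
  - by apply: placement_inj => i j; rewrite mxE ltxx.
  - exact: zero_lp_optimal_bfs.
  split=> // i; first by rewrite mxE sz //; have := ltn_ord i; lia.
  by rewrite ffunE -addnA sz //; have := ltn_ord i; lia.
apply: (wp_seq (ltn0Sn _)).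
apply: (wp_search n0 K5 w_big K_small K_machine K_h r1 tU) => s2 i y.
case=> z2 [z3 [z4 [z5 [fl [fa [fc [r2 f2]]]]]]].
have df := bden_le (den_pvar r2 (isT : (6 < 13)%N)) (den_litn s2 (leq0n 32)).
apply: (wp_cif K5 (ltn0Sn _) w_big df) => /= fl0.
  have no : forall a c, (c < n.+3)%N -> (a < n.+3)%N -> ~~ good m A b a c.
    by case: f2 => [[a [c [E _ _ _]]]|[_ //]]; rewrite E in fl0.
  apply: (wp_assign _ K5 w_big (a := 0) (den_litn s2 (leq0n 32)) (den_litn s2 (leq0n 32))) =>
    [_|].
    exact: (K_small 0%N).
  right; split=> // feas.
  have [|a [c [aN cN gd]]] := exists_good m0 feas.
    by move=> b0'; move/negP: b0; apply; rewrite !b0'.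
  by have := no a c cN aN; rewrite gd.
case: f2 => [[a [c [_ Ea Ec [aN cN gd]]]]|[E _]]; last by rewrite E lexx in fl0.
rewrite Ea Ec in r2.
apply: (wp_output n0 K5 w_big K_small K_machine K_h K_good aN cN gd m0 r2 tU) => s3 s30 s31 sx
  sm.
left; exists (\col_(l < n) good_x m A b a c l), (good_t m A b a c), (good_sigma m0 aN cN gd).
split; [| exact: good_lp_optimal_bfs | exact: good_sigma_placement].
split=> // l; first by rewrite mxE sx.
by rewrite ffunE -addnA sm.
Qed.

End Bounds.

Theorem theorem5 :
  (* the LP-based algorithm is well defined and optimal, for real data *)
  (forall (R : realFieldType) (m n : nat) (A : 'M[R]_(2, n)) (b : 'cV[R]_2),
     (0 < m)%N ->
     ((exists x : 'cV[R]_n, slc_feasible A b x) ->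
      exists (x : 'cV[R]_n) (t : R), lp_optimal_bfs m A b x t)
     /\
     forall (x : 'cV[R]_n) (t : R), lp_optimal_bfs m A b x t ->
       [/\ (#|partial_jobs x t| <= 2)%N,
           exists sigma : {ffun 'I_n -> 'I_m}, placement x t sigma &
           forall sigma : {ffun 'I_n -> 'I_m}, placement x t sigma ->
             makespan x sigma = t /\ slc_optimal m A b x sigma])
  /\
  (* it can be carried out in O(n^4 L) time, for rational data of bit length L *)
  (exists (prog : cmd) (C : nat),
   forall (m n : nat) (A : 'M[rat]_(2, n)) (b : 'cV[rat]_2),
     (0 < m)%N -> (0 < n)%N ->
     let inst := slc_encode m A b in
     let L := bit_length inst in
     exists (T : nat) (s : memory),
       [/\ exec (C * L) prog (init_memory inst) T s,
           (T <= C * (n ^ 4 * L))%N,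
           (exists x : 'cV[rat]_n, slc_feasible A b x) ->
             exists (x : 'cV[rat]_n) (t : rat) (sigma : {ffun 'I_n -> 'I_m}),
               [/\ outputs_schedule s x t sigma,
                   lp_optimal_bfs m A b x t,
                   placement x t sigma &
                   makespan x sigma = t /\ slc_optimal m A b x sigma] &
           ~ (exists x : 'cV[rat]_n, slc_feasible A b x) ->
             outputs_infeasible s]).
Proof.
split=> [R m n A b m0|].
  split=> [|x t [opt bfs]]; first exact: exists_lp_optimal_bfs.
  have [[_ sx xt x0 t0] _] := opt; have p2 := bfs_partial_jobs t0 xt bfs.
  split=> // [|sigma]; first exact: exists_placement.
  exact: placement_makespan.
(* 256 = 4^4 comes from n + 3 <= 4 n. With M the maximal expression cost, the required word size 2 M
   (100 L + 1) + 3 is at most 205 (M + 1) L. *)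
exists slc_prog, (256 * tfactor slc_prog + 205 * (maxcost slc_prog).+1)%N.
move=> m n A b m0 n0 inst L; have L0 : (0 < L)%N by exact: L_gt0.
have [|T [s [ex tT res]]] := @slc_prog_correct m n A b m0 n0
    ((256 * tfactor slc_prog + 205 * (maxcost slc_prog).+1) * L)%N.
  rewrite /word -/inst -/L; move: (tfactor _) (maxcost _) => tf M0; nia.
exists T, s; split; first exact: ex.
- apply: leq_trans tT _; have dp := depth_slc_prog.
  have le1 : (n.+3 ^ depth slc_prog <= 256 * n ^ 4)%N.
    apply: leq_trans (_ : (4 * n) ^ 4 <= _)%N; last by rewrite expnMn.
    apply: leq_trans (_ : n.+3 ^ 4 <= _)%N; first by rewrite leq_exp2l.
    by rewrite leq_exp2r //; lia.
  move: (tfactor _) (maxcost _) => tf M0; apply: leq_trans (leq_mul (leqnn tf) le1) _.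
  rewrite mulnA [(tf * 256)%N]mulnC.
  by apply: leq_mul; [exact: leq_addr | exact: leq_pmulr].
- move=> feas; case: res => [[x [t [sigma [out opt pl]]]]|[_ /(_ feas)//]].
  by exists x, t, sigma; split=> //; case: opt => opt _; exact: placement_makespan.
(* A solution of the linear program contains feasible processing times, so no schedule can have been
   output. *)
move=> infeas; case: res => [[x [t [sigma [_ [[[Ax _ _ x0 _] _] _] _]]]]|[//]].
by case: infeas; exists x.
Qed.
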